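(* Let $\mathbf d$ be a graphical degree sequence with maximum degree $d_{\max}=\mathcal O\left(m^{1/4-\tau}\right)$ for some $\tau>0$. Let $G_{\mathbf d}$ be a simple digraph obeying this degree sequence. Then the sequential stub matching algorithm (described in the context) applied to $\mathbf d$ generates $G_{\mathbf d}$ with probability $$\mathbb P\left[G_{\mathbf d}\right]=\left(1+o(1)\right)\, m!\,\frac{\prod_{i=1}^n d_i^+!\,\prod_{i=1}^n d_i^-!}{\prod_{r=0}^{m-1}(m-r)^2}\;\exp\left(\frac{\sum_{i=1}^n d_i^-d_i^+}{m}-\frac{\sum_{i=1}^n\left((d_i^-)^2+(d_i^+)^2\right)}{2m}+\frac{\sum_{i=1}^n(d_i^-)^2\,\sum_{i=1}^n(d_i^+)^2}{2m^2}+\frac12\right).$$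
   Context: A degree sequence on $n$ vertices is $\mathbf d=\{(d_i^-,d_i^+)\}_{i=1}^n$ with nonnegative integer entries ($d_i^-$ the in-degree, $d_i^+$ the out-degree of vertex $i$) and $m=\sum_i d_i^-=\sum_i d_i^+$ (the number of edges). Its maximum degree is $d_{\max}=\max\{\max_i d_i^-,\max_i d_i^+\}$. A directed graph is simple if it has no self-loops and no parallel edges with identical orientation (both $(i,j)$ and $(j,i)$ may be present). It obeys $\mathbf d$ if each vertex $i$ has in-degree $d_i^-$ and out-degree $d_i^+$; $\mathbf d$ is graphical if some simple digraph obeys it. Degree sequences have no isolated vertices ($d_i^-+d_i^+\ge 1$ for all $i$). Asymptotic notation is understood along a sequence $\{\mathbf d_n\}_{n\in\mathbb N}$ of such degree sequences indexed by the number of vertices $n\to\infty$, with $m=m_n$ and $d_{\max}=d_{\max,n}$, and for an arbitrary choice of simple digraph obeying each $\mathbf d_n$. Sequential stub matching algorithm (Algorithm 1). Input: a graphical degree sequence $\mathbf d$ without isolated nodes. Set $V=\{1,\dots,n\}$, $E=\emptyset$, residual degrees $\hat d_i^{\pm}=d_i^{\pm}$. While an edge can be added, i.e. while there is an ordered pair $(i,j)$ with $i\ne j$, $(i,j)\notin E$, $\hat d_i^+>0$ and $\hat d_j^->0$: pick a pair $(i,j)$, among all ordered pairs with $i\neq j$ and $(i,j)\notin E$, with probability proportional to $\hat d_i^+\hat d_j^-\left(1-\frac{d_i^+d_j^-}{2m}\right)$; add $(i,j)$ to $E$ and decrease $\hat d_i^+$ and $\hat d_j^-$ by $1$. When no edge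 can be added: if $|E|=m$, return the digraph $(V,E)$; otherwise return ''failure''. *)

(* Defs.v *)
From HB Require Import structures.
From mathcomp Require Import all_boot all_order all_algebra.
From mathcomp Require Import all_classical all_reals all_analysis.
Set Implicit Arguments.
Unset Strict Implicit.
Unset Printing Implicit Defensive.
Import Order.TTheory GRing.Theory Num.Theory.
Import numFieldNormedType.Exports.
Local Open Scope ring_scope.

(* The vertices 1, ..., n are represented by the elements of 'I_n. *)
Record degseq (n : nat) := DegSeq {
  din : 'I_n -> nat;
  dout : 'I_n -> nat;
  din_dout_sum : (\sum_i din i = \sum_i dout i)%N
}.

Definition nedges n (d : degseq n) : nat := (\sum_i din d i)%N.

Definition dmax n (d : degseq n) : nat :=
  maxn (\max_i din d i)%N (\max_i dout d i)%N.

Definition no_isolated n (d : degseq n) : Prop :=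
  forall i, (1 <= din d i + dout d i)%N.

(* A digraph on 'I_n is its set of ordered edges (tail, head); since this is a
   set, parallel edges with identical orientation are excluded. *)
Definition digraph (n : nat) : finType := {set 'I_n * 'I_n}.

Definition simple_digraph n (G : digraph n) : Prop :=
  forall i, (i, i) \notin G.

Definition indegree n (G : digraph n) (j : 'I_n) : nat :=
  #|[set i | (i, j) \in G]%SET|.

Definition outdegree n (G : digraph n) (i : 'I_n) : nat :=
  #|[set j | (i, j) \in G]%SET|.

Definition obeys n (G : digraph n) (d : degseq n) : Prop :=
  forall i, indegree G i = din d i /\ outdegree G i = dout d i.

Definition graphical n (d : degseq n) : Prop :=
  exists G : digraph n, simple_digraph G /\ obeys G d.

Record state (n : nat) := State {
  edges : {set 'I_n * 'I_n};
  res_out : 'I_n -> nat;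
  res_in : 'I_n -> nat
}.

Definition init_state n (d : degseq n) : state n :=
  State finset.set0 (dout d) (din d).

Definition add_edge n (s : state n) (e : 'I_n * 'I_n) : state n :=
  State (e |: edges s)%SET
        (fun i => res_out s i - (i == e.1))%N
        (fun j => res_in s j - (j == e.2))%N.

Definition eligible n (s : state n) (e : 'I_n * 'I_n) : bool :=
  (e.1 != e.2) && (e \notin edges s).

Definition can_add n (s : state n) (e : 'I_n * 'I_n) : bool :=
  [&& eligible s e, (0 < res_out s e.1)%N & (0 < res_in s e.2)%N].

Section Algorithm.
Variables (R : realType) (n : nat) (d : degseq n).

Definition weight (s : state n) (e : 'I_n * 'I_n) : R :=
  (res_out s e.1)%:R * (res_in s e.2)%:R *
  (1 - (dout d e.1)%:R * (din d e.2)%:R / (2 * (nedges d)%:R)).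

Definition pick_prob (s : state n) (e : 'I_n * 'I_n) : R :=
  weight s e / \sum_(e' | eligible s e') weight s e'.

(* [run_prob k s o] is the probability that the algorithm, started in state s,
   halts after at most k iterations with outcome o, where [Some G] stands for
   returning G and [None] for "failure".  The weights are nonnegative as soon as
   d_i^+ d_j^- <= 2m for all i, j, which holds for all large n when
   d_max = O(m^(1/4 - tau)). *)
Fixpoint run_prob (k : nat) (s : state n) (o : option (digraph n)) : R :=
  if [exists e, can_add s e] then
    if k is k'.+1 then
      \sum_(e | eligible s e) pick_prob s e * run_prob k' (add_edge s e) o
    else 0
  else (o == if #|edges s| == nedges d then Some (edges s) else None)%:R.

(* A pair of positive weight has positive residual degrees, so every iteration
   decreases the total residual out-degree, initially m, by 1: the algorithm
   halts after at most m iterations. *)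
Definition stub_matching_prob (o : option (digraph n)) : R :=
  run_prob (nedges d) (init_state d) o.

End Algorithm.

Definition asymptotic_prob (R : realType) n (d : degseq n) : R :=
  let m := nedges d in
  (m`!)%:R *
  ((\prod_i (dout d i)`!%:R * \prod_i (din d i)`!%:R) /
     \prod_(0 <= r < m) ((m - r)%N%:R ^+ 2)) *
  expR ((\sum_i (din d i)%:R * (dout d i)%:R) / m%:R
        - (\sum_i ((din d i)%:R ^+ 2 + (dout d i)%:R ^+ 2)) / (2 * m%:R)
        + ((\sum_i (din d i)%:R ^+ 2) * (\sum_i (dout d i)%:R ^+ 2))
            / (2 * m%:R ^+ 2)
        + 2^-1).

(* Main.v *)
Require Import Defs.
From HB Require Import structures.
From mathcomp Require Import all_boot all_order all_algebra.
From mathcomp Require Import all_classical all_reals all_analysis.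
From mathcomp Require Import finset ring lra zify.
Import Order.TTheory GRing.Theory Num.Theory.
Import numFieldNormedType.Exports.
Set Implicit Arguments.
Unset Strict Implicit.
Unset Printing Implicit Defensive.
Local Open Scope ring_scope.

(* The order in which the edges of G are produced is summed over: up to the
   explicit product of factorials and of the factors 1 - d_i^+ d_j^- / 2m, the
   probability of G is the expectation of the product of k^2 / Z(S_k) along a
   uniformly random chain of edge sets set0 = S_0, S_1, ..., S_m = G, where S_k is
   what remains to be placed when k steps are left and Z(S_k) is the total
   weight of the selectable stub pairs.  Write Z(S) = |S|^2 - psi(S).

   Lower bound: by Jensen the expectation is at least the exponential of the sum
   of the layer means of psi(S_k) / k^2, which are explicit rational functions of
   k; the sum gives the exponent, up to an error O(d^4 log m / m).

   Upper bound: the chain is exposed in growing order, that is from the end of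
   the algorithm, since then an increment of psi has conditional mean
   O(k d^2 / m) whatever the past.  As long as k is at least a constant multiple
   of d^2, an exchange coupling shows that revealing one element changes the
   expected value of the sum of ln (k^2 / Z(S_k)) by a small amount, with total
   variance O(d^4 log^2 m / m).  For smaller k, k^2 / Z(S_k) is only bounded by
   O(d^2 / k); there ln (k^2 / Z(S_k)) is bounded by weighted averages of the
   past increments, in such a way that the total weight of the k-th increment is
   (1 + 1/r) ln (d^2 / k) + O(1), and an exponential moment bound costs only
   (d^2 / k)^(1 + 1/r) d^2 / m at step k, with sum O(d^(4 + 2/r) log m / m). *)

(** * Growing chains of subsets *)

(** While few edges remain, [k^2 / Z] may be as large as a multiple of [d^2 / k], and the product of
    these worst cases over [k <= d^2] would put a term of order [d^2] into the exponent. Such values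
    need conflicts among the few elements already exposed, and these are rare. The obstacle is to
    charge each large logarithm to earlier conflicts without charging any conflict too often. If the
    conflicts at step [k] carried total weight [w ln (d^2 / k)], their exponential moment would cost
    [(d^2 / k)^w d^2 / m]. For [w = 2] the step [k = 1] alone gives [d^6 / m], which need not tend
    to 0; for [w = 1] the sum is [d^4 log m / m]. Hence a weight [1 + 1/r], with [r] beyond
    [1 / tau], so that the surplus [d^(2/r)] stays below the margin left by [d^4 / m].

    The estimate does not depend on G although the mean number of conflicts does: its one term that
    is not a function of the degrees is cancelled by the product over G of the factors
    [1 - d_i^+ d_j^- / 2m]. *)

Section Chains.
Variables (R : realType) (T : finType) (G : {set T}).
Implicit Types (S : {set T}) (f : T -> R) (rho xi : {set T} -> R).

Definition up_mean S f : R := (\sum_(e in G :\: S) f e) / #|G :\: S|%:R.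

(** Conditional expectation, given that a uniform chain has reached S, of the product of [rho] over
    its next n sets. The factor at S itself is left out, so that successive steps compose.
    [mean_sum] is the analogue for sums. *)
Fixpoint mean_prod rho n S : R :=
  if n is n'.+1 then up_mean S (fun e => rho (e |: S) * mean_prod rho n' (e |: S))
  else 1.

Fixpoint mean_sum xi n S : R :=
  if n is n'.+1 then up_mean S (fun e => xi (e |: S) + mean_sum xi n' (e |: S))
  else 0.

Definition layer k : pred {set T} := fun S => (S \subset G) && (#|S| == k).

Definition layer_mean k (F : {set T} -> R) : R :=
  (\sum_(S | layer k S) F S) / 'C(#|G|, k)%:R.

Lemma card_layer_compl k S : layer k S -> #|G :\: S| = (#|G| - k)%N.
Proof. by case/andP=> sSG /eqP <-; rewrite cardsD (finset.setIidPr sSG). Qed.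

(** Double counting of the nested pairs of sets of sizes k and k + 1, indexed by the smaller set on
    the left and by the larger one on the right. *)
Lemma sum_layer_succ k (F : T -> {set T} -> {set T} -> R) :
  \sum_(S | layer k S) \sum_(e in G :\: S) F e S (e |: S)
  = \sum_(S | layer k.+1 S) \sum_(e in S) F e (S :\ e) S.
Proof.
rewrite (exchange_big_dep xpredT) //= [RHS](exchange_big_dep xpredT) //=.
apply: eq_bigr => e _.
rewrite (reindex_onto (fun S => S :\ e) (fun S => e |: S)) /=; last first.
  by move=> S /andP[_]; rewrite inE => /andP[eS _]; rewrite setU1K.
apply: eq_big => [S|S /andP[/andP[_ _] /eqP ->]] //.
rewrite /layer !inE eqxx /=.
case eS: (e \in S); last first.
  rewrite andbF; apply/negP=> /andP[_ /eqP/setP/(_ e)].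
  by rewrite !inE eqxx eS.
have US := setD1K eS; rewrite US eqxx !andbT.
rewrite -[in RHS]US subUset sub1set cardsU1 !inE eqxx /= add1n eqSS.
by rewrite [LHS]andbC andbA.
Qed.

Lemma up_mean_le S f g : (forall e, e \in G :\: S -> f e <= g e) ->
  up_mean S f <= up_mean S g.
Proof. by move=> fg; rewrite ler_wpM2r ?invr_ge0 ?ler0n// ler_sum. Qed.

Lemma eq_up_mean S f g : (forall e, e \in G :\: S -> f e = g e) ->
  up_mean S f = up_mean S g.
Proof. by move=> fg; rewrite /up_mean; congr (_ / _); exact: eq_bigr. Qed.

Lemma up_meanD S f g :
  up_mean S (fun e => f e + g e) = up_mean S f + up_mean S g.
Proof. by rewrite /up_mean big_split mulrDl. Qed.

Lemma up_meanZ S c f : up_mean S (fun e => c * f e) = c * up_mean S f.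
Proof. by rewrite /up_mean -mulr_sumr mulrA. Qed.

Lemma up_mean_cst S c : (0 < #|G :\: S|)%N -> up_mean S (fun=> c) = c.
Proof.
move=> S0; rewrite /up_mean sumr_const -[c *+ _]mulr_natr mulfK//.
by rewrite pnatr_eq0 -lt0n.
Qed.

(** A uniform nested pair of sets may be drawn from below or from above; numerically,
    [(m - k) 'C(m, k) = (k + 1) 'C(m, k + 1)]. *)
Lemma layer_mean_up k (F : T -> {set T} -> {set T} -> R) : (k < #|G|)%N ->
  layer_mean k (fun S => up_mean S (fun e => F e S (e |: S)))
  = layer_mean k.+1 (fun S => (\sum_(e in S) F e (S :\ e) S) / k.+1%:R).
Proof.
move=> km; rewrite /layer_mean -!mulr_suml -sum_layer_succ.
rewrite (eq_bigr (fun S => (\sum_(e in G :\: S) F e S (e |: S)) /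
    (#|G| - k)%:R)); last first.
  by move=> S lS; rewrite /up_mean (card_layer_compl lS).
rewrite -mulr_suml -!mulrA; congr (_ * _).
rewrite -!invfM -!natrM; congr (_ %:R^-1).
by rewrite [RHS]mulnC -mul_bin_left mulnC.
Qed.

Lemma eq_layer_mean k (F F' : {set T} -> R) :
  (forall S, layer k S -> F S = F' S) -> layer_mean k F = layer_mean k F'.
Proof. by move=> FF'; rewrite /layer_mean; congr (_ / _); exact: eq_bigr. Qed.

Lemma layer_mean0 (F : {set T} -> R) : layer_mean 0 F = F finset.set0.
Proof.
rewrite /layer_mean bin0 divr1 (big_pred1 finset.set0)// => S.
rewrite /layer cards_eq0 /=; apply/andP/eqP => [[_ /eqP]//|->].
by rewrite sub0set.
Qed.

Lemma layer_mean_full (F : {set T} -> R) : layer_mean #|G| F = F G.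
Proof.
rewrite /layer_mean binn divr1 (big_pred1 G)// => S.
rewrite /layer /= eq_sym; apply/andP/eqP => [[sSG /eqP cS]|->] //.
by apply/eqP; rewrite eqEcard sSG cS leqnn.
Qed.

Lemma layer_meanD k (F F' : {set T} -> R) :
  layer_mean k (fun S => F S + F' S) = layer_mean k F + layer_mean k F'.
Proof. by rewrite /layer_mean big_split mulrDl. Qed.

Lemma mean_sum_layer xi :
  mean_sum xi #|G| finset.set0 = \sum_(1 <= k < #|G|.+1) layer_mean k xi.
Proof.
(* The expected sum is split at level k: levels already passed contribute their layer means, and the
   total does not depend on k. *)
have H k : (k <= #|G|)%N ->
    layer_mean k (mean_sum xi (#|G| - k)) +
    \sum_(1 <= j < k.+1) layer_mean j xi = mean_sum xi #|G| finset.set0.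
  elim: k => [|k IH] km; first by rewrite layer_mean0 subn0 big_geq// addr0.
  rewrite -(IH (ltnW km)) big_nat_recr//= addrCA [LHS]addrC.
  congr (_ + _).
  have -> : (#|G| - k = (#|G| - k.+1).+1)%N by rewrite subnSK.
  rewrite /= [RHS](layer_mean_up
    (fun _ _ S => xi S + mean_sum xi (#|G| - k.+1) S))// addrC -layer_meanD.
  apply: eq_layer_mean => S /andP[_ /eqP cS].
  by rewrite sumr_const cS -[_ *+ _]mulr_natr mulfK ?pnatr_eq0.
by rewrite -(H #|G| (leqnn _)) subnn layer_mean_full /= add0r.
Qed.

(* Conditioning a uniform chain on its k-th set splits the expectation of the
   product of rho into a lower part h and an upper part; the mean of their
   product over the k-subsets does not depend on k. *)
Lemma mean_prod_down rho (h : {set T} -> R) : h finset.set0 = 1 ->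
  (forall S, S \subset G -> (0 < #|S|)%N ->
     h S = rho S * ((\sum_(e in S) h (S :\ e)) / #|S|%:R)) ->
  h G = mean_prod rho #|G| finset.set0.
Proof.
move=> h0 hS.
have H k : (k <= #|G|)%N ->
    layer_mean k (fun S => h S * mean_prod rho (#|G| - k) S)
    = mean_prod rho #|G| finset.set0.
  elim: k => [|k IH] km; first by rewrite layer_mean0 subn0 h0 mul1r.
  rewrite -(IH (ltnW km)).
  have -> : (#|G| - k = (#|G| - k.+1).+1)%N by rewrite subnSK.
  rewrite /=.
  under [RHS]eq_layer_mean do rewrite -up_meanZ.
  rewrite [RHS](layer_mean_up (fun _ S S' =>
    h S * (rho S' * mean_prod rho (#|G| - k.+1) S')))//.
  apply: eq_layer_mean => S /andP[sSG /eqP cS].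
  rewrite hS ?cS// -mulr_suml; ring.
by rewrite -(H #|G| (leqnn _)) subnn layer_mean_full /= mulr1.
Qed.

End Chains.

(** * Exponential moments along a uniform chain *)

Section RealBounds.
Variable R : realType.
Implicit Types x y : R.

Lemma expR_le_invr x : x < 1 -> expR x <= (1 - x)^-1.
Proof.
move=> x1; rewrite -[x in expR x]opprK expRN lef_pV2 ?posrE ?expR_gt0 ?subr_gt0//.
exact: expR_ge1Dx.
Qed.

Lemma expR_le_quadratic x : x <= 2^-1 -> expR x <= 1 + x + 2 * x ^+ 2.
Proof.
move=> x2; apply: le_trans (expR_le_invr _) _; first by lra.
rewrite -[leLHS]mul1r ler_pdivrMr; last by lra.
have := mulr_ge0 (sqr_ge0 x) (_ : 0 <= 1 - 2 * x); lra.
Qed.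

Lemma expR_le2 x : x <= 2^-1 -> expR x <= 2.
Proof.
move=> x2; apply: le_trans (expR_le_invr _) _; first by lra.
rewrite invf_ple ?posrE; lra.
Qed.

(** Convexity between 0 and a: the tangent of exp at [a * s] lies below exp at both end points. *)
Lemma expR_chord a s : 0 <= s <= 1 -> expR (a * s) <= 1 - s + s * expR a :> R.
Proof.
move=> /andP[s0 s1].
have -> : 1 - s + s * expR a
    = expR (a * s) * ((1 - s) * expR (- (a * s)) + s * expR (a - a * s)).
  have h1 := expRxMexpNx_1 (a * s).
  have h2 : expR (a * s) * expR (a - a * s) = expR a by rewrite -expRD addrC subrK.
  by rewrite mulrDr; congr (_ + _); rewrite mulrCA ?h1 ?h2 ?mulr1.
rewrite ler_peMr ?expR_ge0//.
have := ler_wpM2l (_ : 0 <= 1 - s) (expR_ge1Dx (- (a * s))).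
have := ler_wpM2l s0 (expR_ge1Dx (a - a * s)); lra.
Qed.

End RealBounds.

Section Concentration.
Variables (R : realType) (T : finType) (G : {set T}).
Implicit Types (S : {set T}).
Local Notation m := #|G|.

Lemma up_mean_ge0 S (f : T -> R) : (forall e, e \in G :\: S -> 0 <= f e) ->
  0 <= up_mean G S f.
Proof. by move=> f0; rewrite divr_ge0// sumr_ge0. Qed.

Lemma up_mean_sqr_le S (f : T -> R) : (0 < #|G :\: S|)%N ->
  (up_mean G S f) ^+ 2 <= up_mean G S (fun e => f e ^+ 2).
Proof.
move=> S0; set a := up_mean G S f.
have : 0 <= up_mean G S (fun e => (f e - a) ^+ 2).
  by apply: up_mean_ge0 => e _; exact: sqr_ge0.
rewrite (@eq_up_mean _ _ _ _ _ (fun e => f e ^+ 2 + ((-2 * a) * f e + a ^+ 2))).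
  by rewrite !up_meanD up_meanZ up_mean_cst// -/a; lra.
by move=> e _; ring.
Qed.

(** The deviation of [Y e] from its mean is at most [N e + nu <= 1/2], so the quadratic bound on exp
    applies and its linear term averages to 0. Splitting [2 (N e + nu)^2] and using that [nu^2] is
    at most the mean of [N^2] gives the 8. The tilt becomes linear in [s] by [expR_chord]; the 2 in
    front of [expR a] bounds [expR (Y e - b)]. *)
Lemma up_mean_expR_le S (Y N s : T -> R) (a : R) : (0 < #|G :\: S|)%N ->
  (forall e e', e \in G :\: S -> e' \in G :\: S -> Y e - Y e' <= N e + N e') ->
  (forall e, e \in G :\: S -> 0 <= N e <= 4^-1) ->
  (forall e, e \in G :\: S -> 0 <= s e <= 1) ->
  up_mean G S (fun e => expR (Y e + a * s e)) <=
  expR (up_mean G S Y + (8 * up_mean G S (fun e => N e ^+ 2)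
                        + 2 * expR a * up_mean G S s)).
Proof.
move=> S0 YN N4 s01; set b := up_mean G S Y; set nu := up_mean G S N.
have nu4 : 0 <= nu <= 4^-1.
  apply/andP; split; first by apply: up_mean_ge0 => e /N4/andP[].
  rewrite -[leRHS](up_mean_cst _ S0).
  by apply: up_mean_le => e /N4/andP[].
have yN e : e \in G :\: S -> - (N e + nu) <= Y e - b <= N e + nu.
  move=> eS; apply/andP; split.
    rewrite lerNl opprB -[Y e](up_mean_cst _ S0) -[N e](up_mean_cst _ S0).
    rewrite -[- _]mulN1r -up_meanZ -!up_meanD.
    by apply: up_mean_le => e' e'S; have := YN _ _ e'S eS; lra.
  rewrite -[Y e](up_mean_cst _ S0) -[N e](up_mean_cst _ S0).
  rewrite -[- _]mulN1r -up_meanZ -!up_meanD.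
  by apply: up_mean_le => e' e'S; have := YN _ _ eS e'S; lra.
have nusq : nu ^+ 2 <= up_mean G S (fun e => N e ^+ 2) := up_mean_sqr_le N S0.
clearbody nu; rewrite expRD.
apply: (@le_trans _ _ (expR b * (1 + (8 * up_mean G S (fun e => N e ^+ 2)
                        + 2 * expR a * up_mean G S s)))); last first.
  by rewrite ler_wpM2l ?expR_ge0 ?expR_ge1Dx.
have -> : 1 + (8 * up_mean G S (fun e => N e ^+ 2) + 2 * expR a * up_mean G S s)
   = up_mean G S (fun e => 1 + (Y e - b)) +
     (8 * up_mean G S (fun e => N e ^+ 2) + 2 * expR a * up_mean G S s).
  by rewrite up_meanD up_mean_cst// up_meanD up_mean_cst// subrr addr0.
apply: (@le_trans _ _ (expR b * up_mean G S (fun e =>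
  1 + (Y e - b) + (4 * N e ^+ 2 + (4 * nu ^+ 2 + 2 * expR a * s e))))).
  rewrite -up_meanZ; apply: up_mean_le => e eS.
  have -> : Y e + a * s e = b + ((Y e - b) + a * s e) by ring.
  rewrite expRD ler_wpM2l ?expR_ge0// expRD.
  have /andP[y1 y2] := yN e eS; have /andP[n1 n2] := N4 e eS.
  have yh : Y e - b <= 2^-1 by lra.
  have h1 := expR_chord a (s01 e eS).
  have h2 := expR_le_quadratic yh; have h3 := expR_le2 yh.
  have h4 := expR_gt0 (Y e - b).
  have /andP[s1 s2] := s01 e eS.
  apply: (@le_trans _ _ (expR (Y e - b) * (1 + s e * expR a))).
    by rewrite ler_wpM2l ?expR_ge0//; lra.
  rewrite mulrDr mulr1.
  have h5 : expR (Y e - b) * (s e * expR a) <= 2 * (s e * expR a).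
    by rewrite ler_wpM2r// mulr_ge0 ?expR_ge0.
  have h6 : (Y e - b) ^+ 2 <= 2 * N e ^+ 2 + 2 * nu ^+ 2.
    have h7 : (Y e - b) ^+ 2 <= (N e + nu) ^+ 2.
      by rewrite -subr_ge0 subr_sqr mulr_ge0//; lra.
    have := sqr_ge0 (N e - nu); lra.
  lra.
rewrite ler_wpM2l ?expR_ge0// up_meanD lerD2l !up_meanD !up_meanZ up_mean_cst//; lra.
Qed.

(** One factor of the square is bounded by a row sum; the other is summed over e and bounded by
    column sums. *)
Lemma up_mean_sqr_weight_le S (kap : T -> T -> R) (Dl : R) : S \subset G ->
  (forall e f, 0 <= kap e f) -> 0 <= Dl ->
  (forall e, e \in G -> \sum_(f in G) kap e f <= Dl) ->
  (forall f, f \in G -> \sum_(e in G) kap e f <= Dl) ->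
  up_mean G S (fun e => (\sum_(f in S) kap e f) ^+ 2)
  <= Dl ^+ 2 * #|S|%:R / #|G :\: S|%:R.
Proof.
move=> sSG kap0 Dl0 row col.
rewrite /up_mean ler_wpM2r ?invr_ge0//.
apply: (@le_trans _ _ (\sum_(e in G :\: S) Dl * \sum_(f in S) kap e f)).
  apply: ler_sum => e; rewrite inE => /andP[_ eG].
  rewrite expr2 ler_wpM2r ?sumr_ge0//.
  apply: le_trans _ (row e eG); rewrite [leRHS](big_setID S)/= (finset.setIidPr sSG).
  by rewrite lerDl sumr_ge0.
rewrite -mulr_sumr exchange_big/= expr2 -mulrA ler_wpM2l//.
rewrite mulr_natr -sumr_const; apply: ler_sum => f fS.
apply: le_trans _ (col f (fintype.subsetP sSG _ fS)).
rewrite [leRHS](big_setID S)/= lerDr sumr_ge0//.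
Qed.

(** * Sensitivity of the expected sum to one element of the chain *)

Section Lipschitz.
Variables (kap : T -> T -> R) (Dl : R) (c : nat -> R) (xi : {set T} -> R).
Hypotheses (kap0 : forall e f, 0 <= kap e f) (Dl0 : 0 <= Dl) (c0 : forall k, 0 <= c k).
Hypothesis row : forall e, e \in G -> \sum_(f in G) kap e f <= Dl.
Hypothesis lip : forall S e e', S \subset G -> e \in G :\: S -> e' \in G :\: S ->
  xi (e |: S) - xi (e' |: S) <=
  c #|S|.+1 * (\sum_(f in S) kap e f + \sum_(f in S) kap e' f).

(** [c k] measures how [xi] on level k reacts to a conflict [kap e f]. A conflict of e with an
    element of S is felt on all later levels, hence [tail]. An element drawn when the set has i
    elements is uniform among [m - i], so its mean conflict with e is at most [Dl / (m - i)], and it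
    is felt from level [i.+1] on; the sum over i is [far]. *)
Definition tail j : R := \sum_(j <= k < m.+1) c k.
Definition far j : R := \sum_(j <= i < m) tail i.+1 / (m - i)%:R.
Definition influence S e : R :=
  tail #|S|.+1 * (\sum_(f in S) kap e f) + Dl * far #|S|.+1.

Lemma tail_ge0 j : 0 <= tail j. Proof. by rewrite sumr_ge0. Qed.

Lemma far_ge0 j : 0 <= far j.
Proof. by rewrite sumr_ge0// => i _; rewrite divr_ge0// tail_ge0. Qed.

Lemma influence_ge0 S e : 0 <= influence S e.
Proof. by rewrite addr_ge0// mulr_ge0 ?tail_ge0 ?far_ge0 ?sumr_ge0. Qed.

(* Resampling one element of the chain: the continuations of e |: S and
   e' |: S are coupled by exchanging e and e'. *)
Lemma mean_sum_lip n S e e' : S \subset G -> (#|S|.+1 + n = m)%N ->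
  e \in G :\: S -> e' \in G :\: S ->
  (xi (e |: S) + mean_sum G xi n (e |: S))
  - (xi (e' |: S) + mean_sum G xi n (e' |: S)) <= influence S e + influence S e'.
Proof.
elim: n S e e' => [|n IH] S e e' sSG cS eS e'S.
  rewrite /= !addr0; apply: le_trans (lip sSG eS e'S) _.
  rewrite /influence /tail -[X in \sum_(_ <= _ < X.+1) _]cS addn0 big_nat1.
  by have := far_ge0 #|S|.+1; have := Dl0; nra.
have [->|nee] := eqVneq e e'.
  by rewrite subrr addr_ge0 ?influence_ge0.
have jm : (#|S|.+1 < m)%N by rewrite -cS addnS ltnS leq_addr.
pose N' x f : R := influence (f |: S) x.
(* Averaged over the next draw, the influence of x drops at least by what [lip] uses up on the
   current level. *)
have avg x : x \in G :\: S ->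
    (\sum_(f in G :\: (x |: S)) N' x f) / n.+1%:R
    <= influence S x - c #|S|.+1 * \sum_(f in S) kap x f.
  move=> xS; have cx : #|G :\: (x |: S)| = n.+1.
    move: xS; rewrite inE => /andP[xS xG].
    rewrite cardsD (finset.setIidPr _) ?subUset ?sub1set ?xG// cardsU1 xS -cS; lia.
  rewrite ler_pdivrMr ?ltr0n//.
  apply: (@le_trans _ _ (\sum_(f in G :\: (x |: S))
     (tail #|S|.+2 * \sum_(f' in S) kap x f' + Dl * far #|S|.+2) +
     tail #|S|.+2 * \sum_(f in G :\: (x |: S)) kap x f)).
    rewrite [X in _ <= _ + X]mulr_sumr -big_split/=; apply: ler_sum => f.
    rewrite !inE negb_or -andbA => /and3P[fx fS fG].
    rewrite /N' /influence cardsU1 fS add1n big_setU1//=; lra.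
  have xG : x \in G by move: xS; rewrite inE => /andP[].
  have hrow : \sum_(f in G :\: (x |: S)) kap x f <= Dl.
    apply: le_trans _ (row xG).
    by rewrite [leRHS](big_setID (x |: S))/= lerDr sumr_ge0.
  rewrite sumr_const cx -[_ *+ _]mulr_natr /influence.
  have -> : far #|S|.+1 = tail #|S|.+2 / n.+1%:R + far #|S|.+2.
    by rewrite /far big_ltn//; congr (_ / _%:R + _); rewrite -cS; lia.
  have -> : tail #|S|.+1 = c #|S|.+1 + tail #|S|.+2 by rewrite /tail big_ltn// ltnW.
  have n0 : n.+1%:R != 0 :> R by rewrite pnatr_eq0.
  have := ler_wpM2l (tail_ge0 #|S|.+2) hrow.
  set K := \sum_(f in G :\: _) _; set t := tail _; set F := far _.
  set D := \sum_(f in S) _.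
  suff -> : (c #|S|.+1 + t) * D + Dl * (t / n.+1%:R + F) - c #|S|.+1 * D
    = (t * D + Dl * F) + t * Dl / n.+1%:R.
    by move=> hK; rewrite [leRHS]mulrDl divfK//; lra.
  ring.
(* The draw of y right after x is singled out: e' after e and e after e' lead to the same set, so
   these two terms cancel in the difference. *)
have step x y : x \in G :\: S -> y \in G :\: S -> x != y ->
   mean_sum G xi n.+1 (x |: S) =
   ((xi (y |: (x |: S)) + mean_sum G xi n (y |: (x |: S))) +
     \sum_(f in G :\: (y |: (x |: S)))
       (xi (x |: (f |: S)) + mean_sum G xi n (x |: (f |: S)))) / n.+1%:R.
  move=> xS yS xy; rewrite /= /up_mean.
  have -> : #|G :\: (x |: S)| = n.+1.
    move: xS; rewrite inE => /andP[xS xG].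
    rewrite cardsD (finset.setIidPr _) ?subUset ?sub1set ?xG// cardsU1 xS -cS; lia.
  rewrite (big_setD1 y)/=; last by move: yS; rewrite !inE eq_sym (negPf xy).
  congr ((_ + _) / _); rewrite finset.setDDl [_ :|: [set y]]finset.setUC.
  by apply: eq_bigr => f _; rewrite setUCA.
rewrite (step e e')// (step e' e) 1?eq_sym// [e |: (e' |: S)]setUCA.
set W := G :\: _; set A := xi (e' |: _) + _.
rewrite opprD addrACA -mulrBl opprD addrACA subrr add0r -sumrB.
have := lip sSG eS e'S; have := avg e eS; have := avg e' e'S.
suff : \sum_(f in W) (xi (e |: (f |: S)) + mean_sum G xi n (e |: (f |: S)) -
     (xi (e' |: (f |: S)) + mean_sum G xi n (e' |: (f |: S))))
   <= \sum_(f in G :\: (e |: S)) N' e f + \sum_(f in G :\: (e' |: S)) N' e' f.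
  move/(ler_wpM2r (_ : 0 <= n.+1%:R^-1)); rewrite invr_ge0 ler0n mulrDl => /(_ isT).
  set X := (\sum_(f in W) _) / _; set X1 := (\sum_(f in _) _) / _.
  set X2 := (\sum_(f in _) _) / _; rewrite mulrDr.
  set D1 := c _ * _; set D2 := c _ * _; set x1 := xi _; set x2 := xi _.
  by move: X X1 X2 D1 D2 x1 x2 (influence _ _) (influence _ _) => *; lra.
have Wsub x : x \in [set e; e'] -> W \subset G :\: (x |: S).
  move=> xe; apply: finset.setDS; rewrite subUset sub1set.
  by move: xe; rewrite !inE; case/orP=> /eqP->; rewrite eqxx ?orbT/=;
    apply/fintype.subsetP => f fS; rewrite !inE fS !orbT.
apply: (@le_trans _ _ (\sum_(f in W) (N' e f + N' e' f))); last first.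
  rewrite big_split/= lerD//.
    rewrite [leRHS](big_setID W)/= (finset.setIidPr (Wsub e _)) ?inE ?eqxx//.
    by rewrite lerDl sumr_ge0// => f _; exact: influence_ge0.
  rewrite [leRHS](big_setID W)/= (finset.setIidPr (Wsub e' _)) ?inE ?eqxx ?orbT//.
  by rewrite lerDl sumr_ge0// => f _; exact: influence_ge0.
apply: ler_sum => f; rewrite !inE !negb_or -!andbA => /and4P[fe' fe fS fG].
apply: IH.
- by rewrite subUset sub1set fG.
- by rewrite cardsU1 fS -cS; lia.
- by move: eS; rewrite !inE negb_or eq_sym fe.
- by move: e'S; rewrite !inE negb_or eq_sym fe'.
Qed.

End Lipschitz.

End Concentration.

(** * From layer means to chain expectations *)

Section Growth.
Variables (R : realType) (T : finType) (G : {set T}).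
Implicit Types (S : {set T}) (s : seq T).
Local Notation m := #|G|.

(* A sequence lists a chain backwards: in e :: s', the element e is added last,
   to the set of the elements of s'. *)
Fixpoint path_sum (g : T -> {set T} -> R) s : R :=
  if s is e :: s' then g e [set x in s']%SET + path_sum g s' else 0.

Variables (kap : T -> T -> R) (Dl : R) (c : nat -> R) (K : nat).
Variables (rho xi : {set T} -> R) (sg : T -> {set T} -> R) (om : nat -> R) (sb : R).
Hypotheses (kap0 : forall e f, 0 <= kap e f) (Dl0 : 0 <= Dl) (c0 : forall k, 0 <= c k).
Hypothesis row : forall e, e \in G -> \sum_(f in G) kap e f <= Dl.
Hypothesis col : forall f, f \in G -> \sum_(e in G) kap e f <= Dl.
Hypothesis lip : forall S e e', S \subset G -> e \in G :\: S -> e' \in G :\: S ->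
  xi (e |: S) - xi (e' |: S) <=
  c #|S|.+1 * (\sum_(f in S) kap e f + \sum_(f in S) kap e' f).
Hypothesis tailW : forall j, (0 < j <= m)%N ->
  tail G c j.+1 <= 2 * (m - j)%:R / (j%:R * m%:R).
Hypothesis tailK : forall j, (0 < j)%N -> Dl * tail G c j <= 8^-1.

Definition harm : R := \sum_(1 <= i < m) i%:R^-1.

Hypothesis harmK : Dl * (2 * harm / m%:R) <= 8^-1.
Hypothesis rhoK : forall S, S \subset G -> (K < #|S|)%N -> rho S = expR (xi S).
Hypothesis rho_gt0 : forall S, S \subset G -> (0 < #|S| <= K)%N -> 0 < rho S.
Hypothesis xiK : forall S, S \subset G -> (#|S| <= K)%N -> xi S = 0.
Hypothesis sg01 : forall S e, S \subset G -> (#|S| < K)%N -> e \in G :\: S ->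
  0 <= sg e S <= 1.
Hypothesis sg_mean : forall S, S \subset G -> (#|S| < K)%N ->
  up_mean G S (sg^~ S) <= sb.
Hypothesis low : forall s, uniq s -> {subset s <= G} -> (size s <= K)%N ->
  path_sum (fun e S => ln (rho (e |: S))) s <=
  path_sum (fun e S => om #|S|.+1 * sg e S) s.
Hypothesis Km : (K <= m)%N.

(** Variance cost of the j-th draw: [64 = 8 * 2 * 4], with 8 from [up_mean_expR_le], 2 from
    splitting the square of the influence, and 4 from the squared bounds on [tail] and [far]. The
    set before the draw has [j.-1] elements; for j = 1 the convention [0^-1 = 0] is the right value,
    as there is no earlier element. *)
Definition chain_var j : R :=
  64 * Dl ^+ 2 * ((j.-1%:R * m%:R)^-1 + harm ^+ 2 / m%:R ^+ 2).

Lemma harm_ge0 : 0 <= harm. Proof. by rewrite sumr_ge0. Qed.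

(** The numerator in [tailW] cancels the denominator [m - i], which leaves a harmonic sum. *)
Lemma far_le j : (0 < j)%N -> far G c j <= 2 * harm / m%:R.
Proof.
move=> j0; apply: (@le_trans _ _ (\sum_(j <= i < m) (2 / m%:R) * i%:R^-1)).
  rewrite /far big_nat_cond [leRHS]big_nat_cond; apply: ler_sum => i.
  rewrite andbT => /andP[ji im].
  have i0 : (0 < i)%N by exact: leq_trans ji.
  rewrite ler_pdivrMr ?ltr0n ?subn_gt0//.
  apply: le_trans (tailW _) _; first by rewrite i0 ltnW.
  by rewrite invfM; lra.
rewrite -mulr_sumr mulrAC ler_wpM2r// ?divr_ge0//.
rewrite ler_wpM2l// /harm.
have [jm|mj] := leqP j m; last by rewrite big_geq ?sumr_ge0// ltnW.
by rewrite [leRHS](big_cat_nat (n := j))//= lerDr sumr_ge0.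
Qed.

Lemma influence_le S e : S \subset G -> e \in G -> (#|S| < m)%N ->
  0 <= influence G kap Dl c S e <= 4^-1.
Proof.
move=> sSG eG Sm; rewrite influence_ge0//=.
have h1 := le_trans (ler_wpM2l Dl0 (far_le (ltn0Sn #|S|))) harmK.
have h2 := tailK (ltn0Sn #|S|).
have h3 : \sum_(f in S) kap e f <= Dl.
  apply: le_trans _ (row eG); rewrite [leRHS](big_setID S)/= (finset.setIidPr sSG).
  by rewrite lerDl sumr_ge0.
have h4 := ler_wpM2l (tail_ge0 G c0 #|S|.+1) h3.
by rewrite /influence; apply: le_trans (lerD h4 h1) _; rewrite mulrC; lra.
Qed.

Lemma influence_sqr_le S : S \subset G -> (#|S| < m)%N ->
  8 * up_mean G S (fun e => influence G kap Dl c S e ^+ 2) <= chain_var #|S|.+1.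
Proof.
move=> sSG Sm.
have m0 : 0 < m%:R :> R by rewrite ltr0n; exact: leq_ltn_trans Sm.
have cGS : #|G :\: S| = (m - #|S|)%N by rewrite cardsD (finset.setIidPr sSG).
have GS0 : (0 < #|G :\: S|)%N by rewrite cGS subn_gt0.
set t := tail G c #|S|.+1; set F := far G c #|S|.+1.
apply: (@le_trans _ _ (8 * (2 * t ^+ 2 * (Dl ^+ 2 * #|S|%:R / #|G :\: S|%:R)
   + 2 * (Dl ^+ 2 * F ^+ 2)))).
  rewrite ler_wpM2l//.
  apply: (@le_trans _ _ (up_mean G S (fun e => 2 * t ^+ 2 * (\sum_(f in S) kap e f) ^+ 2
    + 2 * (Dl ^+ 2 * F ^+ 2)))).
    apply: up_mean_le => e _; rewrite /influence -/t -/F.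
    have := sqr_ge0 (t * \sum_(f in S) kap e f - Dl * F); lra.
  rewrite up_meanD up_mean_cst// up_meanZ lerD2r ler_wpM2l// ?mulr_ge0 ?tail_ge0//.
  exact: up_mean_sqr_weight_le.
have hF : F ^+ 2 <= 4 * (harm ^+ 2 / m%:R ^+ 2).
  have F0 : 0 <= F by exact: far_ge0.
  apply: le_trans (lerXn2r 2 _ _ (far_le (ltn0Sn #|S|))) _; rewrite ?nnegrE//.
    by rewrite divr_ge0// mulr_ge0// harm_ge0.
  by rewrite !exprMn exprVn; lra.
(* Near the top of the chain [#|G :\: S|] is small; the factor [m - j] in [tailW] makes up for this
   denominator. *)
have hT : t ^+ 2 * (#|S|%:R / #|G :\: S|%:R) <= 4 * (#|S|%:R * m%:R)^-1.
  have [S0|S0] := posnP #|S|; first by rewrite S0 !mul0r mulr0 invr0 mulr0.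
  have s0 : 0 < #|S|%:R :> R by rewrite ltr0n.
  have g0 : 0 < #|G :\: S|%:R :> R by rewrite ltr0n.
  have tle : t <= 2 * #|G :\: S|%:R / (#|S|%:R * m%:R).
    by rewrite cGS; apply: tailW; rewrite S0 ltnW.
  apply: (@le_trans _ _ ((2 * #|G :\: S|%:R / (#|S|%:R * m%:R)) ^+ 2
      * (#|S|%:R / #|G :\: S|%:R))).
    rewrite ler_wpM2r ?divr_ge0//.
    by apply: lerXn2r; rewrite ?nnegrE ?tail_ge0 ?divr_ge0 ?mulr_ge0.
  have -> : (2 * #|G :\: S|%:R / (#|S|%:R * m%:R)) ^+ 2
      * (#|S|%:R / #|G :\: S|%:R)
     = 4 * (#|S|%:R * m%:R)^-1 * (#|G :\: S|%:R / m%:R) :> R.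
    by field; rewrite !gt_eqF.
  rewrite ler_piMr ?mulr_ge0 ?invr_ge0 ?mulr_ge0//.
  rewrite ler_pdivrMr// mul1r ler_nat cGS leq_subr//.
rewrite /chain_var /=.
have D2 := sqr_ge0 Dl.
have := ler_wpM2l D2 hF; have := ler_wpM2l D2 hT; lra.
Qed.

(** The conditional expectations of the sum of [xi] along the chain form a martingale whose
    differences are controlled by [influence]; each draw costs its [chain_var]. *)
Lemma mean_prod_high n S : S \subset G -> (#|S| + n = m)%N -> (K <= #|S|)%N ->
  mean_prod G rho n S <=
  expR (mean_sum G xi n S + \sum_(#|S|.+1 <= j < m.+1) chain_var j).
Proof.
elim: n S => [|n IH] S sSG cS KS.
  rewrite addn0 in cS; rewrite /= cS big_geq// addr0 expR0//.
have Sm : (#|S| < m)%N by rewrite -cS -addn1 leq_add2l.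
have GS0 : (0 < #|G :\: S|)%N by rewrite cardsD (finset.setIidPr sSG) subn_gt0.
set W := \sum_(#|S|.+2 <= j < m.+1) chain_var j.
pose Y e := xi (e |: S) + mean_sum G xi n (e |: S).
have cU e : e \in G :\: S -> #|e |: S| = #|S|.+1.
  by rewrite inE => /andP[eS _]; rewrite cardsU1 eS add1n.
have sU e : e \in G :\: S -> e |: S \subset G.
  by rewrite inE => /andP[_ eG]; rewrite subUset sub1set eG.
apply: (@le_trans _ _ (expR W * up_mean G S (fun e => expR (Y e + 0 * 0)))).
  rewrite -up_meanZ; apply: up_mean_le => e eS.
  rewrite rhoK ?sU ?cU// mulr0 addr0 /Y expRD mulrCA ler_wpM2l ?expR_ge0//.
  rewrite -expRD addrC -/W; apply: le_trans (IH _ _ _ _) _.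
  - exact: sU.
  - by rewrite cU// -cS addnS addSn.
  - by rewrite cU// ltnW.
  - by rewrite cU.
rewrite big_ltn// -/W addrA [leRHS]expRD [leRHS]mulrC ler_pM2l ?expR_gt0//.
apply: le_trans (@up_mean_expR_le R T G S Y (influence G kap Dl c S) (fun=> 0)
  0 GS0 _ _ _) _ => [e e' eS e'S|e|e eS|].
- by apply: mean_sum_lip => //; rewrite -cS addnS.
- by rewrite inE => /andP[_ eG]; apply: influence_le.
- by rewrite lexx ler01.
rewrite up_mean_cst// mulr0 addr0 ler_expR lerD2l.
exact: influence_sqr_le.
Qed.

Lemma path_set s : uniq s -> {subset s <= G} ->
  [set x in s]%SET \subset G /\ #|[set x in s]%SET| = size s.
Proof.
move=> us sG; split; last by rewrite cardsE; apply/card_uniqP.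
by apply/fintype.subsetP => x; rewrite inE; exact: sG.
Qed.

(** [low] compares the logarithms of [rho] with the gains only after summation along a path. The
    induction therefore carries the list of elements drawn and makes this exchange once, at size
    [K]. Each draw before that costs the exponential moment of a single gain,
    [2 * expR (om j) * sb], besides its [chain_var]. *)
Lemma mean_prod_low n s : uniq s -> {subset s <= G} -> (size s + n = K)%N ->
  mean_prod G rho (m - size s) [set x in s]%SET
    * expR (path_sum (fun e S => ln (rho (e |: S))) s) <=
  expR (path_sum (fun e S => om #|S|.+1 * sg e S) s
    + mean_sum G xi (m - size s) [set x in s]%SET
    + \sum_((size s).+1 <= j < m.+1) chain_var j
    + \sum_((size s).+1 <= j < K.+1) 2 * expR (om j) * sb).
Proof.
elim: n s => [|n IH] s us sG ss.
  have [sSG cs] := path_set us sG.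
  rewrite addn0 in ss; rewrite [X in _ + X]big_geq ?ss// addr0.
  rewrite -addrA expRD mulrC ler_pM ?expR_ge0 ?ler_expR//.
  - have := leqnn K; rewrite -[X in (_ <= X)%N]ss -cs.
    elim: (m - K)%N [set x in s]%SET sSG {cs} => [|k IHk] S sSG KS //=.
    rewrite up_mean_ge0// => e; rewrite inE => /andP[eS eG].
    have sU : e |: S \subset G by rewrite subUset sub1set eG.
    have KU : (K < #|e |: S|)%N by rewrite cardsU1 eS add1n ltnS.
    by rewrite mulr_ge0 ?IHk ?rhoK ?expR_ge0// ltnW.
  - by rewrite low ?ss.
  - have := @mean_prod_high (m - K) [set x in s]%SET sSG; rewrite cs ss.
    by apply => //; rewrite subnKC.
have [sSG cs] := path_set us sG.
set S := [set x in s]%SET; set a := path_sum _ s.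
have Ks : (size s < K)%N by rewrite -ss -addn1 leq_add2l.
have sm : (size s < m)%N by exact: leq_trans Km.
have GS0 : (0 < #|G :\: S|)%N by rewrite cardsD (finset.setIidPr sSG) cs subn_gt0.
have -> : (m - size s = (m - (size s).+1).+1)%N by rewrite subnSK.
set W := \sum_((size s).+2 <= j < m.+1) chain_var j.
set W' := \sum_((size s).+2 <= j < K.+1) 2 * expR (om j) * sb.
set b := path_sum (fun e S => om #|S|.+1 * sg e S) s.
set k := (m - (size s).+1)%N.
pose Y e := xi (e |: S) + mean_sum G xi k (e |: S).
have xi0 e : e \in G :\: S -> xi (e |: S) = 0.
  rewrite inE => /andP[eS eG].
  by rewrite xiK ?subUset ?sub1set ?eG// cardsU1 eS cs add1n.
apply: (@le_trans _ _ (expR (b + (W + W')) *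
   up_mean G S (fun e => expR (Y e + om (size s).+1 * sg e S)))).
  rewrite mulrC /= -!up_meanZ; apply: up_mean_le => e eS.
  have [eS' eG] : e \notin s /\ e \in G by move: eS; rewrite !inE => /andP[].
  have US : e |: S = [set x in e :: s]%SET by rewrite /S set_cons.
  have rho0 : 0 < rho (e |: S).
    by apply: rho_gt0; rewrite ?subUset ?sub1set ?eG// cardsU1 inE eS' cs.
  have := IH (e :: s); rewrite /= us eS' -/S -US -/k -/W -/W' => /(_ isT).
  rewrite cs -/a -/b => H.
  have -> : expR a * (rho (e |: S) * mean_prod G rho k (e |: S))
      = mean_prod G rho k (e |: S) * expR (ln (rho (e |: S)) + a).
    by rewrite expRD lnK ?posrE//; ring.
  apply: le_trans (H _ _) _.
  - by move=> x; rewrite inE => /orP[/eqP->|/sG].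
  - by rewrite addSn -addnS.
  by rewrite -expRD ler_expR /Y xi0//; lra.
rewrite (big_ltn (sm : (size s).+1 < m.+1)%N) -/W.
rewrite (big_ltn (Ks : (size s).+1 < K.+1)%N) -/W'.
apply: le_trans (ler_wpM2l (expR_ge0 _) (@up_mean_expR_le R T G S Y
  (influence G kap Dl c S) (sg^~ S) (om (size s).+1) GS0 _ _ _)) _.
- move=> e e' eS e'S; apply: mean_sum_lip => //.
  by rewrite cs /k subnKC.
- by move=> e; rewrite inE => /andP[_ eG]; apply: influence_le; rewrite ?cs.
- by move=> e eS; apply: sg01; rewrite ?cs.
rewrite -expRD ler_expR.
have := influence_sqr_le sSG; rewrite cs => /(_ sm).
have := ler_wpM2l (_ : 0 <= 2 * expR (om (size s).+1)) (sg_mean sSG _).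
rewrite cs mulr_ge0 ?expR_ge0// => /(_ isT Ks).
have -> : mean_sum G xi k.+1 S = up_mean G S Y by [].
lra.
Qed.

Lemma mean_prod_le :
  mean_prod G rho m finset.set0 <=
  expR (mean_sum G xi m finset.set0
    + \sum_(1 <= j < m.+1) chain_var j
    + \sum_(1 <= j < K.+1) 2 * expR (om j) * sb).
Proof.
have := @mean_prod_low K [::] isT _ (add0n K).
rewrite /= subn0 set_nil expR0 mulr1 add0r; apply => //.
Qed.

End Growth.

(** * The last steps: weighted averages along the chain *)

Lemma ln_le_subr1 (R : realType) (x : R) : 0 < x -> ln x <= x - 1.
Proof.
move=> x0; have := @le_ln1Dx R (x - 1); rewrite [1 + _]addrC subrK; apply.
by rewrite ltrBrDr addrC subrr.
Qed.

(* The interpolation costs only ln D (not 2 ln D) per unit of p, because near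
   p = 1 the bound z >= (1 - p) / (r + 1) is used instead of convexity in z. *)
Lemma ln_invr_interpolate (R : realType) (r : nat) (z D p q : R) :
  0 < z -> z <= 1 -> z^-1 <= D -> 0 <= p <= 1 -> 0 <= q ->
  1 - p <= r.+1%:R * z -> 1 - z <= 2 * q ->
  ln z^-1 <= (4 + 4 * r%:R) * q + (1 + ln D) * p.
Proof.
move=> z0 z1 zD /andP[p0 p1] q0 pz zq.
have D1 : 1 <= D by apply: le_trans zD; rewrite invf_ge1.
have D0 : 0 < D by exact: lt_le_trans D1.
have lD : 0 <= ln D by exact: ln_ge0.
have r0 : 0 <= r%:R :> R by [].
have rq : 0 <= r%:R * q by exact: mulr_ge0.
have iz0 : 0 < z^-1 by rewrite invr_gt0.
have lpD : 0 <= (1 + ln D) * p by rewrite mulr_ge0 ?addr_ge0.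
have [zh|zh] := leP 2^-1 z.
  have h1 := ln_le_subr1 iz0.
  have h2 : z^-1 - 1 <= 2 * (1 - z).
    have -> : z^-1 - 1 = (1 - z) * z^-1 by rewrite mulrBl mul1r divff ?gt_eqF.
    rewrite [leRHS]mulrC ler_wpM2l ?subr_ge0//.
    by rewrite invf_ple ?posrE.
  lra.
(* For z < 1/2 the first term of the bound is at least [1 + r], which pays for the factor [r.+1]
   through [ln r.+1 <= r]; only the logarithm of [1 / (1 - p)] remains to be set against [ln D]. *)
have q4 : 4^-1 <= q by lra.
have [uD|uD] := leP ((1 - p) * D) 1.
  have h1 : ln z^-1 <= ln D by rewrite ler_ln.
  have h2 : (1 - p) * (1 + ln D) <= 1.
    apply: le_trans uD; rewrite ler_wpM2l ?subr_ge0//.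
    by have := ln_le_subr1 D0; lra.
  lra.
set u := 1 - p in pz uD.
have u0 : 0 < u by rewrite -(pmulr_lgt0 _ D0); exact: lt_trans uD.
have h1 : ln z^-1 <= ln (r.+1%:R) + ln u^-1.
  rewrite -lnM ?posrE ?ltr0n ?invr_gt0// ler_ln ?posrE ?mulr_gt0 ?ltr0n ?invr_gt0//.
  by rewrite invf_ple ?posrE ?mulr_gt0 ?ltr0n ?invr_gt0// invfM invrK ler_pdivrMl ?ltr0n.
have h2 : ln (r.+1%:R) <= r%:R :> R.
  by have := @ln_le_subr1 R r.+1%:R (ltr0Sn _ _); rewrite -natr1; lra.
have h3 : ln u^-1 <= ln D.
  rewrite ler_ln ?posrE ?invr_gt0// invf_ple ?posrE//.
  by rewrite -[D^-1]mul1r ler_pdivrMr// ltW.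
have h4 : u * (1 + ln u^-1) <= 1.
  have := @ln_le_subr1 R u^-1; rewrite invr_gt0 => /(_ u0) h.
  have hh : 1 + ln u^-1 <= u^-1 by rewrite addrC -lerBrDr.
  by have := ler_wpM2l (ltW u0) hh; rewrite divff ?gt_eqF.
have h5 : p * (1 + ln u^-1) <= p * (1 + ln D) by rewrite ler_wpM2l// lerD2l.
have h6 : p = 1 - u by rewrite /u; lra.
have h7 : ln u^-1 <= p * (1 + ln u^-1) by rewrite h6; lra.
have h8 : r%:R <= 4 * r%:R * q by have := ler_wpM2l r0 q4; lra.
lra.
Qed.

Section LowLayers.
Variables (R : realType) (T : finType) (G : {set T}).
Implicit Types (S : {set T}) (s : seq T).
Variables (K r : nat) (Z : {set T} -> R) (sg : T -> {set T} -> R) (D : nat -> R).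
Hypothesis r2 : (1 < r)%N.
Hypothesis Z0 : Z finset.set0 = 0.
Hypothesis Zle : forall S, S \subset G -> Z S <= #|S|%:R ^+ 2.
Hypothesis Z_gt0 : forall S, S \subset G -> (0 < #|S|)%N -> 0 < Z S.
Hypothesis sg01 : forall S e, S \subset G -> (#|S| < K)%N -> e \in G :\: S ->
  0 <= sg e S <= 1.
Hypothesis Zstep : forall S e, S \subset G -> (#|S| < K)%N -> e \in G :\: S ->
  Z S + (2 * #|S|%:R + 1) * (1 - sg e S) <= Z (e |: S).
Hypothesis ZD : forall S, S \subset G -> (0 < #|S| <= K)%N ->
  #|S|%:R ^+ 2 / Z S <= D #|S|.
Hypothesis D_mono : forall k, (0 < k < K)%N -> D k.+1 <= D k.
Hypothesis D_ge1 : forall k, (0 < k <= K)%N -> 1 <= D k.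

(** Average of the gains along the path in which the j-th one has weight ['C(j + a - 1, a)]. For a
    >= 1, if the averages at all later sizes are added up, each single gain receives total weight at
    most [1 + 1/a]. This is the origin of the coefficients [1 + 1/r] and, with a = 1, of 2 in
    [low_weight]. *)
Fixpoint path_avg (a : nat) s : R :=
  if s is e :: s' then
    ((size s')%:R * path_avg a s' + a.+1%:R * sg e [set x in s']%SET)
      / (size s + a)%:R
  else 0.

Definition low_weight k : R := 2 * (4 + 4 * r%:R) + (1 + r%:R^-1) * (1 + ln (D k)).

Lemma path_cons e s : uniq (e :: s) -> {subset e :: s <= G} -> (size s < K)%N ->
  [/\ [set x in s]%SET \subset G, #|[set x in s]%SET| = size s,
   e \in G :\: [set x in s]%SET, uniq s & {subset s <= G}].
Proof.
move=> /= /andP[es us] sG sK; have sG' : {subset s <= G}.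
  by move=> x xs; apply: sG; rewrite inE xs orbT.
by have [? ?] := path_set us sG'; split; rewrite // !inE es sG// mem_head.
Qed.

Lemma path_avg01 a s : uniq s -> {subset s <= G} -> (size s <= K)%N ->
  0 <= path_avg a s <= 1.
Proof.
elim: s => [|e s IH] us sG sK; first by rewrite /= lexx ler01.
have [sSG cs eS us' sG'] := path_cons us sG sK.
have /andP[p0 p1] := IH us' sG' (ltnW sK).
have /andP[q0 q1] : 0 <= sg e [set x in s]%SET <= 1 by apply: sg01; rewrite ?cs.
rewrite /= divr_ge0 ?addr_ge0 ?mulr_ge0//=.
rewrite ler_pdivrMr ?ltr0n// mul1r addSnnS natrD.
by rewrite lerD ?ler_piMr.
Qed.

(** From size k to k + 1 the old term is multiplied by [(k + 1)^2 / (k (k + 1 + r))], which is at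
    most 1 for k >= 1 and r >= 2. The new term is paid for by the increment of Z. *)
Lemma path_avg_low s : uniq s -> {subset s <= G} -> (size s <= K)%N ->
  (size s)%:R ^+ 2 * (1 - path_avg r s) <= r.+1%:R * Z [set x in s]%SET.
Proof.
elim: s => [|e s IH] us sG sK.
  by rewrite /= set_nil Z0 expr0n mul0r mulr0.
have [sSG cs eS us' sG'] := path_cons us sG sK.
have := Zstep sSG _ eS; rewrite cs => /(_ sK).
have /andP[q0 q1] : 0 <= sg e [set x in s]%SET <= 1 by apply: sg01; rewrite ?cs.
have := IH us' sG' (ltnW sK).
have /andP[p0 p1] := path_avg01 r us' sG' (ltnW sK).
rewrite /= set_cons; set A := path_avg r s; set q := sg _ _.
set Zs := Z [set x in s]%SET; set Ze := Z _.
set k : R := (size s)%:R; move=> h1 h2.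
have -> : (size s).+1%:R = k + 1 :> R by rewrite -natr1.
have -> : ((size s).+1 + r)%:R = k + 1 + r%:R :> R by rewrite natrD -natr1.
have -> : r.+1%:R = r%:R + 1 :> R by rewrite -natr1.
move: h1; have -> : r.+1%:R = r%:R + 1 :> R by rewrite -natr1.
move=> h1.
have r2' : 2 <= r%:R :> R by rewrite ler_nat.
have k0 : 0 <= k by [].
have kr : 0 < k + 1 + r%:R by lra.
have h3 := ler_wpM2l (_ : 0 <= r%:R + 1) h2.
apply: le_trans (h3 _); last by lra.
have -> : (k + 1) ^+ 2 * (1 - (k * A + (r%:R + 1) * q) / (k + 1 + r%:R))
   = ((k + 1) ^+ 2 / (k + 1 + r%:R)) * (k * (1 - A) + (r%:R + 1) * (1 - q)).
  by field; rewrite gt_eqF.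
have e1 : (k + 1) ^+ 2 / (k + 1 + r%:R) <= k + 1.
  by rewrite ler_pdivrMr//; have := mulr_ge0 k0 (_ : 0 <= r%:R); nra.
have e2 : (k + 1) ^+ 2 / (k + 1 + r%:R) * (k * (1 - A)) <= k ^+ 2 * (1 - A).
  rewrite mulrA ler_wpM2r ?subr_ge0//.
  have [k00|k1] := eqVneq (size s) 0%N.
    by rewrite /k k00 mulr0 expr2 mul0r.
  have {}k1 : 1 <= k by rewrite ler1n lt0n.
  rewrite mulrAC ler_pdivrMr//; nra.
rewrite [leLHS]mulrDr [leRHS]mulrDr; apply: lerD; first exact: le_trans h1.
rewrite mulrCA ler_wpM2l ?addr_ge0// ler_wpM2r ?subr_ge0//.
by apply: le_trans e1 _; lra.
Qed.

(** With a = 1, [k (k + 1)] times the average is the sum of [2 j] times the j-th gain, while the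
    j-th increment of Z loses at most [2 j - 1] times that gain. *)
Lemma path_avg_up s : uniq s -> {subset s <= G} -> (size s <= K)%N ->
  (size s)%:R ^+ 2 - Z [set x in s]%SET
  <= (size s)%:R * ((size s)%:R + 1) * path_avg 1 s.
Proof.
elim: s => [|e s IH] us sG sK.
  by rewrite /= set_nil Z0 expr0n subr0 mul0r mulr0.
have [sSG cs eS us' sG'] := path_cons us sG sK.
have := Zstep sSG _ eS; rewrite cs => /(_ sK).
have /andP[q0 q1] : 0 <= sg e [set x in s]%SET <= 1 by apply: sg01; rewrite ?cs.
have := IH us' sG' (ltnW sK).
rewrite /= set_cons; set A := path_avg 1 s; set q := sg _ _.
set Zs := Z [set x in s]%SET; set Ze := Z _.
set k : R := (size s)%:R; move=> h1 h2.
have -> : (size s).+1%:R = k + 1 :> R by rewrite -natr1.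
have -> : ((size s).+1 + 1)%:R = k + 1 + 1 :> R by rewrite natrD -natr1.
have k0 : 0 <= k by [].
have -> : (k + 1) * (k + 1 + 1) * ((k * A + 2 * q) / (k + 1 + 1))
   = (k + 1) * (k * A + 2 * q) by field; lra.
have qq : 0 <= q := q0.
lra.
Qed.

(** [ln_invr_interpolate] at [z = Z / k^2]: the average with parameter r keeps z away from 0, the
    one with parameter 1 bounds [1 - z]. *)
Lemma path_ln_le e s : uniq (e :: s) -> {subset e :: s <= G} -> (size s < K)%N ->
  ln (#|e |: [set x in s]%SET|%:R ^+ 2 / Z (e |: [set x in s]%SET))
  <= (4 + 4 * r%:R) * path_avg 1 (e :: s)
     + (1 + ln (D (size s).+1)) * path_avg r (e :: s).
Proof.
move=> us sG sK.
have [sSG cs] := path_set us sG.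
have := path_avg_up us sG sK; have := path_avg_low us sG sK.
have p01 := path_avg01 r us sG sK; have /andP[q0 _] := path_avg01 1 us sG sK.
have := ZD sSG; have := Zle sSG; have := Z_gt0 sSG.
rewrite -set_cons cs; set S := [set x in e :: s]%SET; set A := path_avg r _ in p01 *.
set B := path_avg 1 _ in q0 *; rewrite [size (e :: s)]/=.
set k : R := (size s).+1%:R => /(_ isT) zz0 zz1 /(_ sK) zz2 h1 h2.
have k0 : 0 < k by rewrite ltr0n.
have k1 : 1 <= k by rewrite ler1n.
have k20 : 0 < k ^+ 2 by rewrite exprn_gt0.
rewrite -[_ / _]invrK invf_div.
apply: ln_invr_interpolate => //.
- by rewrite divr_gt0.
- by rewrite ler_pdivrMr// mul1r.
- by rewrite invf_div.
- by rewrite mulrA ler_pdivlMr// mulrC.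
have -> : 1 - Z S / k ^+ 2 = (k ^+ 2 - Z S) / k ^+ 2.
  by rewrite mulrBl divff// gt_eqF.
rewrite ler_pdivrMr//; apply: le_trans h2 _.
have : 0 <= B * (k * (k - 1)) by apply: mulr_ge0 => //; apply: mulr_ge0; rewrite ?subr_ge0//; exact: ltW.
lra.
Qed.

Lemma path_low s : uniq s -> {subset s <= G} -> (size s <= K)%N ->
  path_sum (fun e S => ln (#|e |: S|%:R ^+ 2 / Z (e |: S))) s <=
  path_sum (fun e S => low_weight #|S|.+1 * sg e S) s.
Proof.
move=> us sG sK.
(* The added potential is the weight of past gains that is reserved for later averages. Since [A' +
   (k + 1) / r * A' = k / r * A + (1 + 1/r) q], adding a gain q pays both for the current average
   and for the new potential; [D_mono] permits the passage to the smaller coefficient. *)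
suff : path_sum (fun e S => ln (#|e |: S|%:R ^+ 2 / Z (e |: S))) s
   + ((4 + 4 * r%:R) * ((size s)%:R * path_avg 1 s)
      + (1 + ln (D (size s))) * ((size s)%:R / r%:R * path_avg r s))
   <= path_sum (fun e S => low_weight #|S|.+1 * sg e S) s.
  apply: le_trans; rewrite lerDl.
  have /andP[p0 _] := path_avg01 r us sG sK; have /andP[q0 _] := path_avg01 1 us sG sK.
  apply: addr_ge0; first by rewrite !mulr_ge0 ?addr_ge0// mulr_ge0.
  have [->|s0] := posnP (size s); first by rewrite !mul0r mulr0.
  apply: mulr_ge0; last by rewrite mulr_ge0// divr_ge0.
  by rewrite addr_ge0// ln_ge0// D_ge1// s0.
elim: s us sG sK => [|e s IH] us sG sK.
  by rewrite /= !mul0r !mulr0 !addr0.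
have [sSG cs eS us' sG'] := path_cons us sG sK.
have H1 := path_ln_le us sG sK.
have {IH} := IH us' sG' (ltnW sK).
have /andP[p0 _] := path_avg01 r us' sG' (ltnW sK).
move: H1; rewrite [path_sum _ (e :: s)]/= [path_sum _ (e :: s)]/= cs.
set X := path_sum _ s; set Y := path_sum _ s; set L := ln (_ / _).
set q := sg e _; set A' := path_avg r (e :: s); set B' := path_avg 1 (e :: s).
rewrite [size (e :: s)]/=.
have rp : 0 < r%:R :> R by rewrite ltr0n ltnW.
have eA : A' * ((size s).+1%:R + r%:R) = (size s)%:R * path_avg r s + r.+1%:R * q.
  by rewrite /A' /= natrD divfK// gt_eqF// -natrD ltr0n.
have eB : B' * ((size s).+1%:R + 1) = (size s)%:R * path_avg 1 s + 2 * q.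
  by rewrite /B' /= natrD divfK// gt_eqF// -natrD ltr0n.
set A := path_avg r s in p0 eA *; set B := path_avg 1 s in eB *.
have Dmon : (1 + ln (D (size s).+1)) * ((size s)%:R / r%:R * A)
    <= (1 + ln (D (size s))) * ((size s)%:R / r%:R * A).
  have [->|s0] := posnP (size s); first by rewrite !mul0r !mulr0.
  rewrite ler_wpM2r ?mulr_ge0 ?divr_ge0// lerD2l ler_ln ?posrE.
  - by apply: D_mono; rewrite s0.
  - by apply: lt_le_trans ltr01 (D_ge1 _); rewrite sK.
  - by apply: lt_le_trans ltr01 (D_ge1 _); rewrite s0 ltnW.
move: Dmon; rewrite /low_weight; set l := ln (D (size s).+1); set l' := ln (D (size s)).
set c1 : R := 4 + 4 * r%:R; set k : R := (size s)%:R => Dmon hL hI.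
have eA' : A' + (size s).+1%:R / r%:R * A' = k / r%:R * A + (1 + r%:R^-1) * q.
  apply: (mulfI (lt0r_neq0 rp)); rewrite mulrDr.
  have -> : r%:R * ((size s).+1%:R / r%:R * A') = (size s).+1%:R * A'.
    by field; rewrite gt_eqF.
  have -> : r%:R * (k / r%:R * A + (1 + r%:R^-1) * q) = k * A + (r%:R + 1) * q.
    by field; rewrite gt_eqF.
  by rewrite natr1 -eA; ring.
have eB' : B' + (size s).+1%:R * B' = k * B + 2 * q by rewrite -eB; ring.
have := congr1 ( *%R c1) eB'; have := congr1 ( *%R (1 + l)) eA'.
move: Dmon hI hL; rewrite -/c1 -/k -/l.
set a := k / r%:R * A; set a' := _ / r%:R * A'; set b := k * B; set b' := (size s).+1%:R * B'.
clear eA eB eA' eB'.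
move: (r%:R^-1) q A' B' l l' L X Y c1 a a' b b' => *; lra.
Qed.

End LowLayers.

(** * Conflict kernels *)

Section Kernels.
Variables (R : realType) (n : nat) (d : degseq n) (G : digraph n).
Local Notation T := ('I_n * 'I_n)%type.
Implicit Types (S : {set T}) (e f : T).
Hypotheses (Gsimple : simple_digraph G) (Gd : obeys G d).

Lemma sum_in_eq v : (\sum_(f in G) (f.2 == v))%N = din d v.
Proof.
have [<- _] := Gd v; rewrite /indegree.
rewrite -sum1_card (eq_bigl (fun i => (i, v) \in G)) => [|i]; last by rewrite inE.
rewrite -big_mkcondr/= (reindex_onto (fun i => (i, v)) fst)/=.
  by apply: eq_bigl => i; rewrite !eqxx !andbT.
by move=> [i j]/= /andP[_ /eqP->].
Qed.

Lemma sum_out_eq u : (\sum_(f in G) (f.1 == u))%N = dout d u.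
Proof.
have [_ <-] := Gd u; rewrite /outdegree.
rewrite -sum1_card (eq_bigl (fun i => (u, i) \in G)) => [|i]; last by rewrite inE.
rewrite -big_mkcondr/= (reindex_onto (fun i => (u, i)) snd)/=.
  by apply: eq_bigl => i; rewrite !eqxx !andbT.
by move=> [i j]/= /andP[_ /eqP->].
Qed.

Lemma nedges_card : nedges d = #|G|.
Proof.
rewrite /nedges -sum1_card (eq_bigr (fun v => \sum_(f in G) (f.2 == v))%N) => [|v _].
  rewrite exchange_big/=; apply: eq_bigr => f _.
  by rewrite (bigD1 f.2)//= eqxx big1// => v; rewrite eq_sym => /negPf->.
by rewrite sum_in_eq.
Qed.

Lemma din_le v : (din d v <= dmax d)%N.
Proof. by apply: leq_trans (leq_maxl _ _); apply: (leq_bigmax v). Qed.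

Lemma dout_le v : (dout d v <= dmax d)%N.
Proof. by apply: leq_trans (leq_maxr _ _); apply: (leq_bigmax v). Qed.

Local Notation m := #|G|.
Local Notation D := ((dmax d)%:R : R).
Hypotheses (m0 : (0 < m)%N) (d2m : ((dmax d) ^ 2 <= m)%N).

Lemma dmax_gt0 : (0 < dmax d)%N.
Proof.
have /card_gt0P[[u v] uvG] := m0.
apply: leq_trans (din_le v); rewrite -sum_in_eq (bigD1 (u, v))//= eqxx//.
Qed.

Lemma D_ge1 : 1 <= D. Proof. by rewrite ler1n dmax_gt0. Qed.

Lemma D_le_sqr : D <= D ^+ 2.
Proof. by rewrite expr2 ler_peMl ?D_ge1. Qed.

Lemma mR_gt0 : 0 < m%:R :> R. Proof. by rewrite ltr0n. Qed.

Lemma D2m : D ^+ 2 <= m%:R. Proof. by rewrite -natrX ler_nat. Qed.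

Definition wt (u v : 'I_n) : R := (dout d u)%:R * (din d v)%:R / (2 * m%:R).

Lemma wt_le u v : 0 <= wt u v <= D ^+ 2 / (2 * m%:R).
Proof.
rewrite /wt divr_ge0 ?mulr_ge0//=.
rewrite ler_wpM2r ?invr_ge0 ?mulr_ge0//.
by rewrite expr2 ler_pM// ler_nat ?dout_le ?din_le.
Qed.

Lemma wt_half u v : 0 <= wt u v <= 2^-1.
Proof.
have /andP[-> h]/= := wt_le u v; apply: le_trans h _.
rewrite ler_pdivrMr ?mulr_gt0 ?mR_gt0//; have := D2m; lra.
Qed.

Definition bad S e f : bool := (e.1 == f.2) || ((e.1, f.2) \in G :\: S).

(* While S is the set of edges still to be placed, a stub pair given by the tail
   of e and the head of f is selected with weight gam S e f, so that zfun S is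
   the normalising constant of the next step. *)
Definition gam S e f : R := if bad S e f then 0 else 1 - wt e.1 f.2.

Definition zfun S : R := \sum_(e in S) \sum_(f in S) gam S e f.

(* Bounds the loss 1 - gam S e f independently of S, for e and f in S. *)
Definition bet e f : R :=
  if (e.1 == f.2) || [&& (e.1, f.2) \in G, (e.1, f.2) != e & (e.1, f.2) != f]
  then 1 else wt e.1 f.2.

Lemma bet01 e f : 0 <= bet e f <= 1.
Proof.
rewrite /bet; case: ifP => _; first by rewrite ler01 lexx.
by have /andP[-> h]/= := wt_half e.1 f.2; lra.
Qed.

Lemma bet_ge0 e f : 0 <= bet e f. Proof. by have /andP[] := bet01 e f. Qed.

Lemma gam01 S e f : 0 <= gam S e f <= 1.
Proof.
rewrite /gam; case: ifP => _; first by rewrite lexx ler01.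
have := wt_half e.1 f.2; lra.
Qed.

Lemma gam_ge S e f : e \in S -> f \in S -> 1 - bet e f <= gam S e f.
Proof.
move=> eS fS; rewrite /gam /bad /bet.
have [->|ne]/= := eqVneq e.1 f.2; first by rewrite subrr.
case: (boolP (_ \in G :\: S)) => [|_]; last first.
  by have := wt_half e.1 f.2; case: ifP => _; lra.
rewrite inE => /andP[nS inG].
have -> : (e.1, f.2) != e by apply/eqP => E; move: nS; rewrite E eS.
have -> : (e.1, f.2) != f by apply/eqP => E; move: nS; rewrite E fS.
by rewrite inG/= subrr.
Qed.

Lemma gam_mono S x e f : gam S e f <= gam (x |: S) e f.
Proof.
rewrite {1}/gam; case: ifP => [_|]; first by have /andP[] := gam01 (x |: S) e f.
move=> /negbT; rewrite /gam /bad negb_or => /andP[/negPf-> /=].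
rewrite !inE negb_and negbK; case: (_ \in S) => /=; first by rewrite orbT.
by move=> /negPf->; rewrite andbF.
Qed.

Lemma gam_step_le S x e f : gam (x |: S) e f <= gam S e f + ((e.1, f.2) == x)%:R.
Proof.
have [ex|ex] := eqVneq (e.1, f.2) x; rewrite ?mulr1n ?mulr0n.
  by have /andP[a _] := gam01 S e f; have /andP[_ b] := gam01 (x |: S) e f; lra.
by rewrite addr0 /gam /bad !inE (negPf ex).
Qed.

Lemma gam_diag S e : S \subset G -> e \in S -> 2^-1 <= gam S e e.
Proof.
move=> sSG eS; rewrite /gam /bad -surjective_pairing inE eS orbF.
have -> : e.1 == e.2 = false.
  apply/negP => /eqP ee; have := Gsimple e.1.
  by rewrite [X in (_, X)]ee -surjective_pairing (fintype.subsetP sSG _ eS).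
have := wt_half e.1 e.2; lra.
Qed.

Lemma bet_diag e : e \in G -> bet e e <= D ^+ 2 / (2 * m%:R).
Proof.
move=> eG; rewrite /bet -surjective_pairing eqxx andbF orbF.
have -> : e.1 == e.2 = false.
  apply/negP => /eqP ee; have := Gsimple e.1.
  by rewrite [X in (_, X)]ee -surjective_pairing eG.
by have /andP[] := wt_le e.1 e.2.
Qed.

Lemma sum_in_le v : \sum_(f in G) (f.2 == v)%:R <= D.
Proof. by rewrite -natr_sum sum_in_eq ler_nat din_le. Qed.

Lemma sum_out_le v : \sum_(f in G) (f.1 == v)%:R <= D.
Proof. by rewrite -natr_sum sum_out_eq ler_nat dout_le. Qed.

Lemma bet_le e f :
  bet e f <= (f.2 == e.1)%:R + ((e.1, f.2) \in G)%:R + D ^+ 2 / (2 * m%:R).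
Proof.
have /andP[w0 w1] := wt_le e.1 f.2.
rewrite /bet [e.1 == _]eq_sym; set q := D ^+ 2 / _ in w1 *.
have t1 : true%:R = 1 :> R by []; have f0 : false%:R = 0 :> R by [].
case: (f.2 == _); first by case: (_ \in G); rewrite /= ?t1 ?f0; lra.
by case: (_ \in G) => /=; first case: ifP => _; rewrite ?t1 ?f0; lra.
Qed.

Lemma sum_wt_bound : \sum_(f in G) (D ^+ 2 / (2 * m%:R)) = D ^+ 2 / 2.
Proof. by rewrite sumr_const -mulr_natr; field; rewrite pnatr_eq0 -lt0n. Qed.

(** Such an f shares its head with one of the at most D edges of G leaving u, and each head belongs
    to at most D edges f. *)
Lemma sum_third_out u :
  \sum_(f in G) ((u, f.2) \in G)%:R <= D ^+ 2.
Proof.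
rewrite (eq_bigr (fun f => \sum_(g in G) ((g.1 == u)%:R * (f.2 == g.2)%:R)));
  last first.
  move=> f _; case: (boolP (_ \in G)) => [uG|uG].
    rewrite (bigD1 (u, f.2))//= !eqxx mulr1 big1 ?addr0// => [[a b]]/=.
    move=> /andP[_]; rewrite xpair_eqE [f.2 == b]eq_sym negb_and.
    by move=> /orP[]/negPf->; rewrite ?mulr0 ?mul0r.
  rewrite big1// => [[a b]]/= abG; apply/eqP; rewrite mulf_eq0 !pnatr_eq0 !eqb0.
  rewrite -negb_and; apply/negP => /andP[/eqP E1 /eqP E2]; by move: uG; rewrite -E1 E2 abG.
rewrite exchange_big/=.
apply: (@le_trans _ _ (\sum_(g in G) (g.1 == u)%:R * D)).
  by apply: ler_sum => g _; rewrite -mulr_sumr ler_wpM2l// sum_in_le.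
by rewrite -mulr_suml expr2 ler_wpM2r// sum_out_le.
Qed.

Lemma sum_third_in v :
  \sum_(f in G) ((f.1, v) \in G)%:R <= D ^+ 2.
Proof.
rewrite (eq_bigr (fun f => \sum_(g in G) ((g.2 == v)%:R * (f.1 == g.1)%:R)));
  last first.
  move=> f _; case: (boolP (_ \in G)) => [uG|uG].
    rewrite (bigD1 (f.1, v))//= !eqxx mulr1 big1 ?addr0// => [[a b]]/=.
    move=> /andP[_]; rewrite xpair_eqE [f.1 == a]eq_sym negb_and.
    by move=> /orP[]/negPf->; rewrite ?mulr0 ?mul0r.
  rewrite big1// => [[a b]]/= abG; apply/eqP; rewrite mulf_eq0 !pnatr_eq0 !eqb0.
  rewrite -negb_and; apply/negP => /andP[/eqP E1 /eqP E2]; by move: uG; rewrite -E1 E2 abG.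
rewrite exchange_big/=.
apply: (@le_trans _ _ (\sum_(g in G) (g.2 == v)%:R * D)).
  by apply: ler_sum => g _; rewrite -mulr_sumr ler_wpM2l// sum_out_le.
by rewrite -mulr_suml expr2 ler_wpM2r// sum_in_le.
Qed.

Lemma bet_row e : \sum_(f in G) bet e f <= 5 / 2 * D ^+ 2.
Proof.
apply: le_trans (ler_sum _ (fun f _ => bet_le e f)) _.
rewrite !big_split/= sum_wt_bound.
have := sum_in_le e.1; have := sum_third_out e.1; have := D_le_sqr; lra.
Qed.

Lemma bet_col f : \sum_(e in G) bet e f <= 5 / 2 * D ^+ 2.
Proof.
apply: le_trans (ler_sum _ (fun e _ => bet_le e f)) _.
rewrite !big_split/= sum_wt_bound.
under eq_bigr do rewrite eq_sym.
have := sum_out_le f.2; have := sum_third_in f.2; have := D_le_sqr; lra.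
Qed.

Definition inc e S : R := \sum_(f in S) (bet e f + bet f e) + bet e e.

Lemma sum2_setU1 e S (F : T -> T -> R) : e \notin S ->
  \sum_(a in e |: S) \sum_(b in e |: S) F a b =
  \sum_(a in S) \sum_(b in S) F a b + \sum_(f in S) (F e f + F f e) + F e e.
Proof.
move=> eS; rewrite big_setU1//= big_setU1//= big_split/=.
under [X in _ + X = _]eq_bigr do rewrite big_setU1//=.
by rewrite [X in _ + X = _]big_split/=; ring.
Qed.

Lemma zfun_step_ge S e : e \notin S ->
  zfun S + (2 * #|S|%:R + 1) - inc e S <= zfun (e |: S).
Proof.
move=> eS; rewrite /zfun sum2_setU1//.
have h1 : \sum_(a in S) \sum_(b in S) gam S a b
   <= \sum_(a in S) \sum_(b in S) gam (e |: S) a b.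
  by apply: ler_sum => a _; apply: ler_sum => b _; exact: gam_mono.
have h2 : \sum_(f in S) (2 - (bet e f + bet f e))
   <= \sum_(f in S) (gam (e |: S) e f + gam (e |: S) f e).
  apply: ler_sum => f fS.
  have := @gam_ge (e |: S) e f; have := @gam_ge (e |: S) f e.
  by rewrite !inE eqxx fS orbT/= => /(_ isT isT) ? /(_ isT isT) ?; lra.
have h3 : 1 - bet e e <= gam (e |: S) e e by rewrite gam_ge// !inE eqxx.
move: h2; rewrite sumrB sumr_const -mulr_natr /inc; lra.
Qed.

(** Enlarging S by e frees only the stub pairs that would form e itself: a tail stub at [e.1]
    together with one of at most D head stubs at [e.2]. *)
Lemma zfun_step_le S e : S \subset G -> e \notin S ->
  zfun (e |: S) <= zfun S + (2 * #|S|%:R + 1) + D * \sum_(f in S) (f.1 == e.1)%:R.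
Proof.
move=> sSG eS; rewrite /zfun sum2_setU1//.
have h1 : \sum_(a in S) \sum_(b in S) gam (e |: S) a b
   <= \sum_(a in S) \sum_(b in S) gam S a b + D * \sum_(f in S) (f.1 == e.1)%:R.
  rewrite mulr_sumr -big_split/=; apply: ler_sum => a _.
  apply: le_trans (ler_sum _ (fun b _ => gam_step_le S e a b)) _.
  rewrite big_split/= lerD2l.
  rewrite (eq_bigr (fun b => (a.1 == e.1)%:R * (b.2 == e.2)%:R)) => [|b _]; last first.
    by rewrite -natrM mulnb -xpair_eqE -surjective_pairing.
  rewrite -mulr_sumr mulrC ler_wpM2r//.
  apply: le_trans _ (sum_in_le e.2).
  by rewrite [leRHS](big_setID S)/= (finset.setIidPr sSG) lerDl sumr_ge0.
have h2 : \sum_(f in S) (gam (e |: S) e f + gam (e |: S) f e)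
   <= \sum_(f in S) (2 : R).
  apply: ler_sum => f _.
  by have := gam01 (e |: S) e f; have := gam01 (e |: S) f e; lra.
have := gam01 (e |: S) e e.
move: h2; rewrite sumr_const -mulr_natr; lra.
Qed.

Lemma zfun_le S : zfun S <= #|S|%:R ^+ 2.
Proof.
rewrite expr2 mulr_natr -sumr_const; apply: ler_sum => e _.
rewrite -[leRHS]mulr1 mulr_natl -sumr_const; apply: ler_sum => f _.
by have /andP[] := gam01 S e f.
Qed.

Lemma zfun_gt0 S : S \subset G -> (0 < #|S|)%N -> 0 < zfun S.
Proof.
move=> sSG /card_gt0P[e eS].
rewrite /zfun (bigD1 e)//= (bigD1 e)//= -addrA ltr_pwDl//.
  by apply: lt_le_trans (gam_diag sSG eS); rewrite invr_gt0.
rewrite addr_ge0 ?sumr_ge0// => [f _|f _]; last rewrite sumr_ge0// => f' _.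
  by have /andP[] := gam01 S e f.
by have /andP[] := gam01 S f f'.
Qed.

Lemma psi_le S : S \subset G -> #|S|%:R ^+ 2 - zfun S <= 5 / 2 * D ^+ 2 * #|S|%:R.
Proof.
move=> sSG.
apply: (@le_trans _ _ (\sum_(e in S) \sum_(f in S) bet e f)).
  rewrite expr2 mulr_natr -sumr_const -sumrB; apply: ler_sum => e eS.
  rewrite -[X in X - _]mulr1 mulr_natl -sumr_const -sumrB; apply: ler_sum => f fS.
  by have := gam_ge eS fS; lra.
rewrite mulr_natr -sumr_const; apply: ler_sum => e eS.
apply: le_trans _ (bet_row e).
by rewrite [leRHS](big_setID S)/= (finset.setIidPr sSG) lerDl sumr_ge0// => f _;
  exact: bet_ge0.
Qed.

Lemma zfun_half S : S \subset G -> 5 * D ^+ 2 <= #|S|%:R ->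
  #|S|%:R ^+ 2 / 2 <= zfun S.
Proof.
move=> sSG Sd; have := psi_le sSG.
have := ler_wpM2r (ler0n R #|S|) Sd; lra.
Qed.

(** [bet e f + bet f e] bounds the conflicts of the new pairs formed by e and f, the third summand
    counts the pairs freed by adding e to S, and [D^2 / m] spreads the loss [bet e e] over the
    elements of a nonempty S. *)
Definition kap e f : R :=
  bet e f + bet f e + D * (f.1 == e.1)%:R + D ^+ 2 / m%:R.

Lemma kap_ge0 e f : 0 <= kap e f.
Proof. by rewrite !addr_ge0 ?bet_ge0 ?mulr_ge0 ?invr_ge0. Qed.

Lemma sum_kap_cst : \sum_(f in G) (D ^+ 2 / m%:R) = D ^+ 2.
Proof. by rewrite sumr_const -[LHS]mulr_natr divfK// pnatr_eq0 -lt0n. Qed.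

Lemma kap_row e : \sum_(f in G) kap e f <= 7 * D ^+ 2.
Proof.
rewrite !big_split/= sum_kap_cst -mulr_sumr.
have := bet_row e; have := bet_col e.
have := ler_wpM2l (ler0n R (dmax d)) (sum_out_le e.1); lra.
Qed.

Lemma kap_col f : \sum_(e in G) kap e f <= 7 * D ^+ 2.
Proof.
rewrite !big_split/= sum_kap_cst -mulr_sumr.
under [X in _ * X]eq_bigr do rewrite eq_sym.
have := bet_row f; have := bet_col f.
have := ler_wpM2l (ler0n R (dmax d)) (sum_out_le f.1); lra.
Qed.

Lemma zfun_step_kap S e : S \subset G -> (0 < #|S|)%N -> e \in G :\: S ->
  `|zfun (e |: S) - zfun S - (2 * #|S|%:R + 1)| <= \sum_(f in S) kap e f.
Proof.
move=> sSG S0; rewrite inE => /andP[eS eG].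
have h1 := zfun_step_ge eS; have h2 := zfun_step_le sSG eS.
have h3 : bet e e <= \sum_(f in S) (D ^+ 2 / m%:R).
  apply: le_trans (bet_diag eG) _; rewrite sumr_const -[leRHS]mulr_natr.
  have q0 : 0 <= D ^+ 2 / m%:R by rewrite divr_ge0.
  have s1 : 1 <= #|S|%:R :> R by rewrite ler1n.
  rewrite invfM mulrCA; nra.
have h4 : 0 <= \sum_(f in S) (D ^+ 2 / m%:R) by rewrite sumr_ge0// => f _; rewrite divr_ge0.
have h5 : 0 <= \sum_(f in S) (bet e f + bet f e).
  by rewrite sumr_ge0// => f _; rewrite addr_ge0 ?bet_ge0.
have h6 : 0 <= D * \sum_(f in S) (f.1 == e.1)%:R by rewrite mulr_ge0 ?sumr_ge0.
move: h1; rewrite /inc => h1.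
rewrite /kap big_split/= big_split/= -mulr_sumr.
by rewrite ler_norml; apply/andP; split; lra.
Qed.

End Kernels.

(** * Selectable pairs in small residual sets *)

Section GoodPairs.
Variables (R : realType) (n : nat) (d : degseq n) (G : digraph n).
Local Notation T := ('I_n * 'I_n)%type.
Implicit Types (S A : {set T}) (e f : T).
Hypotheses (Gsimple : simple_digraph G) (Gd : obeys G d).
Local Notation m := #|G|.
Local Notation D := ((dmax d)%:R : R).
Hypotheses (m0 : (0 < m)%N) (d2m : ((dmax d) ^ 2 <= m)%N).

Definition fiber A (p : T -> 'I_n) v : R := \sum_(x in A) (p x == v)%:R.

Lemma light_sum A (p : T -> 'I_n) (B : pred 'I_n) (th : R) : 0 <= th ->
  \sum_(f in A | (fiber A p (p f) < th) && B (p f)) 1 <= #|B|%:R * th.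
Proof.
move=> th0; rewrite (partition_big p B)/=; last by move=> f /andP[_ /andP[]].
rewrite mulr_natl -sumr_const; apply: ler_sum => v vB.
have [lv|lv] := ltP (fiber A p v) th; last first.
  rewrite big1// => f /andP[/andP[_ /andP[+ _]] /eqP pf].
  by rewrite pf ltNge lv.
apply: le_trans (ltW lv); rewrite [in leRHS]/fiber.
rewrite [leRHS](bigID (fun f => (fiber A p (p f) < th) && B (p f)))/=.
apply: (@le_trans _ _ (\sum_(f | (((f \in A) && ((fiber A p (p f) < th) && B (p f)))
    && (p f == v))) (p f == v)%:R)).
  by apply: ler_sum => f /andP[_ ->].
rewrite -[leLHS]addr0 lerD//; last by rewrite sumr_ge0.
rewrite [leLHS]big_mkcond [leRHS]big_mkcond/=; apply: ler_sum => f _.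
by case: (f \in A) => //=; case: (_ && B _) => //=; case: (p f == v).
Qed.

Definition good S e f : R := (~~ bad G S e f)%:R.

(** With this threshold, [2 D] excluded vertices account for at most [2 D * #|A| / (8 D)], a quarter
    of A. *)
Definition light A (p : T -> 'I_n) : {set T} :=
  [set f in A | fiber A p (p f) < #|A|%:R / (8 * D)]%SET.

Lemma light_subset A p : light A p \subset A.
Proof. by apply/fintype.subsetP => f; rewrite inE => /andP[]. Qed.

Lemma light_good_heads S A e :
  #|light A snd|%:R - #|A|%:R / 4 <= \sum_(f in light A snd) good S e f.
Proof.
have D0 : 0 < D by rewrite ltr0n (dmax_gt0 Gd m0).
pose B := [pred v | (e.1 == v) || ((e.1, v) \in G)].
have cB : (#|B| <= 2 * dmax d)%N.
  apply: (@leq_trans (1 + dout d e.1)); last first.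
    by rewrite mul2n -addnn leq_add ?(dmax_gt0 Gd m0)// dout_le.
  have [_ <-] := Gd e.1; rewrite /outdegree -(cards1 e.1).
  apply: leq_trans (subset_leq_card _) (leq_card_setU _ _).
  apply/fintype.subsetP => v; rewrite !inE => /orP[/eqP->|->].
    by rewrite eqxx.
  by rewrite orbT.
have th0 : 0 <= #|A|%:R / (8 * D) by rewrite divr_ge0 ?mulr_ge0.
have h := light_sum A snd B th0.
have h1 : #|B|%:R * (#|A|%:R / (8 * D)) <= #|A|%:R / 4.
  apply: (@le_trans _ _ (2 * D * (#|A|%:R / (8 * D)))).
    by rewrite ler_wpM2r// -natrM ler_nat.
  by rewrite le_eqVlt; apply/orP; left; apply/eqP; field; rewrite gt_eqF.
have h2 : \sum_(f in light A snd) (bad G S e f)%:R <= #|A|%:R / 4 :> R.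
  apply: le_trans _ (le_trans h h1).
  rewrite [leLHS]big_mkcond [leRHS]big_mkcond/=; apply: ler_sum => f _.
  rewrite inE; case: (f \in A) => //=; case: (_ < _) => //=.
  rewrite /bad; case: (e.1 == f.2) => //=.
  by rewrite inE; case: (_ \in G); rewrite ?andbF//=; case: (_ \notin S).
suff -> : \sum_(f in light A snd) good S e f =
   #|light A snd|%:R - \sum_(f in light A snd) (bad G S e f)%:R by lra.
rewrite -sumr_const -sumrB; apply: eq_bigr => f _; rewrite /good.
by case: bad; rewrite ?subrr ?subr0.
Qed.

Lemma light_good_tails S A f :
  #|light A fst|%:R - #|A|%:R / 4 <= \sum_(e in light A fst) good S e f.
Proof.
have D0 : 0 < D by rewrite ltr0n (dmax_gt0 Gd m0).
pose B := [pred u | (u == f.2) || ((u, f.2) \in G)].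
have cB : (#|B| <= 2 * dmax d)%N.
  apply: (@leq_trans (1 + din d f.2)); last first.
    by rewrite mul2n -addnn leq_add ?(dmax_gt0 Gd m0)// din_le.
  have [<- _] := Gd f.2; rewrite /indegree -(cards1 f.2).
  apply: leq_trans (subset_leq_card _) (leq_card_setU _ _).
  apply/fintype.subsetP => v; rewrite !inE => /orP[/eqP->|->].
    by rewrite eqxx.
  by rewrite orbT.
have th0 : 0 <= #|A|%:R / (8 * D) by rewrite divr_ge0 ?mulr_ge0.
have h := light_sum A fst B th0.
have h1 : #|B|%:R * (#|A|%:R / (8 * D)) <= #|A|%:R / 4.
  apply: (@le_trans _ _ (2 * D * (#|A|%:R / (8 * D)))).
    by rewrite ler_wpM2r// -natrM ler_nat.
  by rewrite le_eqVlt; apply/orP; left; apply/eqP; field; rewrite gt_eqF.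
have h2 : \sum_(e in light A fst) (bad G S e f)%:R <= #|A|%:R / 4 :> R.
  apply: le_trans _ (le_trans h h1).
  rewrite [leLHS]big_mkcond [leRHS]big_mkcond/=; apply: ler_sum => e _.
  rewrite inE; case: (e \in A) => //=; case: (_ < _) => //=.
  rewrite /bad; case: (e.1 == f.2) => //=.
  by rewrite inE; case: (_ \in G); rewrite ?andbF//=; case: (_ \notin S).
suff -> : \sum_(e in light A fst) good S e f =
   #|light A fst|%:R - \sum_(e in light A fst) (bad G S e f)%:R by lra.
rewrite -sumr_const -sumrB; apply: eq_bigr => e _; rewrite /good.
by case: bad; rewrite ?subrr ?subr0.
Qed.

Lemma card_heavy A p : #|A|%:R = #|light A p|%:R + #|A :\: light A p|%:R :> R.
Proof.
by rewrite -natrD -(cardsID (light A p) A) (finset.setIidPr (light_subset A p)).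
Qed.

(** Joining a tail stub at [e.1] to a head stub at [e.2] forms e, which is still to be placed and
    hence admissible, whichever edges own the two stubs; distinct e give distinct pairs. *)
Lemma sum_good_paths S A (B C : {set T}) : S \subset G -> A \subset S -> B \subset S -> C \subset S ->
  \sum_(e in C) fiber A fst e.1 * fiber B snd e.2
  <= \sum_(x in S) \sum_(y in S) good S x y.
Proof.
move=> sSG sA sB sC.
apply: (@le_trans _ _ (\sum_(x in A) \sum_(y in B) good S x y)).
  rewrite (eq_bigr (fun e => \sum_(x in A) \sum_(y in B)
      ((x.1, y.2) == e)%:R)) => [|e _]; last first.
    rewrite /fiber mulr_suml; apply: eq_bigr => x _.
    rewrite mulr_sumr; apply: eq_bigr => y _.
    by rewrite -natrM mulnb -xpair_eqE -surjective_pairing.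
  rewrite exchange_big/=; apply: ler_sum => x xA.
  rewrite exchange_big/=; apply: ler_sum => y yB.
  rewrite -natr_sum /good ler_nat.
  have [xyC|xyC] := boolP ((x.1, y.2) \in C); last first.
    by rewrite big1// => e eC; case: eqP => // E; rewrite E eC in xyC.
  rewrite (bigD1 (x.1, y.2))//= eqxx big1 => [|e /andP[_ /negPf]]; last first.
    by rewrite eq_sym => ->.
  rewrite addn0 lt0b /bad negb_or inE (fintype.subsetP sC _ xyC) andbT.
  apply/negP => /eqP xy; have := Gsimple x.1.
  by rewrite [X in (_, X)]xy (fintype.subsetP sSG) ?(fintype.subsetP sC).
rewrite [leRHS](big_setID A)/= (finset.setIidPr sA) -[leLHS]addr0 lerD//; last first.
  by rewrite sumr_ge0// => x _; rewrite sumr_ge0.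
apply: ler_sum => x _.
by rewrite [leRHS](big_setID B)/= (finset.setIidPr sB) lerDl sumr_ge0.
Qed.

(* Either most heads (or tails) are light, and then half of the pairs are good
   since a vertex has at most 2 D bad partners; or there are many edges with
   both ends heavy, and each such edge alone accounts for many good pairs. *)
Lemma sum_good_ge S : S \subset G -> #|S|%:R <= 112 * D ^+ 2 ->
  #|S|%:R ^+ 3 <= 2048 * D ^+ 2 * \sum_(x in S) \sum_(y in S) good S x y.
Proof.
move=> sSG SD.
have D0 : 0 < D by rewrite ltr0n (dmax_gt0 Gd m0).
set N := \sum_(x in S) _; set k : R := #|S|%:R in SD *.
have k0 : 0 <= k by [].
(* The upper bound on k turns a quadratic estimate into the cubic one, as [16 * 112 <= 2048]. *)
have quad : k ^+ 2 / 16 <= N -> k ^+ 3 <= 2048 * D ^+ 2 * N.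
  move=> h; have N0 : 0 <= N by apply: le_trans _ h; rewrite divr_ge0 ?exprn_ge0.
  have -> : k ^+ 3 = k * (16 * (k ^+ 2 / 16)) by field.
  apply: (@le_trans _ _ (112 * D ^+ 2 * (16 * N))).
    by rewrite ler_pM ?mulr_ge0 ?divr_ge0 ?exprn_ge0// ler_wpM2l.
  have := mulr_ge0 (sqr_ge0 D) N0; lra.
pose H := S :\: light S snd.
have sH : H \subset S by exact: finset.subsetDl.
have cS := card_heavy S snd; rewrite -/H -/k in cS.
have [hH|hH] := leP #|H|%:R (k / 2).
  apply: quad; apply: (@le_trans _ _ (\sum_(x in S) k / 4)).
    by rewrite sumr_const -[leRHS]mulr_natr -/k; nra.
  apply: ler_sum => x xS.
  apply: le_trans (le_trans _ (light_good_heads S S x)) _.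
    by rewrite -/k; lra.
  rewrite [leRHS](big_setID (light S snd))/= (finset.setIidPr (light_subset _ _)).
  by rewrite lerDl sumr_ge0.
pose H' := H :\: light H fst.
have cH := card_heavy H fst; rewrite -/H' in cH.
have [hH'|hH'] := leP #|H'|%:R (#|H|%:R / 2 : R).
  apply: quad; apply: (@le_trans _ _ (\sum_(y in H) #|H|%:R / 4)).
    rewrite sumr_const -[leRHS]mulr_natr.
    have : (k / 2) ^+ 2 <= #|H|%:R ^+ 2.
      by rewrite lerXn2r ?nnegrE ?divr_ge0// ltW.
    lra.
  rewrite /N exchange_big/=.
  apply: (@le_trans _ _ (\sum_(y in H) \sum_(x in S) good S x y)); last first.
    rewrite [leRHS](big_setID H)/= (finset.setIidPr sH) lerDl sumr_ge0// => y _.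
    by rewrite sumr_ge0.
  apply: ler_sum => y yH.
  apply: le_trans (le_trans _ (light_good_tails S H y)) _; first by lra.
  have sL : light H fst \subset S := fintype.subset_trans (light_subset _ _) sH.
  by rewrite [leRHS](big_setID (light H fst))/= (finset.setIidPr sL) lerDl sumr_ge0.
have sH' : H' \subset S := fintype.subset_trans (finset.subsetDl _ _) sH.
have h := sum_good_paths sSG sH (fintype.subxx S) sH'.
rewrite -/N in h.
have h1 : \sum_(e in H') (#|H|%:R / (8 * D)) * (k / (8 * D)) <= N.
  apply: le_trans _ h; apply: ler_sum => e.
  rewrite !inE => /andP[+ /andP[+ eS]]; rewrite eS /= => l1 l2.
  rewrite ler_pM ?divr_ge0 ?mulr_ge0//; last by rewrite leNgt.
  by move: l1; rewrite l2 -leNgt.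
move: h1; rewrite sumr_const -[leLHS]mulr_natr => h1.
have D20 : 0 < D ^+ 2 by rewrite exprn_gt0.
have h2 : k ^+ 3 / (512 * D ^+ 2) <= N.
  apply: le_trans _ h1.
  have -> : k ^+ 3 / (512 * D ^+ 2) = ((k / 2) / (8 * D)) * (k / (8 * D)) * (k / 4).
    by field; rewrite gt_eqF.
  apply: ler_pM; rewrite ?mulr_ge0 ?invr_ge0 ?mulr_ge0//; last by lra.
  rewrite ler_wpM2r ?divr_ge0 ?mulr_ge0//.
  by rewrite ler_wpM2r ?invr_ge0 ?mulr_ge0// ltW.
move: h2; rewrite ler_pdivrMr ?mulr_gt0// => h2.
apply: le_trans h2 _.
have N0 : 0 <= N by rewrite sumr_ge0// => x _; rewrite sumr_ge0.
have := mulr_ge0 N0 (ltW D20); lra.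
Qed.

Lemma zfun_ratio_le S : S \subset G -> (0 < #|S|)%N ->
  #|S|%:R <= 112 * D ^+ 2 ->
  #|S|%:R ^+ 2 / zfun R d G S <= 4096 * D ^+ 2 / #|S|%:R.
Proof.
move=> sSG S0 SD; have s0 : 0 < #|S|%:R :> R by rewrite ltr0n.
have z0 := zfun_gt0 R Gsimple m0 d2m sSG S0.
rewrite ler_pdivrMr// mulrAC ler_pdivlMr// -exprSr.
apply: le_trans (sum_good_ge sSG SD) _.
suff : (\sum_(x in S) \sum_(y in S) good S x y) / 2 <= zfun R d G S.
  move=> h; have := ler_wpM2l (sqr_ge0 D) h; lra.
rewrite mulr_suml; apply: ler_sum => x _; rewrite mulr_suml; apply: ler_sum => y _.
rewrite /good /gam; case: bad; rewrite /= ?mul0r ?mul1r//.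
have := wt_half R m0 d2m x.1 y.2; lra.
Qed.

End GoodPairs.

(** * Upper bound for the chain expectation *)

Lemma sum_invr_sqr_le (R : realType) j M : (0 < j <= M)%N ->
  \sum_(j.+1 <= k < M.+1) (k%:R ^+ 2)^-1 <= j%:R^-1 - M%:R^-1 :> R.
Proof.
move=> /andP[j0 jM]; elim: M jM => [|M IH] jM; first by rewrite leqNgt j0 in jM.
move: jM; rewrite leq_eqVlt => /orP[/eqP<-|jM].
  by rewrite big_geq// subrr.
rewrite big_nat_recr//=; have M0 : 0 < M%:R :> R by rewrite ltr0n; exact: leq_trans j0 jM.
apply: le_trans (lerD (IH jM) (lexx _)) _.
rewrite -natr1; set x : R := M%:R in M0 *.
suff : ((x + 1) ^+ 2)^-1 <= x^-1 - (x + 1)^-1 by lra.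
have -> : x^-1 - (x + 1)^-1 = (x * (x + 1))^-1 by field; rewrite !gt_eqF//; lra.
rewrite lef_pV2 ?posrE ?exprn_gt0 ?mulr_gt0//; lra || nra.
Qed.

Section ChainBounds.
Variables (R : realType) (n : nat) (d : degseq n) (G : digraph n).
Local Notation T := ('I_n * 'I_n)%type.
Implicit Types (S : {set T}) (e f : T).
Hypotheses (Gsimple : simple_digraph G) (Gd : obeys G d).
Local Notation m := #|G|.
Local Notation D := ((dmax d)%:R : R).
Local Notation H := (harm R G).
Hypothesis m0 : (0 < m)%N.
Hypothesis dm : 224 * D ^+ 2 * (1 + H) <= m%:R.

Let D1 : 1 <= D. Proof. exact: D_ge1. Qed.
Let D20 : 0 < D ^+ 2. Proof. by rewrite exprn_gt0 ?(lt_le_trans ltr01 D1). Qed.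
Let mR : 0 < m%:R :> R. Proof. by rewrite ltr0n. Qed.
Let H0 : 0 <= H. Proof. exact: harm_ge0. Qed.

Let dm2 : 224 * D ^+ 2 <= m%:R.
Proof. by apply: le_trans dm; have := mulr_ge0 (ltW D20) H0; lra. Qed.

Let d2m : (dmax d ^ 2 <= m)%N.
Proof. by rewrite -(ler_nat R) natrX; move: dm2 D20; lra. Qed.

(** [coef] vanishes up to the cutoff, so its tails are at most [2 / cutoff]. With [Dl = 7 D^2] the
    constant 112 gives [Dl * tail <= 1/8], the smallness required by the exponential moment
    bound. *)
Definition cutoff : nat := (112 * dmax d ^ 2)%N.

Let cutE : cutoff%:R = 112 * D ^+ 2 :> R. Proof. by rewrite natrM natrX. Qed.

Let cut0 : (0 < cutoff)%N.
Proof. by rewrite muln_gt0 expn_gt0 (dmax_gt0 Gd m0). Qed.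

Let cutm : (2 * cutoff <= m)%N.
Proof. by rewrite -(ler_nat R) natrM cutE; move: dm2; lra. Qed.

Definition rho S : R := #|S|%:R ^+ 2 / zfun R d G S.
Definition xi S : R := if (cutoff < #|S|)%N then ln (rho S) else 0.
Definition coef k : R := if (cutoff < k)%N then 2 / k%:R ^+ 2 else 0.
(** Bound for the fraction of the conflict-free increment [2 #|S| + 1] of [zfun] that is lost when e
    joins S. *)
Definition gain e S : R := inc R d G e S / (2 * #|S|%:R + 1).

Lemma coef_ge0 k : 0 <= coef k.
Proof. by rewrite /coef; case: ifP => // _; rewrite divr_ge0 ?exprn_ge0. Qed.

Lemma rho_pos S : S \subset G -> (0 < #|S|)%N -> 0 < rho S.
Proof.
by move=> sSG S0; rewrite divr_gt0 ?exprn_gt0 ?ltr0n//; exact: zfun_gt0.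
Qed.

(** Both values of [zfun] are compared with [zfun S + 2 #|S| + 1]. The logarithm of their ratio is
    at most their difference divided by [zfun (e |: S)], which exceeds half of the squared size
    above the cutoff; hence the 2 in [coef]. *)
Lemma xi_lip S e e' : S \subset G -> e \in G :\: S -> e' \in G :\: S ->
  xi (e |: S) - xi (e' |: S) <=
  coef #|S|.+1 * (\sum_(f in S) kap R d G e f + \sum_(f in S) kap R d G e' f).
Proof.
move=> sSG eS e'S.
have cU x : x \in G :\: S -> #|x |: S| = #|S|.+1.
  by rewrite inE => /andP[xS _]; rewrite cardsU1 xS add1n.
have sU x : x \in G :\: S -> x |: S \subset G.
  by rewrite inE => /andP[_ xG]; rewrite subUset sub1set xG.
rewrite /xi /coef !cU//; case: ifP => [cS|_]; last by rewrite subrr mul0r.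
have S0 : (0 < #|S|)%N by exact: leq_trans cut0 cS.
have h1 := zfun_step_kap R Gsimple Gd m0 d2m sSG S0 eS.
have h2 := zfun_step_kap R Gsimple Gd m0 d2m sSG S0 e'S.
have Z1 := zfun_gt0 R Gsimple m0 d2m (sU _ eS).
have Z2 := zfun_gt0 R Gsimple m0 d2m (sU _ e'S).
have Z1h : #|S|.+1%:R ^+ 2 / 2 <= zfun R d G (e |: S).
  rewrite -(cU _ eS); apply: (zfun_half Gd m0 d2m); first exact: sU.
  rewrite cU//; apply: (@le_trans _ _ cutoff%:R); first by rewrite cutE; move: D20; lra.
  by rewrite ler_nat ltnW.
rewrite cU// in Z1; rewrite cU// in Z2.
have {}Z1 := Z1 isT; have {}Z2 := Z2 isT.
rewrite /rho !cU//; set k : R := #|S|.+1%:R; have k0 : 0 < k by rewrite ltr0n.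
rewrite -ln_div ?posrE ?divr_gt0 ?exprn_gt0//.
set z := zfun _ _ _ _ in h1 Z1 Z1h *; set z' := zfun _ _ _ _ in h2 Z2 *.
have -> : k ^+ 2 / z / (k ^+ 2 / z') = z' / z by field; rewrite !gt_eqF.
have := @ln_le_subr1 R (z' / z); rewrite divr_gt0// => /(_ isT) h.
apply: le_trans h _; rewrite -[X in _ - X](divff (lt0r_neq0 Z1)) -mulrBl.
set A := \sum_(f in S) kap R d G e f in h1 *; set B := \sum_(f in S) _ in h2 *.
have AB0 : 0 <= A + B by rewrite addr_ge0// (le_trans _ h1, le_trans _ h2).
apply: (@le_trans _ _ ((A + B) / z)).
  rewrite ler_wpM2r ?invr_ge0 ?(ltW Z1)//.
  move: h1 h2; rewrite !ler_norml => /andP[? ?] /andP[? ?]; lra.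
rewrite mulrC ler_wpM2r// -[X in _ <= X]invrK lef_pV2 ?posrE ?invr_gt0 ?divr_gt0 ?exprn_gt0//.
by rewrite invf_div.
Qed.

Lemma tail_coef_le j : (0 < j)%N -> tail G coef j <= 2 / cutoff%:R.
Proof.
move=> j0; rewrite /tail.
have [jm|mj] := leqP j m.+1; last by rewrite big_geq ?divr_ge0// ltnW.
apply: (@le_trans _ _ (\sum_(1 <= k < m.+1) coef k)).
  by rewrite [leRHS](big_cat_nat (n := j))//= lerDr sumr_ge0// => k _; exact: coef_ge0.
have cm : (cutoff <= m)%N by apply: leq_trans cutm; rewrite leq_pmull.
rewrite (big_cat_nat (n := cutoff.+1))//= big_nat big1 ?add0r => [|k /andP[_ kc]]; last first.
  by rewrite /coef ltnNge -ltnS kc.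
apply: (@le_trans _ _ (\sum_(cutoff.+1 <= k < m.+1) 2 * (k%:R ^+ 2)^-1)).
  rewrite big_nat [leRHS]big_nat; apply: ler_sum => k /andP[ck _].
  by rewrite /coef ck.
rewrite -mulr_sumr ler_wpM2l//.
have := @sum_invr_sqr_le R cutoff m; rewrite cut0 cm => /(_ isT) /le_trans; apply.
by rewrite gerBl invr_ge0.
Qed.

Lemma tail_coef_far j : (0 < j <= m)%N ->
  tail G coef j.+1 <= 2 * (m - j)%:R / (j%:R * m%:R).
Proof.
move=> /andP[j0 jm].
apply: (@le_trans _ _ (\sum_(j.+1 <= k < m.+1) 2 * (k%:R ^+ 2)^-1)).
  by apply: ler_sum => k _; rewrite /coef; case: ifP => // _; rewrite mulr_ge0 ?invr_ge0 ?exprn_ge0.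
rewrite -mulr_sumr.
have jR : 0 < j%:R :> R by rewrite ltr0n.
have -> : 2 * (m - j)%:R / (j%:R * m%:R) = 2 * (j%:R^-1 - m%:R^-1) :> R.
  by rewrite natrB//; field; rewrite !gt_eqF.
by rewrite ler_wpM2l// sum_invr_sqr_le// j0.
Qed.

Lemma inc_ge0 e S : 0 <= inc R d G e S.
Proof.
by rewrite addr_ge0 ?bet_ge0// sumr_ge0// => f _; rewrite addr_ge0 ?bet_ge0.
Qed.

Lemma gain01 e S : 0 <= gain e S <= 1.
Proof.
have k0 : 0 < 2 * #|S|%:R + 1 :> R by rewrite ltr_wpDl ?mulr_ge0.
rewrite /gain divr_ge0 ?inc_ge0 ?(ltW k0)//= ler_pdivrMr// mul1r.
apply: lerD; last by have /andP[] := bet01 R m0 d2m e e.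
rewrite mulr_natr -sumr_const; apply: ler_sum => f _.
have := bet01 R m0 d2m e f; have := bet01 R m0 d2m f e; lra.
Qed.

(** Below the cutoff S fills at most half of G, so the complement has at least [m / 2] elements; row
    and column sums of [bet] bound the total. *)
Lemma gain_mean S : S \subset G -> (#|S| < cutoff)%N ->
  up_mean G S (gain^~ S) <= 5 * D ^+ 2 / m%:R.
Proof.
move=> sSG Sc.
have k0 : 0 < 2 * #|S|%:R + 1 :> R by rewrite ltr_wpDl ?mulr_ge0.
have cGS : #|G :\: S| = (m - #|S|)%N by rewrite cardsD (finset.setIidPr sSG).
have Sm : (2 * #|S| <= m)%N by apply: leq_trans cutm; rewrite leq_mul2l ltnW.
have mS : m%:R <= 2 * #|G :\: S|%:R :> R.
  by rewrite cGS -natrM ler_nat; lia.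
have GS0 : 0 < #|G :\: S|%:R :> R by move: mS mR; lra.
rewrite /up_mean /gain -mulr_suml.
have h : \sum_(e in G :\: S) inc R d G e S <= 5 / 2 * D ^+ 2 * (2 * #|S|%:R + 1).
  rewrite /inc big_split/=.
  have h1 : \sum_(e in G :\: S) bet R d G e e <= D ^+ 2.
    apply: (@le_trans _ _ (\sum_(e in G) bet R d G e e)).
      rewrite [leRHS](big_setID S)/= lerDr sumr_ge0// => e _; exact: bet_ge0.
    apply: (@le_trans _ _ (\sum_(e in G) (D ^+ 2 / (2 * m%:R)))).
      by apply: ler_sum => e eG; exact: bet_diag.
    by rewrite sum_wt_bound//; move: D20; lra.
  have h2 : \sum_(e in G :\: S) \sum_(f in S) (bet R d G e f + bet R d G f e)
      <= 5 * D ^+ 2 * #|S|%:R.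
    rewrite exchange_big/= mulr_natr -sumr_const; apply: ler_sum => f fS.
    rewrite big_split/=.
    have a1 : \sum_(e in G :\: S) bet R d G e f <= 5 / 2 * D ^+ 2.
      apply: le_trans _ (bet_col R Gd m0 f).
      by rewrite [leRHS](big_setID S)/= lerDr sumr_ge0// => e _; exact: bet_ge0.
    have a2 : \sum_(e in G :\: S) bet R d G f e <= 5 / 2 * D ^+ 2.
      apply: le_trans _ (bet_row R Gd m0 f).
      by rewrite [leRHS](big_setID S)/= lerDr sumr_ge0// => e _; exact: bet_ge0.
    lra.
  move: D20; lra.
rewrite ler_pdivrMr// ler_pdivrMr//; apply: le_trans h _.
have q : 5 / 2 * D ^+ 2 <= 5 * D ^+ 2 / m%:R * #|G :\: S|%:R.
  rewrite [leRHS]mulrAC ler_pdivlMr//.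
  have := ler_wpM2l (_ : 0 <= 5 / 2 * D ^+ 2) mS; rewrite mulr_ge0// => /(_ isT).
  lra.
apply: le_trans (ler_wpM2r (ltW k0) q) _.
by rewrite le_eqVlt; apply/orP; left; apply/eqP; ring.
Qed.

Definition ratio_bound k : R := 4096 * D ^+ 2 / k%:R.

Lemma mean_prod_rho_le (r : nat) : (1 < r)%N ->
  mean_prod G rho m finset.set0 <=
  expR (mean_sum G xi m finset.set0
    + \sum_(1 <= j < m.+1) chain_var G (7 * D ^+ 2) j
    + \sum_(1 <= j < cutoff.+1) 2 * expR (low_weight r ratio_bound j) * (5 * D ^+ 2 / m%:R)).
Proof.
move=> r2.
have cm : (cutoff <= m)%N by apply: leq_trans cutm; rewrite leq_pmull.
have ratio1 k : (0 < k <= cutoff)%N -> 1 <= ratio_bound k.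
  move=> /andP[k0 kc]; rewrite /ratio_bound ler_pdivlMr ?ltr0n// mul1r.
  apply: (@le_trans _ _ cutoff%:R); first by rewrite ler_nat.
  by rewrite cutE; move: D20; lra.
apply: (@mean_prod_le R _ G (kap R d G) (7 * D ^+ 2) coef cutoff rho xi gain).
- by move=> e f; exact: kap_ge0.
- by rewrite mulr_ge0.
- exact: coef_ge0.
- by move=> e _; exact: kap_row.
- by move=> f _; exact: kap_col.
- exact: xi_lip.
- exact: tail_coef_far.
- move=> j j0; have := ler_wpM2l (_ : 0 <= 7 * D ^+ 2) (tail_coef_le j0).
  rewrite mulr_ge0// => /(_ isT) /le_trans; apply.
  by rewrite cutE le_eqVlt; apply/orP; left; apply/eqP; field; rewrite gt_eqF// (lt_le_trans ltr01 D1).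
- rewrite !mulrA ler_pdivrMr//; move: dm (mulr_ge0 (ltW D20) H0) D20; lra.
- move=> S sSG cS; rewrite /xi cS lnK ?posrE//.
  by rewrite rho_pos//; exact: leq_trans cS.
- by move=> S sSG /andP[S0 _]; exact: rho_pos.
- by move=> S _; rewrite leqNgt /xi => /negPf->.
- by move=> S e _ _ _; exact: gain01.
- exact: gain_mean.
- move=> s us sG ss.
  apply: (@path_low R _ G cutoff r (zfun R d G) gain ratio_bound r2) => //.
  + by rewrite /zfun big_set0.
  + by move=> S _; exact: zfun_le.
  + by move=> S; exact: zfun_gt0.
  + by move=> S e _ _ _; exact: gain01.
  + move=> S e sSG _; rewrite inE => /andP[eS _].
    apply: le_trans (zfun_step_ge R m0 d2m eS).
    have k0 : 0 < 2 * #|S|%:R + 1 :> R by rewrite ltr_wpDl ?mulr_ge0.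
    by rewrite mulrBr mulr1 /gain mulrCA divff ?gt_eqF// mulr1 addrA.
  + move=> S sSG /andP[S0 Sc]; have := @zfun_ratio_le R n d G Gsimple Gd m0 d2m S sSG S0; apply.
    by rewrite -cutE ler_nat.
  + move=> k /andP[k0 _]; apply: ler_wpM2l; first by move: D20; lra.
    by rewrite lef_pV2 ?posrE ?ltr0n ?ler_nat.
- exact: cm.
Qed.

End ChainBounds.

(** * Layer means of the conflict count *)

Section LayerCounts.
Variables (R : realType) (T : finType) (G : {set T}).
Implicit Types (S A B : {set T}) (F : {set T} -> R).
Local Notation m := #|G|.

Lemma layer_mean_le k F F' : (forall S, layer G k S -> F S <= F' S) ->
  layer_mean G k F <= layer_mean G k F'.
Proof. by move=> FF'; rewrite ler_wpM2r ?invr_ge0// ler_sum. Qed.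

Lemma layer_meanZ k (c : R) F : layer_mean G k (fun S => c * F S) = c * layer_mean G k F.
Proof. by rewrite /layer_mean -mulr_sumr mulrA. Qed.

Lemma layer_mean_sum k (I : finType) (P : pred I) (F : I -> {set T} -> R) :
  layer_mean G k (fun S => \sum_(i | P i) F i S) = \sum_(i | P i) layer_mean G k (F i).
Proof. by rewrite /layer_mean exchange_big mulr_suml. Qed.

Lemma card_layer_pattern k A B : A \subset G -> B \subset G -> [disjoint A & B] ->
  (#|A| <= k)%N ->
  #|[set S | layer G k S && ((A \subset S) && [disjoint B & S])]%SET|
  = 'C(m - #|A| - #|B|, k - #|A|).
Proof.
move=> sA sB dAB ak.
have cAB : #|G :\: (A :|: B)| = (m - #|A| - #|B|)%N.
  rewrite cardsD (finset.setIidPr _); last by rewrite subUset sA.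
  by rewrite -(leq_card_setU A B).2 in dAB; rewrite (eqP dAB) subnDA.
rewrite -cAB -cards_draws.
rewrite -[RHS](card_in_imset (f := fun S => A :|: S)); last first.
  move=> S S'; rewrite !inE => /andP[sS _] /andP[sS' _] E.
  have dS (S0 : {set T}) : S0 \subset G :\: (A :|: B) -> (A :|: S0) :\: A = S0.
    move=> s0; rewrite finset.setDUl finset.setDv finset.set0U; apply/finset.setDidPl.
    rewrite disjoint_sym; apply: disjointWr s0 _.
    by rewrite disjoints_subset; apply/fintype.subsetP => x xA; rewrite !inE xA.
  by rewrite -(dS S sS) -(dS S' sS'); congr (_ :\: A).
apply: eq_card => S; rewrite inE; apply/idP/imsetP.
  move=> /andP[/andP[sSG /eqP cS] /andP[sAS dBS]].
  exists (S :\: A); last by rewrite -[LHS](finset.setID S A) (finset.setIidPr sAS).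
  rewrite inE cardsD (finset.setIidPr sAS) cS eqxx andbT.
  apply/fintype.subsetP => x; rewrite !inE negb_or => /andP[xA xS].
  rewrite xA (fintype.subsetP sSG _ xS)/= andbT.
  by apply/negP => xB; move/pred0P: dBS => /(_ x)/=; rewrite xB xS.
move=> [S']; rewrite inE => /andP[sS' /eqP cS'] ->.
have s1 : S' \subset G by apply: fintype.subset_trans sS' (finset.subsetDl _ _).
have d1 : [disjoint A & S'].
  rewrite disjoint_sym; apply: disjointWl sS' _; rewrite disjoint_sym.
  by rewrite disjoints_subset; apply/fintype.subsetP => x xA; rewrite !inE xA.
have d2 : [disjoint B & S'].
  rewrite disjoint_sym; apply: disjointWl sS' _; rewrite disjoint_sym.
  by rewrite disjoints_subset; apply/fintype.subsetP => x xB; rewrite !inE xB orbT.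
rewrite /layer subUset sA s1 finset.subsetUl /=.
rewrite -(leq_card_setU A S').2 in d1.
rewrite (eqP d1) cS' subnKC// eqxx /=.
by rewrite disjoints_subset finset.setCU subsetI -!disjoints_subset d2 andbT disjoint_sym.
Qed.

Lemma layer_mean_pattern k A B : A \subset G -> B \subset G -> [disjoint A & B] ->
  (#|A| <= k)%N ->
  layer_mean G k (fun S => ((A \subset S) && [disjoint B & S])%:R : R)
  = 'C(m - #|A| - #|B|, k - #|A|)%:R / 'C(m, k)%:R.
Proof.
move=> sA sB dAB ak; rewrite /layer_mean; congr (_ / _).
rewrite -(card_layer_pattern sA sB dAB ak) -sum1_card natr_sum.
rewrite [LHS]big_mkcond [RHS]big_mkcond/=; apply: eq_bigr => S _; rewrite inE.
by case: (layer G k S) => //=; case: (_ && _).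
Qed.

Lemma layer_mean_in e k : e \in G -> (0 < k <= m)%N ->
  layer_mean G k (fun S => (e \in S)%:R : R) = k%:R / m%:R.
Proof.
move=> eG /andP[k0 km].
rewrite (eq_layer_mean (F' := fun S => (([set e] \subset S) && [disjoint finset.set0 & S])%:R));
  last by move=> S _; rewrite sub1set disjoints_subset sub0set andbT.
rewrite layer_mean_pattern ?sub1set ?sub0set ?cards1 ?cards0 ?subn0//; last first.
  by rewrite disjoint_sym disjoints_subset sub0set.
have m0 : (0 < m)%N by exact: leq_trans km.
have c0 : 'C(m, k)%:R != 0 :> R by rewrite pnatr_eq0 -lt0n bin_gt0.
have mn0 : m%:R != 0 :> R by rewrite pnatr_eq0 -lt0n.
apply/eqP; rewrite eqr_div//; apply/eqP; rewrite -!natrM.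
have := mul_bin_diag m k.-1; rewrite prednK// subn1 => E.
by congr (_%:R); rewrite mulnC subn1 E.
Qed.

Lemma layer_mean_in2 e f k : e \in G -> f \in G -> e != f -> (0 < k <= m)%N ->
  layer_mean G k (fun S => ((e \in S) && (f \in S))%:R : R)
  = k%:R * (k%:R - 1) / (m%:R * (m%:R - 1)).
Proof.
move=> eG fG ef /andP[k0 km].
have c2 : #|[set e; f]%SET| = 2%N by rewrite cards2 ef.
have m2 : (1 < m)%N by rewrite -c2; apply: subset_leq_card; rewrite subUset !sub1set eG.
have [k1|k2] := leqP k 1.
  have -> : k = 1%N by apply/eqP; rewrite eqn_leq k1.
  rewrite subrr mulr0 mul0r; rewrite /layer_mean big1 ?mul0r// => S /andP[_ /eqP cS].
  case: andP => // -[eS fS]; have : (#|[set e; f]%SET| <= #|S|)%N.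
    by apply: subset_leq_card; rewrite subUset !sub1set eS.
  by rewrite c2 cS.
rewrite (eq_layer_mean (F' := fun S => (([set e; f]%SET \subset S) && [disjoint finset.set0 & S])%:R));
  last by move=> S _; rewrite subUset !sub1set disjoints_subset sub0set andbT.
rewrite layer_mean_pattern ?subUset ?sub1set ?eG ?sub0set ?c2 ?cards0 ?subn0//; last first.
  by rewrite disjoint_sym disjoints_subset sub0set.
have c0 : 'C(m, k)%:R != 0 :> R by rewrite pnatr_eq0 -lt0n bin_gt0.
have mR : m%:R - 1 = (m - 1)%:R :> R by rewrite natrB// ltnW.
have kR : k%:R - 1 = (k - 1)%:R :> R by rewrite natrB// ltnW.
rewrite mR kR.
have n0 : m%:R * (m - 1)%:R != 0 :> R.
  by rewrite -natrM pnatr_eq0 -lt0n muln_gt0 subn_gt0 m2 ltnW.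
apply/eqP; rewrite eqr_div//; apply/eqP; rewrite -!natrM; congr (_%:R).
have E1 := mul_bin_diag m k.-1; have E2 := mul_bin_diag m.-1 k.-2.
have e1 : k.-2.+1 = k.-1 by lia.
have e2 : k.-1.+1 = k by lia.
rewrite e2 in E1; rewrite e1 in E2.
have -> : (k - 2 = k.-2)%N by lia.
have -> : (m - 2 = m.-2)%N by lia.
rewrite !subn1 mulnC -mulnA E2 mulnCA E1; ring.
Qed.

Lemma layer_mean_in3 e f g k : e \in G -> f \in G -> g \in G ->
  e != f -> g != e -> g != f -> (0 < k <= m)%N ->
  layer_mean G k (fun S => [&& e \in S, f \in S & g \notin S]%:R : R)
  = k%:R * (k%:R - 1) * (m%:R - k%:R) / (m%:R * (m%:R - 1) * (m%:R - 2)).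
Proof.
move=> eG fG gG ef ge gf /andP[k0 km].
have c2 : #|[set e; f]%SET| = 2%N by rewrite cards2 ef.
have c3 : #|g |: [set e; f]%SET| = 3%N by rewrite cardsU1 !inE negb_or ge gf c2.
have m3 : (2 < m)%N.
  by rewrite -c3; apply: subset_leq_card; rewrite !subUset !sub1set eG fG gG.
have [k1|k2] := leqP k 1.
  have -> : k = 1%N by apply/eqP; rewrite eqn_leq k1.
  rewrite subrr mulr0 !mul0r; rewrite /layer_mean big1 ?mul0r// => S /andP[_ /eqP cS].
  case: and3P => // -[eS fS _]; have : (#|[set e; f]%SET| <= #|S|)%N.
    by apply: subset_leq_card; rewrite subUset !sub1set eS.
  by rewrite c2 cS.
rewrite (eq_layer_mean (F' := fun S => (([set e; f]%SET \subset S) && [disjoint [set g]%SET & S])%:R));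
  last by move=> S _; rewrite subUset !sub1set disjoints1 andbA.
rewrite layer_mean_pattern ?subUset ?sub1set ?eG ?c2 ?cards1//; last first.
  by rewrite disjoint_sym disjoints1 !inE negb_or ge gf.
have c0 : 'C(m, k)%:R != 0 :> R by rewrite pnatr_eq0 -lt0n bin_gt0.
have mR : m%:R - 1 = (m - 1)%:R :> R by rewrite natrB//; lia.
have mR2 : m%:R - 2 = (m - 2)%:R :> R by rewrite natrB//; lia.
have kR : k%:R - 1 = (k - 1)%:R :> R by rewrite natrB// ltnW.
rewrite mR mR2 kR -natrB//.
have n0 : m%:R * (m - 1)%:R * (m - 2)%:R != 0 :> R.
  by rewrite -!natrM pnatr_eq0 -lt0n !muln_gt0 !subn_gt0 m3 (ltnW m3) !andbT; lia.
apply/eqP; rewrite eqr_div//; apply/eqP; rewrite -!natrM; congr (_%:R).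
have E1 := mul_bin_diag m k.-1; have E2 := mul_bin_diag m.-1 k.-2.
have E3 := mul_bin_down m.-2 k.-2.
have e1 : k.-2.+1 = k.-1 by lia.
have e2 : k.-1.+1 = k by lia.
have e3 : (m.-2 - k.-2 = m - k)%N by lia.
rewrite e2 in E1; rewrite e1 in E2; rewrite e3 in E3.
have -> : (k - 2 = k.-2)%N by lia.
have -> : (m - 2 - 1 = m.-2.-1)%N by lia.
have -> : (m - 2 = m.-2)%N by lia.
rewrite !subn1.
transitivity (m * (m.-1 * (m.-2 * 'C(m.-2.-1, k.-2))))%N; first by ring.
rewrite E3 [(m.-1 * _)%N]mulnCA E2.
transitivity ((m - k) * k.-1 * (m * 'C(m.-1, k.-1)))%N; first by ring.
rewrite E1; ring.
Qed.

End LayerCounts.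

(** * Mean number of conflicts *)

Section MeanConflicts.
Variables (R : realType) (n : nat) (d : degseq n) (G : digraph n).
Local Notation T := ('I_n * 'I_n)%type.
Implicit Types (S : {set T}) (e f : T).
Hypotheses (Gsimple : simple_digraph G) (Gd : obeys G d).
Local Notation m := #|G|.
Local Notation D := ((dmax d)%:R : R).
Hypotheses (m6 : (6 <= m)%N) (d2m : ((dmax d) ^ 2 <= m)%N).

Let m0 : (0 < m)%N. Proof. exact: leq_trans m6. Qed.
Let mR : 0 < m%:R :> R. Proof. by rewrite ltr0n. Qed.
Let m6R : 6 <= m%:R :> R. Proof. by rewrite ler_nat. Qed.
Let D1 : 1 <= D. Proof. exact: D_ge1. Qed.
Let D20 : 0 <= D ^+ 2. Proof. exact: sqr_ge0. Qed.

Definition psi S : R := #|S|%:R ^+ 2 - zfun R d G S.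

Definition third e f : bool :=
  [&& (e.1, f.2) \in G, (e.1, f.2) != e & (e.1, f.2) != f].

(** [p1], [p2], [p3] are the probabilities that a uniform k-subset of G contains one given edge,
    contains two given edges, and contains two while missing a third. *)
Definition p1 k : R := k%:R / m%:R.
Definition p2 k : R := k%:R * (k%:R - 1) / (m%:R * (m%:R - 1)).
Definition p3 k : R :=
  k%:R * (k%:R - 1) * (m%:R - k%:R) / (m%:R * (m%:R - 1) * (m%:R - 2)).

Lemma psiE S : S \subset G -> psi S = \sum_(e in G) \sum_(f in G)
  ((e \in S) && (f \in S))%:R * (1 - gam R d G S e f).
Proof.
move=> sSG; rewrite [RHS](big_setID S)/= (finset.setIidPr sSG).
rewrite [X in _ + X]big1 ?addr0 => [|e]; last first.
  by rewrite inE => /andP[/negPf-> _]; rewrite big1// => f _; rewrite mul0r.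
rewrite /psi /zfun expr2 mulr_natr -sumr_const -sumrB; apply: eq_bigr => e eS.
rewrite [RHS](big_setID S)/= (finset.setIidPr sSG).
rewrite [X in _ = _ + X]big1 ?addr0 => [|f]; last first.
  by rewrite inE => /andP[/negPf-> _]; rewrite andbF mul0r.
rewrite -[X in X - _]mulr1 mulr_natl -sumr_const -sumrB; apply: eq_bigr => f fS.
by rewrite eS fS mul1r.
Qed.

Lemma no_loop e f : e.1 == f.2 -> (e.1, f.2) \in G -> false.
Proof. by move=> /eqP -> h; have := Gsimple f.2; rewrite h. Qed.

(** For distinct e and f in S, [1 - gam] is [w] plus [1 - w] times the indicator of a loop or of a
    third edge already placed. Dropping the products of [w] with these indicators leaves the second
    error term; the diagonal leaves the first. *)
Lemma conflict_mean k e f : e \in G -> f \in G -> (0 < k <= m)%N ->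
  `|layer_mean G k (fun S => ((e \in S) && (f \in S))%:R * (1 - gam R d G S e f))
    - (p2 k * (wt R d G e.1 f.2 + (e.1 == f.2)%:R) + p3 k * (third e f)%:R)|
  <= (e == f)%:R * (p1 k * wt R d G e.1 f.2)
     + wt R d G e.1 f.2 * (p2 k * (e.1 == f.2)%:R + p3 k * (third e f)%:R).
Proof.
move=> eG fG km; have /andP[k0 kle] := km.
have k1R : 1 <= k%:R :> R by rewrite ler1n.
have kmR : k%:R <= m%:R :> R by rewrite ler_nat.
set w := wt R d G e.1 f.2.
have /andP[w0 w1] : 0 <= w <= 2^-1 by exact: wt_half.
have p20 : 0 <= p2 k by rewrite /p2 divr_ge0 ?mulr_ge0// subr_ge0//; move: m6R; lra.
have p21 : p2 k <= p1 k.
  rewrite /p2 /p1 invfM mulrACA ler_piMr ?divr_ge0// ler_pdivrMr; move: m6R; lra.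
have p30 : 0 <= p3 k by rewrite /p3 divr_ge0 ?mulr_ge0// subr_ge0//; move: m6R; lra.
have [ef|ef] := eqVneq e f.
  subst f.
  have -> : third e e = false by rewrite /third -surjective_pairing eqxx andbF.
  have lp : (e.1 == e.2) = false.
    by apply/negP => /no_loop; rewrite -surjective_pairing eG => /(_ isT).
  rewrite lp /=.
  rewrite (eq_layer_mean (F' := fun S => w * (e \in S)%:R)); last first.
    move=> S lS; rewrite andbb mulrC; case: (boolP (e \in S)) => eS; rewrite ?mulr0//.
    by rewrite !mulr1 /gam /bad lp -surjective_pairing inE eS /=; rewrite -/w; lra.
  rewrite layer_meanZ layer_mean_in// -/(p1 k) !mulr0 !addr0 mul1r mulr0 addr0.
  have := ler_wpM2l w0 p21; have := mulr_ge0 w0 p20.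
  by rewrite ler_norml => ? ?; apply/andP; split; lra.
rewrite mul0r add0r.
have -> : layer_mean G k (fun S => ((e \in S) && (f \in S))%:R * (1 - gam R d G S e f))
    = p2 k * (w + (1 - w) * (e.1 == f.2)%:R) + p3 k * ((1 - w) * (third e f)%:R).
  rewrite (eq_layer_mean (F' := fun S =>
     (w + (1 - w) * (e.1 == f.2)%:R) * ((e \in S) && (f \in S))%:R
     + ((1 - w) * (third e f)%:R)
       * [&& e \in S, f \in S & (e.1, f.2) \notin S]%:R)); last first.
    move=> S _; rewrite mulrC; case: (boolP (e \in S)) => eS; rewrite /= ?mulr0 ?addr0//.
    case: (boolP (f \in S)) => fS; rewrite /= ?mulr0 ?addr0//.
    rewrite !mulr1 /gam /bad /third inE -/w.
    have [ee|ee] := boolP (e.1 == f.2).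
      have -> : ((e.1, f.2) \in G) = false by apply/negP => /(no_loop ee).
      by rewrite /= mulr0 mul0r; lra.
    have [gG|gG] := boolP ((e.1, f.2) \in G); last first.
      by rewrite andbF /= !mulr0 mul0r; lra.
    have [gS|gS] := boolP ((e.1, f.2) \in S); first by rewrite /= !mulr0; lra.
    have -> : (e.1, f.2) != e by apply/eqP => E; move: gS; rewrite E eS.
    have -> : (e.1, f.2) != f by apply/eqP => E; move: gS; rewrite E fS.
    by rewrite /= mulr0 !mulr1; lra.
  rewrite layer_meanD !layer_meanZ layer_mean_in2// -/(p2 k).
  rewrite mulrC; congr (_ + _).
  have [th|_] := boolP (third e f); last by rewrite !mulr0 mul0r.
  have /and3P[g1 g2 g3] := th.
  by rewrite layer_mean_in3// -/(p3 k) mulrC.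
have := mulr_ge0 p20 (ler0n R (e.1 == f.2)); have := mulr_ge0 p30 (ler0n R (third e f)).
set a := p2 k * _%:R; set b := p3 k * _%:R => b0 a0.
have -> : p2 k * (w + (1 - w) * (e.1 == f.2)%:R) + p3 k * ((1 - w) * (third e f)%:R)
   - (p2 k * (w + (e.1 == f.2)%:R) + b) = - (w * (a + b)) by rewrite /a /b; ring.
by rewrite normrN ger0_norm// mulr_ge0// addr_ge0.
Qed.

Definition harm1 : R := \sum_(1 <= k < m.+1) k%:R^-1.

Lemma harm1_ge1 : 1 <= harm1.
Proof. by rewrite /harm1 big_ltn// invr1 lerDl sumr_ge0. Qed.

Definition a1 : R := \sum_(1 <= k < m.+1) p1 k / k%:R ^+ 2.
Definition a2 : R := \sum_(1 <= k < m.+1) p2 k / k%:R ^+ 2.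
Definition a3 : R := \sum_(1 <= k < m.+1) p3 k / k%:R ^+ 2.

Lemma sum_nat1 (c : R) : \sum_(1 <= k < m.+1) c = m%:R * c.
Proof. by rewrite sumr_const_nat subn1 mulr_natl. Qed.

Lemma a1E : a1 = harm1 / m%:R.
Proof.
rewrite /a1 /harm1 mulr_suml big_nat [RHS]big_nat; apply: eq_bigr => k /andP[k0 _].
by rewrite /p1; field; rewrite !pnatr_eq0 -!lt0n m0 k0.
Qed.

Lemma a2E : a2 = (m%:R - harm1) / (m%:R * (m%:R - 1)).
Proof.
rewrite -[X in X - _]mulr1 -sum_nat1 -sumrB mulr_suml /a2.
rewrite big_nat [RHS]big_nat; apply: eq_bigr => k /andP[k0 _].
have mm : m%:R - 1 != 0 :> R by rewrite gt_eqF// subr_gt0; move: m6R; lra.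
by rewrite /p2; field; rewrite mm !pnatr_eq0 -!lt0n m0 k0.
Qed.

Lemma sum_id_nat (M : nat) : \sum_(1 <= k < M.+1) k%:R = M%:R * (M%:R + 1) / 2 :> R.
Proof.
elim: M => [|M IH]; first by rewrite big_geq// !mul0r.
by rewrite big_nat_recr//= IH -natr1; field.
Qed.

Lemma a3E : a3 = ((m%:R + 1) / 2 - harm1) / ((m%:R - 1) * (m%:R - 2)).
Proof.
have mm : m%:R - 1 != 0 :> R by rewrite gt_eqF// subr_gt0; move: m6R; lra.
have mm2 : m%:R - 2 != 0 :> R by rewrite gt_eqF// subr_gt0; move: m6R; lra.
have mn : m%:R != 0 :> R by rewrite gt_eqF.
transitivity (\sum_(1 <= k < m.+1) ((m%:R + 1 - k%:R - m%:R * k%:R^-1)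
   / (m%:R * (m%:R - 1) * (m%:R - 2))) : R).
  rewrite /a3 big_nat [RHS]big_nat; apply: eq_bigr => k /andP[k0 _].
  by rewrite /p3; field; rewrite mm mm2 mn !pnatr_eq0 -!lt0n k0.
rewrite -mulr_suml !sumrB sum_nat1 sum_id_nat -mulr_sumr -/harm1.
by field; rewrite mm mm2 mn.
Qed.

Lemma a2_bound : 0 <= a2 <= m%:R^-1 /\ `|a2 - m%:R^-1| <= 2 * harm1 / m%:R ^+ 2.
Proof.
have h1 := harm1_ge1.
have a20 : 0 <= a2.
  rewrite /a2 big_nat sumr_ge0// => k /andP[k0 _].
  apply: divr_ge0; last exact: exprn_ge0.
  by apply: divr_ge0; apply: mulr_ge0; rewrite ?subr_ge0 ?ler1n.
have mm : 0 < m%:R - 1 :> R by rewrite subr_gt0; move: m6R; lra.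
have E : m%:R^-1 - a2 = (harm1 - 1) / (m%:R * (m%:R - 1)).
  by rewrite a2E; field; rewrite gt_eqF// gt_eqF.
have q0 : 0 <= m%:R^-1 - a2 by rewrite E; apply: divr_ge0; rewrite ?subr_ge0 ?mulr_ge0 ?(ltW mm).
split; first by rewrite a20 -subr_ge0.
rewrite distrC ger0_norm// E ler_pdivrMr ?mulr_gt0//.
have -> : 2 * harm1 / m%:R ^+ 2 * (m%:R * (m%:R - 1)) = harm1 * (2 * (m%:R - 1) / m%:R).
  by field; rewrite gt_eqF.
apply: (@le_trans _ _ (harm1 * 1)); first by lra.
by rewrite ler_wpM2l ?(le_trans ler01 h1)// ler_pdivlMr// ; move: m6R; lra.
Qed.

(** [p3 k / k^2] is about [(m - k) / m^3], and the sum of this over k is about [1 / (2 m)]: averaged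
    over the levels, the third edge is already placed half of the time. *)
Lemma a3_bound : 0 <= a3 <= m%:R^-1 /\ `|a3 - (2 * m%:R)^-1| <= 4 * harm1 / m%:R ^+ 2.
Proof.
have h1 := harm1_ge1.
have a30 : 0 <= a3.
  rewrite /a3 big_nat sumr_ge0// => k /andP[k0 km].
  apply: divr_ge0; last exact: exprn_ge0.
  apply: divr_ge0; do 2?[apply: mulr_ge0]; rewrite ?subr_ge0 ?ler1n ?ler_nat//.
  by apply: leq_trans m6.
have mm : 0 < m%:R - 1 :> R by rewrite subr_gt0; move: m6R; lra.
have mm2 : 0 < m%:R - 2 :> R by rewrite subr_gt0; move: m6R; lra.
have E : a3 - (2 * m%:R)^-1 = (4 * m%:R - 2 - 2 * m%:R * harm1) /
    (2 * m%:R * ((m%:R - 1) * (m%:R - 2))).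
  by rewrite a3E; field; rewrite !gt_eqF.
have mm3 : m%:R ^+ 2 / 2 <= (m%:R - 1) * (m%:R - 2) :> R by move: m6R; nra.
have q0 : 0 < (m%:R - 1) * (m%:R - 2) :> R by rewrite mulr_gt0.
have q1 : 0 < m%:R ^+ 2 :> R by rewrite exprn_gt0.
split.
  rewrite a30 a3E ler_pdivrMr// ler_pdivlMl//.
  move: mm3 h1 m6R; nra.
have den : 0 < 2 * m%:R * ((m%:R - 1) * (m%:R - 2)) :> R by rewrite !mulr_gt0.
rewrite E normrM [X in _ * X]ger0_norm ?invr_ge0 ?(ltW den)// ler_pdivrMr//.
apply: (@le_trans _ _ (4 * m%:R * harm1)).
  by rewrite ler_norml; move: h1 m6R => ? ?; apply/andP; split; nra.
have -> : 4 * harm1 / m%:R ^+ 2 * (2 * m%:R * ((m%:R - 1) * (m%:R - 2)))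
   = 4 * m%:R * harm1 * (2 * ((m%:R - 1) * (m%:R - 2)) / m%:R ^+ 2).
  by field; rewrite gt_eqF.
rewrite ler_peMr ?mulr_ge0 ?(le_trans ler01 h1)//.
by rewrite ler_pdivlMr//; lra.
Qed.

Definition sumW : R := \sum_(e in G) \sum_(f in G) wt R d G e.1 f.2.
Definition sumL : R := \sum_(e in G) \sum_(f in G) (e.1 == f.2)%:R.
Definition sumT : R := \sum_(e in G) \sum_(f in G) (third e f)%:R.

Lemma sum_cst (c : R) : \sum_(e in G) c = m%:R * c.
Proof. by rewrite sumr_const mulr_natl. Qed.

Lemma sumW_le : 0 <= sumW <= m%:R * D ^+ 2.
Proof.
apply/andP; split.
  by apply: sumr_ge0 => e _; apply: sumr_ge0 => f _; have /andP[] := wt_le R d G e.1 f.2.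
rewrite -sum_cst; apply: ler_sum => e _.
apply: (@le_trans _ _ (\sum_(f in G) (D ^+ 2 / (2 * m%:R)))).
  by apply: ler_sum => f _; have /andP[] := wt_le R d G e.1 f.2.
by rewrite sum_wt_bound//; move: D20; lra.
Qed.

Lemma sumL_le : 0 <= sumL <= m%:R * D ^+ 2.
Proof.
apply/andP; split; first by apply: sumr_ge0 => e _; apply: sumr_ge0.
rewrite -sum_cst; apply: ler_sum => e _.
apply: le_trans _ (D_le_sqr R Gd m0); apply: le_trans _ (sum_in_le R Gd e.1).
by apply: ler_sum => f _; rewrite [e.1 == _]eq_sym lexx.
Qed.

Lemma sumT_le : 0 <= sumT <= m%:R * D ^+ 2.
Proof.
apply/andP; split; first by apply: sumr_ge0 => e _; apply: sumr_ge0.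
rewrite -sum_cst; apply: ler_sum => e _.
apply: le_trans _ (sum_third_out R Gd e.1).
by apply: ler_sum => f _; rewrite ler_nat /third; case: (_ \in G); rewrite ?leq_b1.
Qed.

Definition mu : R :=
  \sum_(1 <= k < m.+1) layer_mean G k (fun S => psi S / #|S|%:R ^+ 2).

Lemma muE : mu = \sum_(1 <= k < m.+1) \sum_(e in G) \sum_(f in G)
  layer_mean G k (fun S => ((e \in S) && (f \in S))%:R * (1 - gam R d G S e f)) / k%:R ^+ 2.
Proof.
apply: eq_bigr => k _; under eq_bigr do rewrite -mulr_suml -layer_mean_sum.
rewrite -mulr_suml -layer_mean_sum mulrC -layer_meanZ; apply: eq_layer_mean => S.
by move=> /andP[sSG /eqP cS]; rewrite (psiE sSG) cS mulrC.
Qed.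

Lemma mu_approx : `|mu - (a2 * (sumW + sumL) + a3 * sumT)|
  <= D ^+ 2 * a1 + D ^+ 4 * (a2 + a3).
Proof.
have step : `|mu - (a2 * (sumW + sumL) + a3 * sumT)| <=
  \sum_(1 <= k < m.+1) \sum_(e in G) \sum_(f in G)
   ((e == f)%:R * (p1 k * wt R d G e.1 f.2)
     + wt R d G e.1 f.2 * (p2 k * (e.1 == f.2)%:R + p3 k * (third e f)%:R)) / k%:R ^+ 2.
  have -> : a2 * (sumW + sumL) + a3 * sumT = \sum_(1 <= k < m.+1) \sum_(e in G) \sum_(f in G)
    (p2 k * (wt R d G e.1 f.2 + (e.1 == f.2)%:R) + p3 k * (third e f)%:R) / k%:R ^+ 2.
    rewrite /a2 /a3 !mulr_suml -big_split/=; apply: eq_bigr => k _.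
    rewrite /sumW /sumL /sumT -big_split/= !mulr_sumr -big_split/=; apply: eq_bigr => e _.
    rewrite -big_split/= !mulr_sumr -big_split/=; apply: eq_bigr => f _; ring.
  rewrite muE -sumrB; apply: le_trans (ler_norm_sum _ _ _) _.
  rewrite big_nat [leRHS]big_nat; apply: ler_sum => k km.
  rewrite -sumrB; apply: le_trans (ler_norm_sum _ _ _) _; apply: ler_sum => e eG.
  rewrite -sumrB; apply: le_trans (ler_norm_sum _ _ _) _; apply: ler_sum => f fG.
  rewrite -mulrBl normrM [X in _ * X]ger0_norm ?invr_ge0 ?exprn_ge0//.
  by rewrite ler_wpM2r ?invr_ge0 ?exprn_ge0// conflict_mean.
apply: le_trans step _.
pose c : R := D ^+ 2 / (2 * m%:R).
have c0 : 0 <= c by rewrite divr_ge0// mulr_ge0.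
apply: (@le_trans _ _ (\sum_(1 <= k < m.+1)
   (p1 k / k%:R ^+ 2 * (m%:R * c) + (p2 k / k%:R ^+ 2 * (c * sumL) + p3 k / k%:R ^+ 2 * (c * sumT))))).
  rewrite big_nat [leRHS]big_nat; apply: ler_sum => k /andP[k0 km].
  have k1R : 1 <= k%:R :> R by rewrite ler1n.
  have kmR : k%:R <= m%:R :> R by rewrite ler_nat.
  have p10 : 0 <= p1 k by rewrite divr_ge0.
  have p20 : 0 <= p2 k by rewrite /p2 divr_ge0 ?mulr_ge0// subr_ge0//; move: m6R; lra.
  have p30 : 0 <= p3 k by rewrite /p3 divr_ge0 ?mulr_ge0// subr_ge0//; move: m6R; lra.
  under eq_bigr do rewrite -mulr_suml.
  rewrite -mulr_suml ler_pdivrMr ?exprn_gt0 ?ltr0n//.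
  have -> : (p1 k / k%:R ^+ 2 * (m%:R * c) + (p2 k / k%:R ^+ 2 * (c * sumL)
     + p3 k / k%:R ^+ 2 * (c * sumT))) * k%:R ^+ 2
    = p1 k * (m%:R * c) + (p2 k * (c * sumL) + p3 k * (c * sumT)).
    by field; rewrite pnatr_eq0 -lt0n.
  rewrite -sum_cst /sumL /sumT !mulr_sumr -!big_split/=; apply: ler_sum => e eG.
  rewrite !mulr_sumr.
  rewrite [leLHS]big_split -[X in _ <= _ + X]big_split/=; apply: lerD.
    rewrite (bigD1 e)//= eqxx mul1r big1 ?addr0 => [|f /andP[_]]; last first.
      by rewrite eq_sym => /negPf->; rewrite mul0r.
    by rewrite ler_wpM2l//; have /andP[] := wt_le R d G e.1 e.2.
  apply: ler_sum => f _.
  rewrite [X in _ <= X + _]mulrCA [X in _ <= _ + X]mulrCA -mulrDr; apply: ler_wpM2r.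
    by apply: addr_ge0; apply: mulr_ge0.
  by have /andP[] := wt_le R d G e.1 f.2.
rewrite big_split/= big_split/= -!mulr_suml -/a1 -/a2 -/a3.
have h1 := harm1_ge1.
have a10 : 0 <= a1 by rewrite a1E divr_ge0// (le_trans ler01 h1).
have [/andP[a20 _] _] := a2_bound; have [/andP[a30 _] _] := a3_bound.
have /andP[l0 l1] := sumL_le; have /andP[t0 t1] := sumT_le.
have mc : m%:R * c = D ^+ 2 / 2 by rewrite /c; field; rewrite gt_eqF.
have cl : c * sumL <= D ^+ 4.
  apply: le_trans (ler_wpM2l c0 l1) _; rewrite mulrA [c * _]mulrC mc.
  by have := sqr_ge0 (D ^+ 2); lra.
have ct : c * sumT <= D ^+ 4.
  apply: le_trans (ler_wpM2l c0 t1) _; rewrite mulrA [c * _]mulrC mc.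
  by have := sqr_ge0 (D ^+ 2); lra.
have := ler_wpM2l a20 cl; have := ler_wpM2l a30 ct; have := mulr_ge0 a10 D20.
rewrite mc; lra.
Qed.

(** [11 = 1 + 2 + 4 + 4]: two contributions from [mu_approx], then the errors of [a2] and [a3]
    against [1 / m] and [1 / (2 m)], times the sums they multiply. *)
Lemma mu_bound :
  `|mu - ((sumW + sumL) / m%:R + sumT / (2 * m%:R))| <= 11 * D ^+ 4 * harm1 / m%:R.
Proof.
have h := mu_approx; have h1 := harm1_ge1.
have [/andP[a20 a21] a2d] := a2_bound; have [/andP[a30 a31] a3d] := a3_bound.
have /andP[w0 w1] := sumW_le; have /andP[l0 l1] := sumL_le; have /andP[t0 t1] := sumT_le.
have E : mu - ((sumW + sumL) / m%:R + sumT / (2 * m%:R))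
  = (mu - (a2 * (sumW + sumL) + a3 * sumT)) + ((a2 - m%:R^-1) * (sumW + sumL)
    + (a3 - (2 * m%:R)^-1) * sumT) by ring.
rewrite E; apply: le_trans (ler_normD _ _) _.
apply: le_trans (lerD h (ler_normD _ _)) _.
rewrite !normrM [`|sumT|]ger0_norm// [`|sumW + _|]ger0_norm ?addr_ge0//.
have D4 : D ^+ 2 <= D ^+ 4.
  by rewrite [D ^+ 4](exprD _ 2 2) ler_peMr// exprn_ege1.
have D40 : 0 <= D ^+ 4 by exact: le_trans D4.
have b0 : 0 <= harm1 / m%:R by rewrite divr_ge0// (le_trans ler01 h1).
have q1 : D ^+ 2 * a1 <= D ^+ 4 * (harm1 / m%:R) by rewrite a1E ler_wpM2r.
have mh : m%:R^-1 <= harm1 / m%:R by rewrite ler_pdivlMr// mulVf ?gt_eqF.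
have q2 : D ^+ 4 * (a2 + a3) <= D ^+ 4 * (2 * (harm1 / m%:R)).
  by rewrite ler_wpM2l//; lra.
have s1 : sumW + sumL <= m%:R * (2 * D ^+ 4).
  have := ler_wpM2l (ltW mR) D4; lra.
have s2 : sumT <= m%:R * D ^+ 4 by have := ler_wpM2l (ltW mR) D4; lra.
have q3 : `|a2 - m%:R^-1| * (sumW + sumL) <= 4 * D ^+ 4 * (harm1 / m%:R).
  apply: le_trans (ler_pM _ _ a2d s1) _; rewrite ?addr_ge0//.
  by rewrite le_eqVlt; apply/orP; left; apply/eqP; field; rewrite gt_eqF.
have q4 : `|a3 - (2 * m%:R)^-1| * sumT <= 4 * D ^+ 4 * (harm1 / m%:R).
  apply: le_trans (ler_pM _ _ a3d s2) _; rewrite ?addr_ge0//.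
  by rewrite le_eqVlt; apply/orP; left; apply/eqP; field; rewrite gt_eqF.
rewrite -[leRHS]mulrA; lra.
Qed.

End MeanConflicts.

(** * Two-sided estimate of the chain expectation *)

Section Combine.
Variables (R : realType) (n : nat) (d : degseq n) (G : digraph n).
Local Notation T := ('I_n * 'I_n)%type.
Implicit Types (S : {set T}) (e f : T).
Hypotheses (Gsimple : simple_digraph G) (Gd : obeys G d).
Local Notation m := #|G|.
Local Notation D := ((dmax d)%:R : R).
Local Notation h1 := (harm1 R G).
Hypotheses (m6 : (6 <= m)%N) (dm : 448 * D ^+ 2 * h1 <= m%:R).

Let m0 : (0 < m)%N. Proof. exact: leq_trans m6. Qed.
Let mR : 0 < m%:R :> R. Proof. by rewrite ltr0n. Qed.
Let m6R : 6 <= m%:R :> R. Proof. by rewrite ler_nat. Qed.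
Let D1 : 1 <= D. Proof. exact: D_ge1. Qed.
Let D20 : 0 <= D ^+ 2. Proof. exact: sqr_ge0. Qed.
Let h11 : 1 <= h1. Proof. exact: harm1_ge1. Qed.

Let hh : harm R G <= h1.
Proof. by rewrite /harm1 big_nat_recr//= lerDl invr_ge0. Qed.

Let dmH : 224 * D ^+ 2 * (1 + harm R G) <= m%:R.
Proof.
apply: le_trans _ dm.
have := ler_wpM2l D20 hh; have := ler_wpM2l D20 h11; lra.
Qed.

Let d2m : (dmax d ^ 2 <= m)%N.
Proof.
rewrite -(ler_nat R) natrX; apply: le_trans _ dm.
have := ler_wpM2l D20 h11; move: D20; lra.
Qed.

Let psi_ge0 S : 0 <= psi R d G S.
Proof. by rewrite subr_ge0; exact: zfun_le. Qed.

(** A crude order of magnitude suffices: it serves only to multiply the relative excess [5 D^2 / k]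
    in [mean_sum_xi_le]. *)
Lemma layer_mean_psi_le k : (0 < k <= m)%N ->
  layer_mean G k (fun S => psi R d G S / #|S|%:R ^+ 2) <= 9 * D ^+ 2 / m%:R.
Proof.
move=> km; have /andP[k0 kle] := km.
have k1R : 1 <= k%:R :> R by rewrite ler1n.
have kmR : k%:R <= m%:R :> R by rewrite ler_nat.
have kR : 0 < k%:R :> R by rewrite ltr0n.
rewrite (eq_layer_mean (F' := fun S => (k%:R ^+ 2)^-1 * \sum_(e in G) \sum_(f in G)
   ((e \in S) && (f \in S))%:R * (1 - gam R d G S e f))); last first.
  by move=> S /andP[sSG /eqP cS]; rewrite psiE// cS mulrC.
rewrite layer_meanZ layer_mean_sum; under eq_bigr do rewrite layer_mean_sum.
rewrite mulrC ler_pdivrMr ?exprn_gt0//.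
have p10 : 0 <= p1 R G k by rewrite divr_ge0.
have p20 : 0 <= p2 R G k.
  by apply: divr_ge0; apply: mulr_ge0; rewrite ?subr_ge0//; move: m6R; lra.
have p32 : 0 <= p3 R G k <= 2 * p2 R G k.
  have mm2 : 0 < m%:R - 2 :> R by move: m6R; lra.
  have -> : p3 R G k = p2 R G k * ((m%:R - k%:R) / (m%:R - 2)).
    have mm : 0 < m%:R - 1 :> R by move: m6R; lra.
    by rewrite /p3 /p2; field; rewrite !gt_eqF.
  have q0 : 0 <= (m%:R - k%:R) / (m%:R - 2) :> R.
    by apply: divr_ge0; [rewrite subr_ge0 | exact: ltW].
  rewrite (mulr_ge0 p20 q0) [leRHS]mulrC; apply: ler_wpM2l => //.
  by rewrite ler_pdivrMr//; move: m6R; lra.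
have p2k : p2 R G k <= k%:R ^+ 2 / m%:R ^+ 2.
  have mm : 0 < m%:R - 1 :> R by move: m6R; lra.
  rewrite /p2 ler_pdivrMr ?mulr_gt0//.
  have -> : k%:R ^+ 2 / m%:R ^+ 2 * (m%:R * (m%:R - 1)) = k%:R * (k%:R * (m%:R - 1) / m%:R) :> R.
    by field; rewrite gt_eqF.
  by rewrite ler_wpM2l// ler_pdivlMr//; lra.
apply: (@le_trans _ _ (\sum_(e in G) \sum_(f in G)
   (p2 R G k * (2 * wt R d G e.1 f.2 + 2 * (e.1 == f.2)%:R + 4 * (third G e f)%:R)
    + (e == f)%:R * (p1 R G k * wt R d G e.1 f.2)))).
  apply: ler_sum => e eG; apply: ler_sum => f fG.
  have := conflict_mean R Gsimple m6 d2m eG fG km; rewrite ler_norml => /andP[_].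
  have /andP[w0 w1] := wt_half R m0 d2m e.1 f.2.
  set w := wt _ _ _ _ _ in w0 w1 *; set X := layer_mean _ _ _.
  set L : R := (e.1 == f.2)%:R; set t : R := (third G e f)%:R; set q := _ * (p1 R G k * w).
  have L0 : 0 <= L by []. have t0 : 0 <= t by [].
  have /andP[p30 p31] := p32.
  have a1 := mulr_ge0 p20 L0; have a2 := mulr_ge0 p30 t0.
  have a3 := ler_wpM2r t0 p31; have a4 := mulr_ge0 p20 w0.
  have a5 : w * (p2 R G k * L + p3 R G k * t) <= 2^-1 * (p2 R G k * L + p3 R G k * t).
    by rewrite ler_wpM2r// addr_ge0.
  move=> hX; lra.
under eq_bigr do rewrite big_split/= -mulr_sumr !big_split/= -!mulr_sumr.
rewrite big_split/= -mulr_sumr !big_split/= -!mulr_sumr.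
rewrite -/(sumW R d G) -/(sumL R G) -/(sumT R G).
have /andP[_ W] := sumW_le R d m6; have /andP[_ L] := sumL_le R Gd m6.
have /andP[_ Th] := sumT_le R Gd.
have last : \sum_(e in G) \sum_(f in G) (e == f)%:R * (p1 R G k * wt R d G e.1 f.2)
   <= k%:R / m%:R * (D ^+ 2 / 2).
  rewrite -(sum_wt_bound R d m0) mulr_sumr; apply: ler_sum => e eG.
  rewrite (bigD1 e)//= eqxx mul1r big1 ?addr0 => [|f /andP[_]]; last first.
    by rewrite eq_sym => /negPf->; rewrite mul0r.
  by rewrite ler_wpM2l//; have /andP[] := wt_le R d G e.1 e.2.
have main : p2 R G k * (2 * sumW R d G + 2 * sumL R G + 4 * sumT R G)
    <= k%:R ^+ 2 / m%:R ^+ 2 * (m%:R * (8 * D ^+ 2)).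
  have /andP[W0 W1] := sumW_le R d m6; have /andP[L0 L1] := sumL_le R Gd m6.
  have /andP[T0 T1] := sumT_le R Gd.
  apply: ler_pM => //; last lra.
  by rewrite !addr_ge0 ?mulr_ge0.
apply: le_trans (lerD main last) _.
have -> : k%:R ^+ 2 / m%:R ^+ 2 * (m%:R * (8 * D ^+ 2)) = 8 * (D ^+ 2 / m%:R * k%:R ^+ 2).
  by field; rewrite gt_eqF.
have -> : k%:R / m%:R * (D ^+ 2 / 2) = D ^+ 2 / m%:R * k%:R / 2 :> R.
  by field; rewrite gt_eqF.
have -> : 9 * D ^+ 2 / m%:R * k%:R ^+ 2 = 9 * (D ^+ 2 / m%:R * k%:R ^+ 2) by ring.
have q0 : 0 <= D ^+ 2 / m%:R by rewrite divr_ge0.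
have : D ^+ 2 / m%:R * k%:R <= D ^+ 2 / m%:R * k%:R ^+ 2.
  by rewrite ler_wpM2l// expr2 ler_peMr.
have : 0 <= D ^+ 2 / m%:R * k%:R by rewrite mulr_ge0.
lra.
Qed.

(** [ln rho <= rho - 1], which is [psi / k^2] times [k^2 / Z], and above the cutoff [k^2 / Z]
    exceeds 1 by at most [5 D^2 / k]. Against [9 D^2 / m] this excess sums to the harmonic error,
    with [45 = 5 * 9]. *)
Lemma mean_sum_xi_le :
  mean_sum G (xi R d G) m finset.set0 <= mu R d G + 45 * D ^+ 4 * h1 / m%:R.
Proof.
rewrite mean_sum_layer /mu /harm1.
have -> : 45 * D ^+ 4 * (\sum_(1 <= k < m.+1) k%:R^-1) / m%:R
   = \sum_(1 <= k < m.+1) 5 * D ^+ 2 / k%:R * (9 * D ^+ 2 / m%:R) :> R.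
  rewrite mulr_sumr mulr_suml; apply: eq_bigr => k _.
  by rewrite [D ^+ 4](exprD _ 2 2); ring.
rewrite -big_split/= big_nat [leRHS]big_nat; apply: ler_sum => k /andP[k0 km].
have kR : 0 < k%:R :> R by rewrite ltr0n.
have k1R : 1 <= k%:R :> R by rewrite ler1n.
have c0 : 0 <= 5 * D ^+ 2 / k%:R by rewrite divr_ge0// mulr_ge0.
have h : layer_mean G k (fun S => psi R d G S / #|S|%:R ^+ 2) <= 9 * D ^+ 2 / m%:R.
  by apply: layer_mean_psi_le; rewrite k0.
apply: le_trans _ (lerD (lexx _) (ler_wpM2l c0 h)).
rewrite -layer_meanZ -layer_meanD; apply: layer_mean_le => S /andP[sSG /eqP cS].
have x0 : 0 <= psi R d G S / k%:R ^+ 2 by rewrite divr_ge0 ?exprn_ge0.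
rewrite cS /xi; case: ifP => [cutS|_]; last by rewrite addr_ge0// mulr_ge0.
have Z0 : 0 < zfun R d G S by apply: zfun_gt0; rewrite ?cS.
have Zh : k%:R ^+ 2 / 2 <= zfun R d G S.
  rewrite -cS; apply: (zfun_half Gd m0 d2m sSG).
  apply: (@le_trans _ _ (cutoff d)%:R); last by rewrite ler_nat ltnW.
  by rewrite /cutoff natrM natrX; move: D20; lra.
have r0 : 0 < rho R d G S by apply: rho_pos; rewrite ?cS.
apply: le_trans (ln_le_subr1 r0) _; rewrite /rho cS.
have -> : k%:R ^+ 2 / zfun R d G S - 1 = psi R d G S / k%:R ^+ 2 * (k%:R ^+ 2 / zfun R d G S).
  by rewrite /psi cS; field; rewrite !gt_eqF.
suff q : k%:R ^+ 2 / zfun R d G S <= 1 + 5 * D ^+ 2 / k%:R.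
  by apply: le_trans (ler_wpM2l x0 q) _; rewrite mulrDr mulr1 [X in _ + X]mulrC.
have -> : k%:R ^+ 2 / zfun R d G S = 1 + psi R d G S / zfun R d G S.
  by rewrite /psi cS; field; rewrite gt_eqF.
rewrite lerD2l ler_pdivrMr//.
have pl : psi R d G S <= 5 / 2 * D ^+ 2 * #|S|%:R := psi_le R Gd m0 d2m sSG.
rewrite cS in pl.
apply: le_trans pl _; apply: le_trans _ (ler_wpM2l c0 Zh).
by rewrite le_eqVlt; apply/orP; left; apply/eqP; field; rewrite gt_eqF.
Qed.

(** Jensen's inequality, one draw at a time: the tangent of exp at the mean b averages to [expR b].
    The factors are compared through [expR x <= 1 / (1 - x)] at [x = psi / k^2], where the right
    side is [rho]. *)
Lemma mean_prod_rho_ge : expR (mu R d G) <= mean_prod G (rho R d G) m finset.set0.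
Proof.
rewrite /mu -mean_sum_layer.
suff H k S : S \subset G -> (#|S| + k = m)%N ->
    expR (mean_sum G (fun S => psi R d G S / #|S|%:R ^+ 2) k S)
    <= mean_prod G (rho R d G) k S.
  by apply: H; rewrite ?finset.sub0set ?cards0.
elim: k S => [|k IH] S sSG cS; first by rewrite /= expR0.
have GS0 : (0 < #|G :\: S|)%N.
  by rewrite cardsD (finset.setIidPr sSG) subn_gt0 -cS addnS ltnS leq_addr.
pose Y e := psi R d G (e |: S) / #|e |: S|%:R ^+ 2
   + mean_sum G (fun S => psi R d G S / #|S|%:R ^+ 2) k (e |: S).
rewrite [mean_sum _ _ _ _]/= -/(up_mean G S Y); set b := up_mean G S Y.
have -> : expR b = up_mean G S (fun e => expR b * (1 + (Y e - b))).
  by rewrite up_meanZ up_meanD up_mean_cst// up_meanD up_mean_cst// subrr addr0 mulr1.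
apply: up_mean_le => e; rewrite inE => /andP[eS eG].
have sU : e |: S \subset G by rewrite subUset sub1set eG.
have cU : #|e |: S| = #|S|.+1 by rewrite cardsU1 eS add1n.
apply: (@le_trans _ _ (expR (Y e))).
  have -> : expR (Y e) = expR b * expR (Y e - b) by rewrite -expRD addrC subrK.
  by apply: ler_wpM2l; [exact: expR_ge0 | exact: expR_ge1Dx].
rewrite /Y expRD; apply: ler_pM; rewrite ?expR_ge0//; last first.
  by apply: IH; rewrite // cU addSn -addnS.
set k1 : R := #|e |: S|%:R.
have k00 : 0 < k1 by rewrite ltr0n cU.
have k0 : 0 < k1 ^+ 2 by rewrite exprn_gt0.
have Z0 : 0 < zfun R d G (e |: S) by apply: zfun_gt0; rewrite ?cU.
apply: le_trans (expR_le_invr _) _.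
  by rewrite ltr_pdivrMr// mul1r /psi -/k1; move: Z0; lra.
rewrite le_eqVlt; apply/orP; left; apply/eqP.
rewrite /rho /psi -/k1; set z := zfun _ _ _ _ in Z0 *.
have -> : 1 - (k1 ^+ 2 - z) / k1 ^+ 2 = z / k1 ^+ 2.
  by field; rewrite gt_eqF.
by rewrite invf_div.
Qed.

(* The constants are written as products because numerals are unary. *)
Definition err_const (r : nat) : R :=
  (8 * 1000) + (10 * 4096) * expR (2 * (4 + 4 * r%:R) + (1 + r%:R^-1)).

Definition err (r : nat) : R :=
  err_const r * expR (r%:R^-1 * ln (4096 * D ^+ 2)) * D ^+ 4 * h1 ^+ 2 / m%:R.

Let D4096 : 1 <= 4096 * D ^+ 2.
Proof. by have := exprn_ege1 2 D1; lra. Qed.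

Let D40 : 0 <= D ^+ 4. Proof. exact: exprn_ge0. Qed.

(** [6272 = 2 * 64 * 7^2]. The term j = 1 of the first sum is 0, so a harmonic sum up to [m - 1]
    remains. *)
Lemma sum_chain_var_le :
  \sum_(1 <= j < m.+1) chain_var G (7 * D ^+ 2) j <= 6272 * (D ^+ 4 * h1 ^+ 2 / m%:R).
Proof.
rewrite /chain_var -mulr_sumr big_split/=.
have -> : \sum_(1 <= j < m.+1) (j.-1%:R * m%:R)^-1 = harm R G / m%:R :> R.
  rewrite big_ltn// mul0r invr0 add0r big_add1/= /harm mulr_suml.
  by apply: eq_bigr => j _; rewrite invfM.
have -> : \sum_(1 <= j < m.+1) harm R G ^+ 2 / m%:R ^+ 2 = harm R G ^+ 2 / m%:R.
  by rewrite sum_nat1; field; rewrite gt_eqF.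
have H0 : 0 <= harm R G by exact: harm_ge0.
have q1 : harm R G + harm R G ^+ 2 <= 2 * h1 ^+ 2.
  have : harm R G ^+ 2 <= h1 ^+ 2 by rewrite lerXn2r ?nnegrE ?(le_trans H0 hh).
  have : h1 <= h1 ^+ 2 by rewrite expr2 ler_peMr ?(le_trans H0 hh).
  by move: hh; lra.
rewrite -mulrDl.
have -> : 64 * (7 * D ^+ 2) ^+ 2 * ((harm R G + harm R G ^+ 2) / m%:R)
    = 3136 * D ^+ 4 / m%:R * (harm R G + harm R G ^+ 2).
  by rewrite [D ^+ 4](exprD _ 2 2) exprMn; ring.
have c0 : 0 <= D ^+ 4 / m%:R by rewrite divr_ge0.
have := ler_wpM2l c0 q1; lra.
Qed.

(** The exponential of [low_weight] is a constant times the power [1 + 1/r] of [4096 D^2 / j]. One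
    power of [1 / j] yields the harmonic sum; the remaining power [1/r] is bounded by its value at j
    = 1. *)
Lemma sum_low_le (r : nat) : (0 < r)%N ->
  \sum_(1 <= j < (cutoff d).+1)
     2 * expR (low_weight r (ratio_bound R d) j) * (5 * D ^+ 2 / m%:R)
  <= (10 * 4096) * expR (2 * (4 + 4 * r%:R) + (1 + r%:R^-1))
     * expR (r%:R^-1 * ln (4096 * D ^+ 2)) * (D ^+ 4 * h1 ^+ 2 / m%:R).
Proof.
move=> r0; set E := expR (2 * _ + _).
have [C CE] : exists C : R, C = 4096 * D ^+ 2 by exists (4096 * D ^+ 2).
have C1 : 1 <= C by rewrite CE.
have C0 : 0 < C by exact: lt_le_trans C1.
have rC j : ratio_bound R d j = C / j%:R by rewrite /ratio_bound CE.
rewrite -CE; set F := expR (_ * ln _).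
have rR : 0 < r%:R :> R by rewrite ltr0n.
have E0 : 0 <= E by exact: expR_ge0.
have F0 : 0 <= F by exact: expR_ge0.
apply: (@le_trans _ _ (\sum_(1 <= j < (cutoff d).+1)
   10 * C * E * F * (D ^+ 2 / m%:R) * j%:R^-1)).
  rewrite big_nat [leRHS]big_nat; apply: ler_sum => j /andP[j0 _].
  have jR : 0 < j%:R :> R by rewrite ltr0n.
  have q0 : 0 < ratio_bound R d j by rewrite rC divr_gt0.
  have ql : ln (ratio_bound R d j) <= ln C.
    by rewrite ler_ln ?posrE// rC ler_pdivrMr// ler_peMr ?ler1n// ltW.
  have -> : low_weight r (ratio_bound R d) j = (2 * (4 + 4 * r%:R) + (1 + r%:R^-1))
     + (ln (ratio_bound R d j) + r%:R^-1 * ln (ratio_bound R d j)).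
    by rewrite /low_weight; ring.
  rewrite expRD -/E [X in E * X]expRD lnK ?posrE//.
  have qF : expR (r%:R^-1 * ln (ratio_bound R d j)) <= F.
    by rewrite ler_expR ler_wpM2l ?invr_ge0 ?(ltW rR).
  have -> : 10 * C * E * F * (D ^+ 2 / m%:R) * j%:R^-1
    = 2 * (E * (ratio_bound R d j * F)) * (5 * D ^+ 2 / m%:R).
    by rewrite rC; ring.
  rewrite ler_wpM2r ?divr_ge0 ?mulr_ge0// ler_wpM2l// ler_wpM2l// ler_wpM2l//.
  exact: ltW.
have cm : (cutoff d <= m)%N.
  rewrite -(ler_nat R) natrM natrX; apply: le_trans _ dm.
  by have := ler_wpM2l D20 h11; move: D20; lra.
rewrite -mulr_sumr.
have q : \sum_(1 <= j < (cutoff d).+1) j%:R^-1 <= h1 ^+ 2.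
  apply: (@le_trans _ _ h1); last by rewrite expr2 ler_peMr ?(le_trans ler01 h11).
  by rewrite /harm1 [leRHS](big_cat_nat (n := (cutoff d).+1))//= lerDl sumr_ge0.
have c0 : 0 <= C * E * F * (D ^+ 2 / m%:R) by rewrite !mulr_ge0 ?(ltW C0)// invr_ge0.
have := ler_wpM2l c0 q.
have -> : (10 * 4096) * E * F * (D ^+ 4 * h1 ^+ 2 / m%:R)
    = 10 * (C * E * F * (D ^+ 2 / m%:R) * h1 ^+ 2).
  by rewrite CE [D ^+ 4](exprD _ 2 2); ring.
lra.
Qed.

(** The subtracted multiple of [D^4 h1^2 / m] is a reserve for the errors made later in evaluating
    [mu] and the product of the factors [1 - wt]. *)
Lemma mean_prod_rho_bounds (r : nat) : (1 < r)%N -> exists2 x : R,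
  mean_prod G (rho R d G) m finset.set0 = expR (mu R d G + x) &
  0 <= x <= err r - 1000 * (D ^+ 4 * h1 ^+ 2 / m%:R).
Proof.
move=> r1; have r0 : (0 < r)%N by exact: ltnW.
have ge := mean_prod_rho_ge; have le := mean_prod_rho_le Gsimple Gd m0 dmH r1.
set P := mean_prod _ _ _ _ in ge le *.
have P0 : 0 < P by exact: lt_le_trans (expR_gt0 _) ge.
exists (ln P - mu R d G); first by rewrite addrC subrK lnK.
rewrite subr_ge0 -[mu R d G]expRK ler_ln ?posrE ?expR_gt0// ge/= expRK.
rewrite lerBlDl; apply: (@le_trans _ _ (ln (expR (mean_sum G (xi R d G) #|G| finset.set0 +
     \sum_(1 <= j < #|G|.+1) chain_var G (7 * D ^+ 2) j +
     \sum_(1 <= j < (cutoff d).+1)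
       2 * expR (low_weight r (ratio_bound R d) j) * (5 * D ^+ 2 / #|G|%:R))))).
  by rewrite ler_ln ?posrE ?expR_gt0.
rewrite expRK; apply: le_trans (lerD (lerD mean_sum_xi_le sum_chain_var_le) (sum_low_le r0)) _.
rewrite /err /err_const; set E := expR (2 * _ + _); set F := expR (_ * ln _).
set Q := D ^+ 4 * h1 ^+ 2 / m%:R.
have F1 : 1 <= F.
  by rewrite -expR0 ler_expR mulr_ge0 ?invr_ge0// ln_ge0.
have Q0 : 0 <= Q by rewrite divr_ge0// mulr_ge0// sqr_ge0.
have q1 : 45 * D ^+ 4 * h1 / m%:R <= 45 * Q.
  have -> : 45 * D ^+ 4 * h1 / m%:R = 45 * D ^+ 4 / m%:R * h1 by ring.
  have -> : 45 * Q = 45 * D ^+ 4 / m%:R * h1 ^+ 2 by rewrite /Q; ring.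
  apply: ler_wpM2l; first by rewrite divr_ge0// mulr_ge0.
  by rewrite expr2 ler_peMr ?(le_trans ler01 h11).
have -> : ((8 * 1000) + (10 * 4096) * E) * F * D ^+ 4 * h1 ^+ 2 / m%:R = (8 * 1000) * (F * Q) + (10 * 4096) * E * F * Q.
  by rewrite /Q; ring.
have : Q <= F * Q by rewrite ler_peMl.
lra.
Qed.

End Combine.

(** * The exponent *)

Section Exponent.
Variables (R : realType) (n : nat) (d : degseq n) (G : digraph n).
Hypotheses (Gsimple : simple_digraph G) (Gd : obeys G d).
Local Notation m := #|G|.
Local Notation D := ((dmax d)%:R : R).
Local Notation din i := ((din d i)%:R : R).
Local Notation dout i := ((dout d i)%:R : R).
Hypotheses (m6 : (6 <= m)%N) (dm : 448 * D ^+ 2 * harm1 R G <= m%:R).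

Lemma sum_tail (F : 'I_n -> R) : \sum_(e in G) F e.1 = \sum_u dout u * F u.
Proof.
rewrite (partition_big fst xpredT)//=; apply: eq_bigr => u _.
rewrite -(sum_out_eq Gd u) natr_sum mulr_suml [LHS]big_mkcond [RHS]big_mkcond/=.
apply: eq_bigr => e _; case: (e \in G) => //=.
by have [->|_] := eqVneq e.1 u; rewrite ?mul1r ?mul0r.
Qed.

Lemma sum_head (F : 'I_n -> R) : \sum_(e in G) F e.2 = \sum_v din v * F v.
Proof.
rewrite (partition_big snd xpredT)//=; apply: eq_bigr => u _.
rewrite -(sum_in_eq Gd u) natr_sum mulr_suml [LHS]big_mkcond [RHS]big_mkcond/=.
apply: eq_bigr => e _; case: (e \in G) => //=.
by have [->|_] := eqVneq e.2 u; rewrite ?mul1r ?mul0r.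
Qed.

Lemma sumWE : sumW R d G =
  (\sum_u dout u ^+ 2) * (\sum_v din v ^+ 2) / (2 * m%:R).
Proof.
rewrite /sumW /wt -(eq_bigr _ (fun u _ => erefl (dout u * dout u))).
rewrite -(eq_bigr _ (fun u _ => erefl (din u * din u))) -sum_tail -sum_head.
rewrite !mulr_suml; apply: eq_bigr => e _; rewrite mulr_sumr mulr_suml.
by apply: eq_bigr => f _.
Qed.

Lemma sumLE : sumL R G = \sum_u din u * dout u.
Proof.
rewrite /sumL (eq_bigr (fun e => din e.1)) => [|e _].
  by rewrite (sum_tail (fun u => din u)); apply: eq_bigr => u _; rewrite mulrC.
rewrite -(sum_in_eq Gd) natr_sum; apply: eq_bigr => f _.
by rewrite eq_sym.
Qed.

(** Counted by the third edge g: e is any other edge with the tail of g, and independently f is any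
    other edge with the head of g. *)
Lemma sumTE : sumT R G = \sum_(g in G) (dout g.1 - 1) * (din g.2 - 1).
Proof.
rewrite /sumT.
transitivity (\sum_(e in G) \sum_(f in G) \sum_(g in G)
   ((e.1 == g.1) && (e != g))%:R * ((f.2 == g.2) && (f != g))%:R : R).
  apply: eq_bigr => e _; apply: eq_bigr => f _; rewrite /third.
  have [gG|gG] := boolP ((e.1, f.2) \in G).
    rewrite (bigD1 (e.1, f.2))//= !eqxx/= big1 ?addr0.
      by rewrite -natrM mulnb ![_ == (_, _)]eq_sym.
    move=> [u v]/= /andP[_]; rewrite xpair_eqE negb_and ![_ == e.1]eq_sym ![_ == f.2]eq_sym.
    by move=> /orP[]/negPf->; rewrite /= ?mul0r ?mulr0.
  rewrite big1// => [[u v]]/= gG'.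
  have [eu|_] := eqVneq e.1 u; last by rewrite mul0r.
  have [fv|_] := eqVneq f.2 v; last by rewrite mulr0.
  by rewrite eu fv gG' in gG.
under eq_bigr do rewrite exchange_big/=.
rewrite exchange_big/=; apply: eq_bigr => g gG.
under eq_bigr do rewrite -mulr_sumr.
rewrite -mulr_suml; congr (_ * _).
  rewrite -(sum_out_eq Gd g.1) natr_sum (bigD1 g)//= [in RHS](bigD1 g)//= !eqxx/= add0r.
  rewrite [RHS]addrAC mulr1n subrr add0r.
  by apply: eq_bigr => e /andP[_ ->]; rewrite andbT.
rewrite -(sum_in_eq Gd g.2) natr_sum (bigD1 g)//= [in RHS](bigD1 g)//= !eqxx/= add0r.
rewrite [RHS]addrAC mulr1n subrr add0r.
by apply: eq_bigr => e /andP[_ ->]; rewrite andbT.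
Qed.

Definition expo : R :=
  (\sum_i din i * dout i) / m%:R - (\sum_i (din i ^+ 2 + dout i ^+ 2)) / (2 * m%:R)
  + ((\sum_i din i ^+ 2) * (\sum_i dout i ^+ 2)) / (2 * m%:R ^+ 2) + 2^-1.

Let m0 : (0 < m)%N. Proof. exact: leq_trans m6. Qed.
Let mR : 0 < m%:R :> R. Proof. by rewrite ltr0n. Qed.

(** The sum over G of [dout g.1 * din g.2] is not a function of the degrees. It enters through
    [sumT / (2 m)] and cancels exactly against the sum of [wt] over G. The summand 1/2 is the
    constant term m of [sumT] divided by [2 m]. *)
Lemma expoE : expo = (sumW R d G + sumL R G) / m%:R + sumT R G / (2 * m%:R)
  - \sum_(g in G) wt R d G g.1 g.2.
Proof.
have -> : \sum_(g in G) wt R d G g.1 g.2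
    = (\sum_(g in G) dout g.1 * din g.2) / (2 * m%:R) by rewrite mulr_suml.
have -> : sumT R G = \sum_(g in G) dout g.1 * din g.2
    - \sum_i dout i ^+ 2 - \sum_i din i ^+ 2 + m%:R.
  rewrite sumTE -(eq_bigr _ (fun u _ => erefl (dout u * dout u))).
  rewrite -(eq_bigr _ (fun u _ => erefl (din u * din u))) -sum_tail -sum_head.
  rewrite -[m%:R]mulr1 -sum_cst -!sumrB -big_split/=.
  by apply: eq_bigr => g _; ring.
rewrite sumWE sumLE /expo big_split/=; field; by rewrite gt_eqF.
Qed.

(** [ln (1 - w)] differs from [- w] by O(w^2), with [w <= D^2 / (2 m)], and there are m factors. *)
Lemma prod_wt_bounds : (dmax d ^ 2 <= m)%N -> exists2 x : R,
  \prod_(g in G) (1 - wt R d G g.1 g.2) = expR (x - \sum_(g in G) wt R d G g.1 g.2) &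
  `|x| <= D ^+ 4 / m%:R.
Proof.
move=> d2m; pose l (g : 'I_n * 'I_n) : R := ln (1 - wt R d G g.1 g.2).
have w01 (g : 'I_n * 'I_n) : 0 <= wt R d G g.1 g.2 <= 2^-1 by exact: wt_half.
exists (\sum_(g in G) (l g + wt R d G g.1 g.2)).
  rewrite -sumrB expR_sum; apply: eq_bigr => g _.
  by rewrite addrK lnK// posrE; have := w01 g; lra.
apply: le_trans (ler_norm_sum _ _ _) _.
apply: (@le_trans _ _ (\sum_(g in G) (D ^+ 4 / m%:R ^+ 2))); last first.
  by rewrite sum_cst le_eqVlt; apply/orP; left; apply/eqP; field; rewrite gt_eqF.
apply: ler_sum => g _; have /andP[w0 w1] := w01 g.
have /andP[_ w2] := wt_le R d G g.1 g.2; rewrite /l.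
set w := wt _ _ _ _ _ in w0 w1 w2 *.
have p0 : 0 < 1 - w by lra.
have u1 := ln_le_subr1 p0.
have i0 : 0 < (1 - w)^-1 by rewrite invr_gt0.
have u2 := ln_le_subr1 i0; rewrite lnV ?posrE// in u2.
have u3 : (1 - w)^-1 - 1 <= w + 2 * w ^+ 2.
  have -> : (1 - w)^-1 - 1 = w / (1 - w) by field; rewrite gt_eqF.
  rewrite ler_pdivrMr//; have := mulr_ge0 (sqr_ge0 w) (_ : 0 <= 1 - 2 * w); lra.
have u4 : 2 * w ^+ 2 <= D ^+ 4 / m%:R ^+ 2.
  apply: (@le_trans _ _ (2 * (D ^+ 2 / (2 * m%:R)) ^+ 2)).
    by rewrite ler_wpM2l// lerXn2r ?nnegrE ?(le_trans w0 w2).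
  have -> : 2 * (D ^+ 2 / (2 * m%:R)) ^+ 2 = D ^+ 4 / m%:R ^+ 2 / 2.
    by rewrite [D ^+ 4](exprD _ 2 2); field; rewrite gt_eqF.
  have : 0 <= D ^+ 4 / m%:R ^+ 2 by rewrite divr_ge0 ?exprn_ge0.
  lra.
by rewrite ler_norml; apply/andP; split; lra.
Qed.

Lemma chain_expectation (r : nat) : (1 < r)%N -> exists2 x : R,
  mean_prod G (rho R d G) m finset.set0 * \prod_(g in G) (1 - wt R d G g.1 g.2)
  = expR (expo + x) & `|x| <= err R d G r.
Proof.
move=> r1; have h11 := harm1_ge1 R m6; have D1 := D_ge1 R Gd m0.
have D20 := sqr_ge0 D.
have d2m : (dmax d ^ 2 <= m)%N.
  rewrite -(ler_nat R) natrX; apply: le_trans _ dm.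
  have := ler_wpM2l D20 h11; lra.
have [x -> /andP[x0 x1]] := mean_prod_rho_bounds Gsimple Gd m6 dm r1.
have [y -> y1] := prod_wt_bounds d2m.
have := mu_bound R Gsimple Gd m6 d2m.
set z := mu R d G - _ => z1.
exists (x + y + z); first by rewrite -expRD expoE /z; congr (expR _); ring.
apply: le_trans (ler_normD _ _) _.
apply: le_trans (lerD (ler_normD _ _) (lexx _)) _; rewrite (ger0_norm x0).
set h := harm1 R G in h11 x1 z1 *; set Q := D ^+ 4 * h ^+ 2 / m%:R in x1.
have q0 : 0 <= D ^+ 4 / m%:R by rewrite divr_ge0// exprn_ge0.
have hh : h <= h ^+ 2 by rewrite expr2 ler_peMr// (le_trans ler01).
have q1 : D ^+ 4 / m%:R <= Q.
  have -> : Q = D ^+ 4 / m%:R * h ^+ 2 by rewrite /Q; ring.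
  by rewrite ler_peMr// (le_trans h11).
have q2 : 11 * D ^+ 4 * h / m%:R <= 11 * Q.
  have -> : Q = D ^+ 4 / m%:R * h ^+ 2 by rewrite /Q; ring.
  by have := ler_wpM2l q0 hh; lra.
have := le_trans y1 q1; have := le_trans z1 q2; have := le_trans q0 q1.
by clearbody Q => *; lra.
Qed.

End Exponent.

(** * The algorithm as a uniform chain *)

Section Run.
Variables (R : realType) (n : nat) (d : degseq n) (G : digraph n).
Local Notation T := ('I_n * 'I_n)%type.
Implicit Types (S : {set T}) (e f : T).
Hypotheses (Gsimple : simple_digraph G) (Gd : obeys G d).
Local Notation m := #|G|.
Hypotheses (m0 : (0 < m)%N) (d2m : (dmax d ^ 2 <= m)%N).

Definition tails S u : nat := (\sum_(x in S) (x.1 == u))%N.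
Definition heads S v : nat := (\sum_(x in S) (x.2 == v))%N.

(** A run that returns G passes only through states of this form, S being the set of edges of G that
    are still missing. *)
Definition state_of S : state n := State (G :\: S) (tails S) (heads S).

Lemma init_state_of : init_state d = state_of G.
Proof.
rewrite /init_state /state_of finset.setDv.
have -> : dout d = tails G by apply/funext => u; rewrite /tails (sum_out_eq Gd).
by have -> : din d = heads G by apply/funext => v; rewrite /heads (sum_in_eq Gd).
Qed.

Lemma tailsD1 S e u : e \in S -> tails S u = ((u == e.1) + tails (S :\ e) u)%N.
Proof. by move=> eS; rewrite /tails (big_setD1 e)//= eq_sym. Qed.

Lemma headsD1 S e v : e \in S -> heads S v = ((v == e.2) + heads (S :\ e) v)%N.
Proof. by move=> eS; rewrite /heads (big_setD1 e)//= eq_sym. Qed.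

Lemma add_edge_state_of S e : S \subset G -> e \in S ->
  add_edge (state_of S) e = state_of (S :\ e).
Proof.
move=> sSG eS; rewrite /add_edge /state_of /=.
have -> : e |: G :\: S = G :\: (S :\ e).
  apply/setP => x; rewrite !inE; have [->|xe] //= := eqVneq x e.
  by rewrite (fintype.subsetP sSG).
have -> : (fun i => tails S i - (i == e.1))%N = tails (S :\ e).
  by apply/funext => u; rewrite (tailsD1 u eS) addKn.
by have -> : (fun i => heads S i - (i == e.2))%N = heads (S :\ e);
  first by apply/funext => v; rewrite (headsD1 v eS) addKn.
Qed.

(** Edges are never removed, so a single edge outside G excludes the outcome G. *)
Lemma run_prob_outside k (s : state n) : ~~ (edges s \subset G) ->
  run_prob R d k s (Some G) = 0.
Proof.
have halt (t : state n) : ~~ (edges t \subset G) ->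
    (Some G == if #|edges t| == nedges d then Some (edges t) else None) = false.
  move=> tG; case: ifP => _ //; apply/eqP => -[E].
  by rewrite -E fintype.subxx in tG.
elim: k s => [|k IH] s sG /=; case: ifP => // _; rewrite ?halt//.
rewrite big1// => e _; rewrite IH ?mulr0//=.
by apply: contra sG => /(fintype.subset_trans _); apply; exact: finset.subsetUr.
Qed.

Lemma weight_state_of S e :
  weight R d (state_of S) e = (tails S e.1)%:R * (heads S e.2)%:R * (1 - wt R d G e.1 e.2).
Proof. by rewrite /weight /wt (nedges_card Gd). Qed.

Lemma sum_pairs S (F : T -> R) :
  \sum_(x in S) \sum_(y in S) F (x.1, y.2)
  = \sum_e (tails S e.1)%:R * (heads S e.2)%:R * F e.
Proof.
transitivity (\sum_(x in S) \sum_(y in S) \sum_e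
   (x.1 == e.1)%:R * (y.2 == e.2)%:R * F e : R).
  apply: eq_bigr => x _; apply: eq_bigr => y _.
  rewrite (bigD1 (x.1, y.2))//= !eqxx !mul1r big1 ?addr0// => -[u v].
  rewrite xpair_eqE negb_and [u == _]eq_sym [v == _]eq_sym /=.
  by move=> /orP[]/negPf->; rewrite ?mulr0 !mul0r.
under eq_bigr do rewrite exchange_big/=.
rewrite exchange_big/=; apply: eq_bigr => e _.
rewrite /tails /heads !natr_sum mulr_suml mulr_suml; apply: eq_bigr => x _.
by rewrite mulr_sumr mulr_suml.
Qed.

(** Vertex pairs weighted by residual degrees are pairs of stubs, that is, pairs of edges of S of
    which the first gives its tail and the second its head. *)
Lemma sum_weight S :
  \sum_(e | eligible (state_of S) e) weight R d (state_of S) e = zfun R d G S.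
Proof.
rewrite /zfun; pose F (e : T) : R :=
  if (e.1 == e.2) || (e \in G :\: S) then 0 else 1 - wt R d G e.1 e.2.
rewrite -[RHS]/(\sum_(x in S) \sum_(y in S) F (x.1, y.2)) sum_pairs.
rewrite [LHS]big_mkcond/=; apply: eq_bigr => e _.
rewrite weight_state_of /eligible /F /= -negb_or.
by case: (_ || _); rewrite /= ?mulr0.
Qed.

(** The part of the probability that does not depend on the order of the edges: residual degrees
    used up one by one multiply to factorials. Owing to the division by the factorial of [#|S|],
    each step leaves [#|S| / Z]; passing from a sum over S to a mean supplies the second [#|S|] of
    [rho]. *)
Definition degree_weight S : R :=
  (\prod_u (tails S u)`!%:R * \prod_v (heads S v)`!%:R)
  * \prod_(g in S) (1 - wt R d G g.1 g.2) / (#|S|)`!%:R.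

Lemma wt1_gt0 u v : 0 < 1 - wt R d G u v.
Proof. have := wt_half R m0 d2m u v; lra. Qed.

Lemma degree_weight_gt0 S : 0 < degree_weight S.
Proof.
have fact0 k : 0 < k`!%:R :> R by rewrite ltr0n fact_gt0.
rewrite /degree_weight divr_gt0// !mulr_gt0 ?prodr_gt0// => g _.
exact: wt1_gt0.
Qed.

Lemma prod_factD1 (a b : 'I_n -> nat) (w : 'I_n) :
  (forall u, a u = ((u == w) + b u)%N) ->
  \prod_u (a u)`!%:R = (a w)%:R * \prod_u (b u)`!%:R :> R.
Proof.
move=> ab; rewrite (bigD1 w)//= [X in _ * X = _](eq_bigr (fun u => (b u)`!%:R)).
  rewrite [in RHS](bigD1 w)//= mulrA; congr (_ * _).
  by rewrite ab eqxx add1n factS natrM.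
by move=> u /negPf uw; rewrite ab uw.
Qed.

Lemma degree_weightD1 S e : e \in S ->
  weight R d (state_of S) e * degree_weight (S :\ e) = degree_weight S * #|S|%:R.
Proof.
move=> eS; rewrite weight_state_of /degree_weight.
rewrite (@prod_factD1 (tails S) (tails (S :\ e)) e.1) => [|u]; last exact: tailsD1.
rewrite (@prod_factD1 (heads S) (heads (S :\ e)) e.2) => [|u]; last exact: headsD1.
rewrite [in RHS](big_setD1 e)//= (cardsD1 e S) eS add1n factS natrM.
have f0 : (#|S :\ e|)`!%:R != 0 :> R by rewrite pnatr_eq0 -lt0n fact_gt0.
have c0 : #|S :\ e|.+1%:R != 0 :> R by rewrite pnatr_eq0.
set b : R := #|S :\ e|.+1%:R in c0 *; clearbody b.
by field; rewrite f0 c0.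
Qed.

Definition run_ratio S : R :=
  run_prob R d #|S| (state_of S) (Some G) / degree_weight S.

Lemma run_ratio0 : run_ratio finset.set0 = 1.
Proof.
rewrite /run_ratio /degree_weight cards0 /=.
case: ifP => [/existsP[e]|_].
  by rewrite /can_add /= /tails big_set0 ltnn andbF.
rewrite setD0 (nedges_card Gd) !eqxx big_set0 /tails /heads.
by rewrite !big1 ?mulr1 ?fact0 ?divr1 ?mulr1 ?divr1// => u _; rewrite big_set0.
Qed.

Lemma run_ratio_rec S : S \subset G -> (0 < #|S|)%N ->
  run_ratio S = rho R d G S * ((\sum_(e in S) run_ratio (S :\ e)) / #|S|%:R).
Proof.
move=> sSG S0; have Z0 := zfun_gt0 R Gsimple m0 d2m sSG S0.
have s0 : 0 < #|S|%:R :> R by rewrite ltr0n.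
have elig e : e \in S -> eligible (state_of S) e.
  move=> eS; rewrite /eligible /= inE eS /= andbT.
  apply/eqP => ee; have := Gsimple e.1.
  by rewrite [X in (_, X)]ee -surjective_pairing (fintype.subsetP sSG).
have W0 := degree_weight_gt0 S.
suff E : run_prob R d #|S| (state_of S) (Some G)
   = \sum_(e in S) degree_weight S * #|S|%:R / zfun R d G S * run_ratio (S :\ e).
  rewrite {1}/run_ratio E -mulr_sumr /rho.
  by field; rewrite !gt_eqF.
have [k Sk] : exists k, #|S| = k.+1 by exists #|S|.-1; rewrite prednK.
have ex : [exists e, can_add (state_of S) e].
  have /card_gt0P[e eS] := S0.
  apply/existsP; exists e; rewrite /can_add elig//=.
  by rewrite (tailsD1 _ eS) (headsD1 _ eS) !eqxx.
rewrite {1}Sk /= ex.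
(* An eligible pair outside S is not an edge of G, so its choice excludes the outcome G. *)
rewrite (bigID (mem S))/= addrC big1 ?add0r => [|e /andP[/andP[_ eG] eS]]; last first.
  rewrite run_prob_outside ?mulr0//=.
  apply/negP => /fintype.subsetP/(_ e); rewrite !inE eqxx => /(_ isT) eG'.
  by move: eG; rewrite /= inE eS eG'.
apply: eq_big => [e|e /andP[_ eS]].
  by case: (boolP (e \in S)) => [/elig ->|]; rewrite ?andbF.
rewrite add_edge_state_of// /pick_prob sum_weight -(degree_weightD1 eS).
rewrite /run_ratio.
have -> : #|S :\ e| = k by apply/eqP; rewrite -eqSS -Sk (cardsD1 e S) eS.
have W1 := degree_weight_gt0 (S :\ e).
by field; rewrite !gt_eqF.
Qed.

Lemma stub_matching_probE : stub_matching_prob R d (Some G)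
  = (\prod_u (dout d u)`!%:R * \prod_v (din d v)`!%:R) / m`!%:R
    * (mean_prod G (rho R d G) m finset.set0 * \prod_(g in G) (1 - wt R d G g.1 g.2)).
Proof.
rewrite -(mean_prod_down run_ratio0 run_ratio_rec).
rewrite /stub_matching_prob (nedges_card Gd) init_state_of /run_ratio.
have W0 := degree_weight_gt0 G.
have -> : (\prod_u (dout d u)`!%:R * \prod_v (din d v)`!%:R) / m`!%:R
    * (run_prob R d m (state_of G) (Some G) / degree_weight G
       * \prod_(g in G) (1 - wt R d G g.1 g.2))
   = degree_weight G / degree_weight G * run_prob R d m (state_of G) (Some G).
  have -> : \prod_u (dout d u)`!%:R = \prod_u (tails G u)`!%:R :> R.
    by apply: eq_bigr => u _; rewrite /tails (sum_out_eq Gd).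
  have -> : \prod_v (din d v)`!%:R = \prod_v (heads G v)`!%:R :> R.
    by apply: eq_bigr => v _; rewrite /heads (sum_in_eq Gd).
  by rewrite {2}/degree_weight; ring.
by rewrite divff ?mul1r// gt_eqF.
Qed.

End Run.

(** * Asymptotics *)

Section Asymptotics.
Variables (R : realType) (n : nat) (d : degseq n) (G : digraph n).
Hypotheses (Gsimple : simple_digraph G) (Gd : obeys G d).
Local Notation m := #|G|.
Local Notation D := ((dmax d)%:R : R).

(** The product of the [(m - r)^2] is the square of [m!], so the prefactor reduces to that of
    [stub_matching_probE]. *)
Lemma asymptotic_probE : asymptotic_prob R d
  = (\prod_u (dout d u)`!%:R * \prod_v (din d v)`!%:R) / m`!%:R * expR (expo R d G).
Proof.
rewrite /asymptotic_prob /expo (nedges_card Gd); congr (_ * _).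
have -> : \prod_(0 <= r < m) ((m - r)%N%:R ^+ 2) = m`!%:R ^+ 2 :> R.
  rewrite prodrXl fact_prod natr_prod; congr (_ ^+ 2).
  rewrite [RHS]big_nat_rev/= [RHS]big_add1/= !big_mkord; apply: eq_bigr => i _.
  by congr (_%:R); lia.
have f0 : m`!%:R != 0 :> R by rewrite pnatr_eq0 -lt0n fact_gt0.
by field.
Qed.

Lemma asymptotic_prob_gt0 : 0 < asymptotic_prob R d.
Proof.
have f0 k : 0 < k`!%:R :> R by rewrite ltr0n fact_gt0.
by rewrite asymptotic_probE mulr_gt0 ?expR_gt0// divr_gt0// mulr_gt0// prodr_gt0.
Qed.

Lemma stub_matching_ratio (r : nat) : (1 < r)%N -> (6 <= m)%N ->
  448 * D ^+ 2 * harm1 R G <= m%:R ->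
  exists2 x : R, stub_matching_prob R d (Some G) / asymptotic_prob R d = expR x &
    `|x| <= err R d G r.
Proof.
move=> r1 m6 dm; have m0 : (0 < m)%N by exact: leq_trans m6.
have d2m : (dmax d ^ 2 <= m)%N.
  rewrite -(ler_nat R) natrX; apply: le_trans _ dm.
  have := ler_wpM2l (sqr_ge0 D) (harm1_ge1 R m6); have := sqr_ge0 D; lra.
have [x xE xb] := chain_expectation Gsimple Gd m6 dm r1; exists x => //.
have a0 := asymptotic_prob_gt0.
rewrite (stub_matching_probE R Gsimple Gd m0 d2m) xE expRD.
apply: (mulIf (lt0r_neq0 a0)); rewrite divfK ?gt_eqF// asymptotic_probE; ring.
Qed.

Lemma harm1_le : (0 < m)%N -> harm1 R G <= 1 + ln (m%:R : R).
Proof.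
rewrite /harm1; elim: m => // -[_ _|k IH _].
  by rewrite big_nat1 ln1 invr1 addr0.
rewrite big_nat_recr//=; apply: le_trans (lerD (IH isT) (lexx _)) _.
rewrite -addrA lerD2l.
have k0 : 0 < k.+1%:R :> R by rewrite ltr0n.
have k1 : 0 < k.+2%:R :> R by rewrite ltr0n.
have := @ln_le_subr1 R (k.+1%:R / k.+2%:R) (divr_gt0 k0 k1).
rewrite ln_div ?posrE//.
have -> : k.+1%:R / k.+2%:R - 1 = - k.+2%:R^-1 :> R.
  apply: (mulIf (lt0r_neq0 k1)).
  rewrite mulrBl divfK ?gt_eqF// mulNr mulVf ?gt_eqF// mul1r -[k.+2%:R]natr1; ring.
by move: (ln k.+1%:R) (ln k.+2%:R) (k.+2%:R^-1) => a b c; lra.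
Qed.

(* The factor (4096 D^2)^(1/r) in err is the price of the last steps; it is at
   most of order m^tau as soon as 2 tau r >= 1. *)
Lemma err_le (C tau : R) (r : nat) : (6 <= m)%N -> 0 < tau -> (0 < r)%N ->
  1 <= 2 * tau * r%:R -> 0 < C ->
  D <= C * expR ((4^-1 - tau) * ln m%:R) ->
  D ^+ 4 * harm1 R G ^+ 2 / m%:R
    <= C ^+ 4 * (1 + tau^-1) ^+ 2 * expR (- tau * ln m%:R) /\
  err R d G r <= err_const R r * expR (r%:R^-1 * ln (4096 * C ^+ 2))
    * (C ^+ 4 * (1 + tau^-1) ^+ 2) * expR (- tau * ln m%:R).
Proof.
move=> m6 tau0 r0 rtau C0 DC; have m0 : (0 < m)%N by exact: leq_trans m6.
have mR : 0 < m%:R :> R by rewrite ltr0n.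
have rR : 0 < r%:R :> R by rewrite ltr0n.
have D1 := D_ge1 R Gd m0; have D0 : 0 < D by exact: lt_le_trans D1.
set L := ln m%:R in DC *.
have L0 : 0 <= L by rewrite ln_ge0// ler1n.
have mL : m%:R^-1 = expR (- L) by rewrite expRN lnK// posrE.
have E1 : 1 <= expR (tau * L) by rewrite -expR0 ler_expR mulr_ge0// ltW.
(* The logarithm is absorbed into [m^tau] at the price of the constant [1 + 1 / tau]. *)
have hle : harm1 R G <= (1 + tau^-1) * expR (tau * L).
  apply: le_trans (harm1_le m0) _; rewrite -/L.
  have h := expR_ge1Dx (tau * L).
  have : L <= tau^-1 * expR (tau * L).
    rewrite ler_pdivlMl//; lra.
  lra.
have h0 : 0 <= harm1 R G by exact: le_trans (harm1_ge1 R m6).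
(* Exponent of m: [4 (1/4 - tau) + 2 tau - 1 = - 2 tau]. One tau of this margin is spent below on
   the factor bounded in [F]. *)
have Q : D ^+ 4 * harm1 R G ^+ 2 / m%:R
    <= C ^+ 4 * (1 + tau^-1) ^+ 2 * expR (- (2 * tau) * L).
  have -> : - (2 * tau) * L = 4 * ((4^-1 - tau) * L) + 2 * (tau * L) + - L by field.
  rewrite !expRD -mL [expR (4 * _)]expRM_natl [expR (2 * _)]expRM_natl.
  have -> : C ^+ 4 * (1 + tau^-1) ^+ 2 * (expR ((4^-1 - tau) * L) ^+ 4 * expR (tau * L) ^+ 2 / m%:R)
    = (C * expR ((4^-1 - tau) * L)) ^+ 4 * ((1 + tau^-1) * expR (tau * L)) ^+ 2 / m%:R.
    by rewrite !exprMn; ring.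
  rewrite ler_wpM2r ?invr_ge0//; apply: ler_pM; rewrite ?exprn_ge0//.
    by rewrite lerXn2r ?nnegrE// (le_trans _ DC).
  by rewrite lerXn2r ?nnegrE// (le_trans _ hle).
have K0 : 0 <= C ^+ 4 * (1 + tau^-1) ^+ 2.
  by rewrite mulr_ge0 ?sqr_ge0// exprn_ge0// ltW.
split.
  apply: le_trans Q _; rewrite ler_wpM2l// ler_expR ler_wpM2r//; lra.
have [B [BE B0]] : exists B : R, B = 4096 /\ 0 < B.
  by exists 4096; split; [exact: erefl | lra].
have F : expR (r%:R^-1 * ln (4096 * D ^+ 2))
    <= expR (r%:R^-1 * ln (4096 * C ^+ 2)) * expR (tau * L).
  rewrite -expRD ler_expR -BE.
  have q : ln (B * D ^+ 2) <= ln (B * C ^+ 2) + 2 * ((4^-1 - tau) * L).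
    rewrite -[2 * _]expRK expRM_natl -lnM ?posrE ?mulr_gt0 ?exprn_gt0 ?expR_gt0//.
    rewrite ler_ln ?posrE ?mulr_gt0 ?exprn_gt0 ?expR_gt0//.
    by rewrite -mulrA -exprMn ler_pM2l// lerXn2r ?nnegrE ?(ltW D0)// (le_trans (ltW D0) DC).
  apply: le_trans (ler_wpM2l _ q) _; first by rewrite invr_ge0.
  rewrite mulrDr lerD2l.
  have -> : r%:R^-1 * (2 * ((4^-1 - tau) * L)) = r%:R^-1 * (2 * (4^-1 - tau)) * L by ring.
  rewrite ler_wpM2r// ler_pdivrMl//.
  lra.
have e0 : 0 <= err_const R r.
  rewrite /err_const; have := expR_ge0 (2 * (4 + 4 * r%:R) + (1 + r%:R^-1) : R); lra.
rewrite /err.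
have -> : err_const R r * expR (r%:R^-1 * ln (4096 * D ^+ 2)) * D ^+ 4 * harm1 R G ^+ 2 / m%:R
  = err_const R r * (expR (r%:R^-1 * ln (4096 * D ^+ 2)) * (D ^+ 4 * harm1 R G ^+ 2 / m%:R)).
  by ring.
rewrite -2![in leRHS]mulrA; apply: ler_wpM2l; first exact: e0.
have -> : - tau * L = tau * L + - (2 * tau) * L by ring.
rewrite expRD [leRHS]mulrA [leRHS]mulrCA [leRHS]mulrA.
apply: le_trans (ler_pM _ _ F Q) _; rewrite ?expR_ge0 ?divr_ge0 ?mulr_ge0 ?exprn_ge0//.
by rewrite le_eqVlt; apply/orP; left; apply/eqP; ring.
Qed.

End Asymptotics.

(** * Passage to the limit along the sequence of degree sequences *)

Local Open Scope classical_set_scope.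
Local Open Scope ring_scope.

(** Every vertex owns at least one of the [2 m] stubs; this is how [n] tending to infinity forces
    [m] to do so. *)
Lemma no_isolated_leq n (d : degseq n) : no_isolated d -> (n <= 2 * nedges d)%N.
Proof.
move=> di; rewrite mul2n -addnn {2}/nedges din_dout_sum -big_split/=.
by rewrite -[X in (X <= _)%N]card_ord -sum1_card; apply: leq_sum => i _; exact: di.
Qed.

Lemma cvg_expR_ln_nedges (R : realType) (tau : R) (m : nat -> nat) : 0 < tau ->
  (\forall n \near \oo, (n <= 2 * m n)%N) ->
  forall e : R, 0 < e -> \forall n \near \oo, expR (- tau * ln (m n)%:R) <= e.
Proof.
move=> tau0 nm e e0.
near=> n; have e1 : 2 * expR (tau^-1 * - ln e) <= n%:R.
  near: n; exact: nbhs_infty_ger.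
have h : (n <= 2 * m n)%N by near: n.
have h' : 2 * expR (tau^-1 * - ln e) <= 2 * (m n)%:R.
  by apply: le_trans e1 _; rewrite -natrM ler_nat.
have h2 : expR (tau^-1 * - ln e) <= (m n)%:R by lra.
have m0 : 0 < (m n)%:R :> R by exact: lt_le_trans (expR_gt0 _) h2.
rewrite -[leRHS]lnK ?posrE// ler_expR mulNr lerNl.
rewrite -ler_pdivrMl//.
by rewrite -[leLHS]expRK ler_ln ?posrE ?expR_gt0.
Unshelve. all: by end_near.
Qed.

Lemma norm_expR_sub1_le (R : realType) (x : R) :
  `|x| <= 2^-1 -> `|expR x - 1| <= 2 * `|x|.
Proof.
move=> xb; have := expR_ge1Dx x.
have /expR_le_quadratic := le_trans (ler_norm x) xb.
have := real_normK (num_real x); have := normr_ge0 x; have := ler_norm x.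
have := lerNnormlW (lexx `|x|); rewrite ler_norml; nra.
Qed.

(** With [x = D^2 h >= 1] one has [x <= x^2 <= M / 448]: once the error bound is small, the size
    condition of the finite estimates holds by itself. *)
Lemma sqr_le_of_fourth_le (R : realType) (D h M K e : R) :
  1 <= D -> 1 <= h -> 0 < M -> 0 < K ->
  D ^+ 4 * h ^+ 2 / M <= K * e -> e <= (448 * K)^-1 -> 448 * D ^+ 2 * h <= M.
Proof.
move=> D1 h1 M0 K0 H He.
have D2 : 1 <= D ^+ 2 by nra.
have : D ^+ 4 * h ^+ 2 / M <= 448^-1.
  apply: le_trans H _; have := ler_wpM2l (ltW K0) He.
  by rewrite invfM mulrCA divff ?gt_eqF// mulr1.
rewrite ler_pdivrMr// (_ : D ^+ 4 = D ^+ 2 * D ^+ 2); last by ring.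
move: (D ^+ 2) D2 => x x1 H2.
have xh1 : 1 <= x * h by rewrite mulr_ege1.
have : x * h <= x * x * h ^+ 2.
  by rewrite (_ : x * x * h ^+ 2 = x * h * (x * h)); [rewrite ler_peMr//; lra|ring].
by move=> H3; have := le_trans H3 H2; lra.
Qed.

Theorem theorem1p2 (R : realType) (tau : R) (htau : 0 < tau)
    (d : forall n : nat, degseq n) (G : forall n : nat, digraph n)
    (hd : \forall n \near \oo, graphical (d n) /\ no_isolated (d n))
    (hdmax : (fun n : nat => (dmax (d n))%:R : R^o) =O_\oo
             (fun n : nat => ((nedges (d n))%:R `^ (4^-1 - tau) : R^o)))
    (hG : \forall n \near \oo, simple_digraph (G n) /\ obeys (G n) (d n)) :
  exists2 eps : nat -> R, eps n @[n --> \oo] --> (0 : R) &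
    \forall n \near \oo,
      stub_matching_prob R (d n) (Some (G n))
      = (1 + eps n) * asymptotic_prob R (d n).
Proof.
move/eqO_exP : hdmax => [C C0 hC].
(* This r exceeds [1 / tau], which yields [1 <= 2 tau r], and it is at least 2. *)
pose r := (Num.truncn (tau^-1)).+2.
have r1 : (1 < r)%N by [].
have r0 : (0 < r)%N by [].
have rtau : 1 <= 2 * tau * r%:R.
  have : tau^-1 < r%:R by apply: lt_trans (truncnS_gt _) _; rewrite ltr_nat.
  by rewrite -(ltr_pM2l htau) divff ?gt_eqF// -mulrA; move: (tau * r%:R) => x; lra.
pose m n := nedges (d n).
have nm : \forall n \near \oo, (n <= 2 * m n)%N.
  by near=> n; apply: no_isolated_leq; near: n; apply: filterS hd => n [].
have small := cvg_expR_ln_nedges htau nm.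
set K1 := C ^+ 4 * (1 + tau^-1) ^+ 2.
set K2 := err_const R r * expR (r%:R^-1 * ln (4096 * C ^+ 2)) * K1.
have K10 : 0 < K1.
  by rewrite mulr_gt0 ?exprn_gt0// addr_gt0 ?invr_gt0.
have K20 : 0 < K2.
  apply: mulr_gt0 => //; apply: mulr_gt0; last exact: expR_gt0.
  rewrite /err_const; have := expR_ge0 (2 * (4 + 4 * r%:R) + (1 + r%:R^-1) : R); lra.
have small1 : \forall n \near \oo, expR (- tau * ln (m n)%:R) <= (448 * K1)^-1.
  by apply: small; rewrite invr_gt0 mulr_gt0 ?ltr0n.
have key : \forall n \near \oo, exists2 x : R,
    stub_matching_prob R (d n) (Some (G n)) / asymptotic_prob R (d n) = expR x &
    `|x| <= K2 * expR (- tau * ln (m n)%:R).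
  near=> n.
  have [Gs Gd] : simple_digraph (G n) /\ obeys (G n) (d n) by near: n.
  have m6 : (6 <= #|G n|)%N.
    rewrite -(nedges_card Gd); have : (n <= 2 * m n)%N by near: n.
    have : (12 <= n)%N by near: n; exact: nbhs_infty_ge.
    by rewrite /m; lia.
  have m0 : (0 < #|G n|)%N by exact: leq_trans m6.
  have D1 := D_ge1 R Gd m0.
  have DC : (dmax (d n))%:R <= C * expR ((4^-1 - tau) * ln (#|G n|%:R : R)).
    have : `|(dmax (d n))%:R : R| <= C * `|(nedges (d n))%:R `^ (4^-1 - tau)| by near: n.
    rewrite (nedges_card Gd) ger0_norm// ger0_norm ?powR_ge0//.
    by rewrite /powR pnatr_eq0 eqn0Ngt m0.
  have [Q1 Q2] := err_le Gd m6 htau r0 rtau C0 DC.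
  have e1 : expR (- tau * ln (#|G n|%:R : R)) <= (448 * K1)^-1.
    by rewrite -(nedges_card Gd); near: n.
  have dm : 448 * (dmax (d n))%:R ^+ 2 * harm1 R (G n) <= #|G n|%:R.
    by apply: sqr_le_of_fourth_le D1 (harm1_ge1 R m6) _ K10 Q1 e1; rewrite ltr0n.
  have [x xE xb] := stub_matching_ratio Gs Gd r1 m6 dm.
  exists x => //; apply: le_trans xb (le_trans Q2 _).
  by rewrite /m (nedges_card Gd).
exists (fun n => stub_matching_prob R (d n) (Some (G n)) / asymptotic_prob R (d n) - 1).
  apply/cvgr0Pnorm_le => e e0.
  have smallK e' : 0 < e' -> \forall n \near \oo, K2 * expR (- tau * ln (m n)%:R) <= e'.
    move=> e'0; have /small : 0 < K2^-1 * e' by rewrite mulr_gt0 ?invr_gt0.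
    by apply: filterS => n; rewrite ler_pdivlMl.
  have half : \forall n \near \oo, K2 * expR (- tau * ln (m n)%:R) <= 2^-1.
    by apply: smallK; lra.
  have halfe : \forall n \near \oo, K2 * expR (- tau * ln (m n)%:R) <= e / 2.
    by apply: smallK; lra.
  near=> n; have [x -> xb] : exists2 x : R,
      stub_matching_prob R (d n) (Some (G n)) / asymptotic_prob R (d n) = expR x &
      `|x| <= K2 * expR (- tau * ln (m n)%:R) by near: n.
  have x1 : `|x| <= 2^-1 by apply: le_trans xb _; near: n.
  have x2 : `|x| <= e / 2 by apply: le_trans xb _; near: n.
  by have := norm_expR_sub1_le x1; lra.
near=> n; have Gd : obeys (G n) (d n) by near: n; apply: filterS hG => n [].
by rewrite addrC subrK divfK// gt_eqF// (asymptotic_prob_gt0 R Gd).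
Unshelve. all: by end_near.
Qed.
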